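(* Let $X$ be a connected simplicial set with base vertex $v_*$, let $H$ be a group and let $\chi:\pi_1(|X|,v_* )\to H$ be a surjective group morphism. Let $\tau:X\to H$ be the induced map, $\tilde X$ the simplicial set with $\tilde X_n=H\times X_n$ twisted by $\tau$, and $\pi:\tilde X\to X$, $(h,\sigma)\mapsto\sigma$ (all as defined in the context). If $\chi$ is an isomorphism, then $|\tilde X|$ is the universal cover of $|X|$ (that is, a simply connected cover), and $\pi$ induces the corresponding covering map $|\tilde X|\to|X|$.
   Context: $X$ has face maps $\partial_i$ and degeneracy maps $s_i$, and $|X|$ is its geometric realization. Fix a maximal tree $T$ in the 1-skeleton of $X$ (regarded as a set of non-degenerate edges). The group $\pi_1(|X|,v_* )$ is identified with the group presented by one generator $g_e$ for each non-degenerate edge $e\notin T$ and one relation $g_{\partial_2\sigma}g_{\partial_0\sigma}g_{\partial_1\sigma}^{-1}=1$ for each non-degenerate 2-simplex $\sigma$, where $g_e=1$ for $e\in T$ and for degenerate edges $e$; put $\tau'(e)=g_e$. The map $\tau:X\to H$ (defined on all simplices of $X$) is given by: $\tau(v)=1$ for $v\in X_0$; $\tau(e)=1$ for $e\in T$; $\tau(s_0v)=1$ for $v\in X_0$; $\tau(e)=\chi(\tau'(e))$ for non-degenerate edges $e\notin T$; $\tau(\sigma)=\tau(\partial_0\sigma)$ for $\sigma\in X_n$, $n>1$. $\tilde X$ is given by $\tilde X_n=H\times X_n$, $\tilde s_i(h,\sigma)=(h,s_i\sigma)$, and, for $\sigma\in X_n$, $\tilde\partial_i(h,\sigma)=(h,\partial_i\sigma)$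 for $i<n$ and $\tilde\partial_n(h,\sigma)=(h\cdot\tau(\sigma)^{-1},\partial_n\sigma)$. It is a simplicial set and $\pi$ is a simplicial map. A continuous map $f:Y\to Z$ between path-connected spaces is a covering map if every $z\in Z$ has a neighborhood $U$ such that $f^{-1}(U)$ is a disjoint union of copies of $U$, each mapped homeomorphically onto $U$ by $f$; $Y$ is then a cover of $Z$. It is a universal cover if $Y$ is simply connected. *)

(* Defs.v *)
From HB Require Import structures.
From mathcomp Require Import all_boot all_order all_algebra.
From mathcomp Require Import generic_quotient lra zify.
From mathcomp Require Import all_classical all_reals all_analysis.
From mathcomp Require Import homotopy.

Set Implicit Arguments.
Unset Strict Implicit.
Unset Printing Implicit Defensive.

Import Order.TTheory GRing.Theory Num.Theory.
Import numFieldTopology.Exports numFieldNormedType.Exports.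

Local Open Scope classical_set_scope.
Local Open Scope ring_scope.
Local Open Scope quotient_scope.

Definition unit_interval (R : realType) : Type := set_type (`[0, 1]%classic : set R).

Section UnitInterval.
Variable R : realType.
Local Notation I := (unit_interval R).

HB.instance Definition _ := Topological.on I.

Definition clamp01 (x : R) : R := Num.max 0 (Num.min 1 x).

Lemma clamp01P (x : R) : clamp01 x \in (`[0, 1]%classic : set R).
Proof.
rewrite inE /= in_itv /= /clamp01 le_max lexx /= ge_max ler01 /=.
by rewrite ge_min lexx.
Qed.

Definition clampI (x : R) : I := SigSub (clamp01P x).

Lemma valI_itv (t : I) : 0 <= val t <= 1.
Proof. by have := valP t; rewrite inE /= in_itv. Qed.

Lemma clamp01_id (x : R) : 0 <= x <= 1 -> clamp01 x = x.
Proof. by case/andP=> x0 x1; rewrite /clamp01 (min_idPr x1) (max_idPr x0). Qed.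

Lemma clampIK (t : I) : clampI (val t) = t.
Proof. by apply: val_inj; rewrite /= clamp01_id// valI_itv. Qed.

Lemma valI_neq : clampI 0 != clampI 1.
Proof.
apply/eqP => /(congr1 val) /=; rewrite !clamp01_id ?lexx ?ler01//.
by move/eqP; rewrite eq_sym oner_eq0.
Qed.

HB.instance Definition _ := isBiPointed.Build I valI_neq.

Lemma val_zeroI : val (zero : I) = 0 :> R.
Proof. by rewrite /= clamp01_id// lexx ler01. Qed.

Lemma val_oneI : val (one : I) = 1 :> R.
Proof. by rewrite /= clamp01_id// lexx ler01. Qed.

Lemma clampI0 (x : R) : x <= 0 -> clampI x = zero.
Proof.
move=> x0; apply: val_inj; rewrite val_zeroI /= /clamp01.
by rewrite (min_idPr (le_trans x0 ler01)) (max_idPl x0).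
Qed.

Lemma clampI1 (x : R) : 1 <= x -> clampI x = one.
Proof.
by move=> x1; apply: val_inj; rewrite val_oneI /= /clamp01 (min_idPl x1) (max_idPr ler01).
Qed.

Lemma val_continuous_set (T : topologicalType) (A : set T) :
  continuous (set_val : A -> T).
Proof. exact: initial_continuous. Qed.

Lemma continuous_to_set (S T : topologicalType) (A : set T) (f : S -> A) :
  continuous (set_val \o f) -> continuous f.
Proof.
move=> /continuousP cf; apply/continuousP => U [V oV <-].
exact: (cf V oV).
Qed.

Lemma valI_continuous : continuous (val : I -> R).
Proof. exact: val_continuous_set. Qed.

Lemma maxr_continuous (T : topologicalType) (f g : T -> R) :
  continuous f -> continuous g -> continuous (fun x => Num.max (f x) (g x)).
Proof.
move=> cf cg x; exact: (@continuous_max R T f g x (cf x) (cg x)).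
Qed.

Lemma minr_continuous (T : topologicalType) (f g : T -> R) :
  continuous f -> continuous g -> continuous (fun x => Num.min (f x) (g x)).
Proof.
move=> cf cg x; exact: (@continuous_min R T f g x (cf x) (cg x)).
Qed.

Lemma clamp01_continuous : continuous clamp01.
Proof.
apply: maxr_continuous; first exact: cst_continuous.
by apply: minr_continuous; [exact: cst_continuous | by move=> x; exact: cvg_id].
Qed.

Lemma clampI_continuous : continuous clampI.
Proof. by apply: continuous_to_set; exact: clamp01_continuous. Qed.

Lemma paste_continuous (S T : topologicalType) (h : S -> R) (c : R) (f g : S -> T) :
  continuous h -> continuous f -> continuous g ->
  (forall x, h x = c -> f x = g x) ->
  continuous (fun x => if h x <= c then f x else g x).
Proof.
move=> ch cf cg fg.
have cA : closed [set x | h x <= c].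
  by apply: (@preimage_closed _ _ h _ _ (@closed_le _ c)) => y _; exact: ch.
have cB : closed [set x | c <= h x].
  by apply: (@preimage_closed _ _ h _ _ (@closed_ge _ c)) => y _; exact: ch.
have AB : [set x | h x <= c] `|` [set x | c <= h x] = setT.
  apply/seteqP; split=> // x _ /=.
  by case: (leP (h x) c) => [|/ltW]; [left|right].
pose k x := if h x <= c then f x else g x; change (continuous k).
have ck : {within setT, continuous k}.
  rewrite -AB; apply: withinU_continuous => //.
  - apply: subspace_eq_continuous (continuous_subspaceT cf) => x.
    by rewrite inE /= => hx; rewrite /from_subspace /k hx.
  - apply: subspace_eq_continuous (continuous_subspaceT cg) => x.
    rewrite inE /= => h2; rewrite /from_subspace /k; case: ifP => // h1.
    by rewrite fg//; apply/eqP; rewrite eq_le h1 h2.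
exact/continuous_subspace_setT.
Qed.

End UnitInterval.

Section Homotopy.
Variable R : realType.
Local Notation I := (unit_interval R).

Definition homotopic (T : topologicalType) (f g : I -> T) : Prop :=
  exists F : I * I -> T,
    [/\ continuous F,
        forall t, F (zero, t) = f t,
        forall t, F (one, t) = g t,
        forall s, F (s, zero) = f zero
      & forall s, F (s, one) = f one].

Definition pcat (T : Type) (f g : I -> T) (t : I) : T :=
  if val t <= 1 / 2 then f (clampI (2 * val t)) else g (clampI (2 * val t - 1)).

Definition revI (t : I) : I := clampI (1 - val t).

Definition path_rev (T : Type) (f : I -> T) : I -> T := f \o revI.

Section Raw.
Variable T : topologicalType.
Implicit Types f g h k : I -> T.

Lemma contcomp (S U W : topologicalType) (u : S -> U) (v : U -> W) :
  continuous u -> continuous v -> continuous (v \o u).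
Proof. by move=> cu cv x; apply: continuous_comp; [exact: cu|exact: cv]. Qed.

Lemma contpair (S U W : topologicalType) (u : S -> U) (v : S -> W) :
  continuous u -> continuous v -> continuous (fun x => (u x, v x)).
Proof. by move=> cu cv x; apply: cvg_pair; [exact: cu|exact: cv]. Qed.

Lemma clampI_comp (S : topologicalType) (u : S -> R) :
  continuous u -> continuous (fun x => clampI (u x)).
Proof. by move=> cu; exact: (contcomp cu (@clampI_continuous R)). Qed.

Lemma affine_continuous (S : topologicalType) (u : S -> R) (a b : R) :
  continuous u -> continuous (fun x => a * u x + b).
Proof.
move=> cu x; apply: (@cvgD R R^o); last exact: cvg_cst.
by apply: (@cvgM R); [exact: cvg_cst|exact: (cu x)].
Qed.

Lemma valI_comp (S : topologicalType) (u : S -> I) :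
  continuous u -> continuous (fun x => val (u x)).
Proof. by move=> cu; exact: (contcomp cu (@valI_continuous R)). Qed.

Lemma revI_continuous : continuous revI.
Proof.
rewrite (_ : revI = fun t => clampI ((- 1) * val t + 1)).
  by apply: clampI_comp; apply: affine_continuous; exact: valI_continuous.
by apply/funext => t; rewrite /revI; congr clampI; lra.
Qed.

Lemma scale_continuous (S : topologicalType) (u : S -> R) (a : R) :
  continuous u -> continuous (fun x => a * u x).
Proof.
move=> cu; rewrite (_ : (fun x => _) = fun x => a * u x + 0).
  exact: affine_continuous.
by apply/funext => x; rewrite addr0.
Qed.

Lemma val_revI (t : I) : val (revI t) = 1 - val t :> R.
Proof.
have := valI_itv t; rewrite /= => /andP[t0 t1].
by rewrite clamp01_id//; lra.
Qed.

Lemma revIK : involutive revI.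
Proof. by move=> t; apply: val_inj; rewrite !val_revI; lra. Qed.

Lemma revI0 : revI zero = one.
Proof. by apply: val_inj; rewrite val_revI val_zeroI val_oneI; lra. Qed.

Lemma revI1 : revI one = zero.
Proof. by apply: val_inj; rewrite val_revI val_zeroI val_oneI; lra. Qed.

Lemma prevK f : path_rev (path_rev f) = f.
Proof. by apply/funext => t; rewrite /path_rev /= revIK. Qed.

Lemma prev0 f : path_rev f zero = f one.
Proof. by rewrite /path_rev /= revI0. Qed.

Lemma prev1 f : path_rev f one = f zero.
Proof. by rewrite /path_rev /= revI1. Qed.

Lemma prev_continuous f : continuous f -> continuous (path_rev f).
Proof. by move=> cf; exact: (contcomp revI_continuous cf). Qed.

Lemma pcat0 f g : pcat f g zero = f zero.
Proof.
by rewrite /pcat val_zeroI ifT ?clampI0 //; lra.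
Qed.

Lemma pcat1 f g : pcat f g one = g one.
Proof.
by rewrite /pcat val_oneI ifF ?clampI1 //; lra.
Qed.

Lemma pcat_continuous f g : continuous f -> continuous g -> f one = g zero ->
  continuous (pcat f g).
Proof.
move=> cf cg fg; apply: paste_continuous.
- exact: valI_continuous.
- apply: (contcomp _ cf); apply: clampI_comp; apply: scale_continuous; exact: valI_continuous.
- apply: (contcomp _ cg); apply: clampI_comp; apply: affine_continuous.
  exact: valI_continuous.
- by move=> x ->; rewrite clampI1 ?clampI0 //; lra.
Qed.

Lemma homotopic_refl f : continuous f -> homotopic f f.
Proof.
move=> cf; exists (f \o snd); split=> //.
by apply: (contcomp _ cf) => x; exact: cvg_snd.
Qed.

Lemma homotopic_sym f g : homotopic f g -> homotopic g f.
Proof.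
move=> [F [cF F0 F1 Fl Fr]]; exists (fun st => F (revI st.1, st.2)); split=> /=.
- apply: (contcomp _ cF); apply: contpair.
    by apply: (contcomp _ revI_continuous) => x; exact: cvg_fst.
  by move=> x; exact: cvg_snd.
- by move=> t; rewrite revI0.
- by move=> t; rewrite revI1.
- by move=> s; rewrite Fl -F1 Fl.
- by move=> s; rewrite Fr -F1 Fr.
Qed.

Lemma homotopic_trans f g h : homotopic f g -> homotopic g h -> homotopic f h.
Proof.
move=> [F [cF F0 F1 Fl Fr]] [G [cG G0 G1 Gl Gr]].
exists (fun st => if val st.1 <= 1 / 2 then F (clampI (2 * val st.1), st.2)
                  else G (clampI (2 * val st.1 - 1), st.2)).
have c1 : continuous (fun st : I * I => val st.1 : R).
  by apply: valI_comp => x; exact: cvg_fst.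
have c2 : continuous (fun st : I * I => st.2) by move=> x; exact: cvg_snd.
split=> /=.
- apply: (@paste_continuous R (I * I)%type T (fun st => val st.1)) => //.
  + apply: (contcomp _ cF); apply: contpair => //; apply: clampI_comp; apply: scale_continuous; exact: c1.
  + apply: (contcomp _ cG); apply: contpair => //; apply: clampI_comp.
    exact: affine_continuous.
  + by move=> x ->; rewrite clampI1 ?clampI0 ?F1 ?G0//; lra.
- by move=> t; rewrite clamp01_id ?lexx ?ler01// ifT ?clampI0//; lra.
- by move=> t; rewrite clamp01_id ?lexx ?ler01// ifF ?clampI1//; lra.
- by move=> s; case: ifP => _; rewrite ?Fl ?Gl// -F1 Fl.
- by move=> s; case: ifP => _; rewrite ?Fr ?Gr// -F1 Fr.
Qed.

Lemma homotopic_ends f g : homotopic f g -> f zero = g zero /\ f one = g one.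
Proof.
by move=> [F [_ _ F1 Fl Fr]]; rewrite -(Fl one) -(Fr one) !F1.
Qed.

Lemma homotopic_pcat f f' g g' : homotopic f f' -> homotopic g g' ->
  f one = g zero -> homotopic (pcat f g) (pcat f' g').
Proof.
move=> [F [cF F0 F1 Fl Fr]] [G [cG G0 G1 Gl Gr]] fg.
exists (fun st => if val st.2 <= 1 / 2 then F (st.1, clampI (2 * val st.2))
                  else G (st.1, clampI (2 * val st.2 - 1))).
have c2 : continuous (fun st : I * I => val st.2 : R).
  by apply: valI_comp => x; exact: cvg_snd.
have c1 : continuous (fun st : I * I => st.1) by move=> x; exact: cvg_fst.
split=> /=.
- apply: (@paste_continuous R (I * I)%type T (fun st => val st.2)) => //.
  + apply: (contcomp _ cF); apply: contpair => //; apply: clampI_comp; apply: scale_continuous; exact: c2.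
  + apply: (contcomp _ cG); apply: contpair => //; apply: clampI_comp.
    exact: affine_continuous.
  + by move=> x ->; rewrite clampI1 ?clampI0 ?Fr ?Gl//; lra.
- by move=> t; rewrite /pcat F0 G0.
- by move=> t; rewrite /pcat F1 G1.
- by move=> s; rewrite clamp01_id ?lexx ?ler01// ifT ?clampI0 ?Fl ?pcat0//; lra.
- by move=> s; rewrite clamp01_id ?lexx ?ler01// ifF ?clampI1 ?Gr ?pcat1//; lra.
Qed.

Lemma homotopic_prev f g : homotopic f g -> homotopic (path_rev f) (path_rev g).
Proof.
move=> [F [cF F0 F1 Fl Fr]]; exists (fun st => F (st.1, revI st.2)); split=> /=.
- apply: (contcomp _ cF); apply: contpair.
    by move=> x; exact: cvg_fst.
  by apply: (contcomp _ revI_continuous) => x; exact: cvg_snd.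
- by move=> t; rewrite F0.
- by move=> t; rewrite F1.
- by move=> s; rewrite revI0 Fr prev0.
- by move=> s; rewrite revI1 Fl prev1.
Qed.

Lemma homotopic_convex (V : normedModType R) (A : set V) (f : A -> T)
    (u v : I -> A) :
  (forall x y (s : R), A x -> A y -> 0 <= s <= 1 -> A ((1 - s) *: x + s *: y)) ->
  continuous f -> continuous u -> continuous v ->
  u zero = v zero -> u one = v one -> homotopic (f \o u) (f \o v).
Proof.
move=> cA cf cu cv uv0 uv1.
have cS (x : A) : continuous (set_val : A -> V) by exact: val_continuous_set.
have mem (st : I * I) : (1 - val st.1) *: set_val (u st.2)
    + val st.1 *: set_val (v st.2) \in A.
  by rewrite inE; apply: cA; [exact: set_valP..|exact: valI_itv].
exists (fun st => f (SigSub (mem st))); split.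
- apply: (contcomp _ cf); apply: continuous_to_set => st.
  apply: cvgD; apply: cvgZ.
  + apply: cvgB; first exact: cvg_cst.
    by apply: valI_comp => x; exact: cvg_fst.
  + apply: (@contcomp _ _ _ (fun st => u st.2) set_val); last exact: val_continuous_set.
    by apply: (@contcomp _ _ _ snd u) => // x; exact: cvg_snd.
  + by apply: valI_comp => x; exact: cvg_fst.
  + apply: (@contcomp _ _ _ (fun st => v st.2) set_val); last exact: val_continuous_set.
    by apply: (@contcomp _ _ _ snd v) => // x; exact: cvg_snd.
- move=> t; rewrite /=; congr f; apply: val_inj => /=.
  by rewrite clamp01_id ?lexx ?ler01// subr0 scale1r scale0r addr0.
- move=> t; rewrite /=; congr f; apply: val_inj => /=.
  by rewrite clamp01_id ?lexx ?ler01// subrr scale1r scale0r add0r.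
- move=> s /=; congr f; apply: val_inj => /=.
  by rewrite -uv0 -scalerDl subrK scale1r.
- move=> s /=; congr f; apply: val_inj => /=.
  by rewrite -uv1 -scalerDl subrK scale1r.
Qed.

Lemma homotopic_reparam f (u v : I -> I) :
  continuous f -> continuous u -> continuous v ->
  u zero = v zero -> u one = v one -> homotopic (f \o u) (f \o v).
Proof.
move=> cf cu cv; apply: (@homotopic_convex R `[0, 1]%classic f u v) => //.
move=> x y s /=; rewrite !in_itv /= => /andP[x0 x1] /andP[y0 y1] /andP[s0 s1].
by rewrite /GRing.scale /=; apply/andP; split; nra.
Qed.

Lemma homotopic_pcat_cstl f : continuous f -> homotopic (pcat (cst (f zero)) f) f.
Proof.
move=> cf; have -> : pcat (cst (f zero)) f = f \o (fun t => clampI (2 * val t - 1)).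
  apply/funext => t; rewrite /pcat /=; case: ifP => // h.
  by rewrite clampI0//; lra.
apply: (@homotopic_reparam f _ id) => //.
- by apply: clampI_comp; apply: affine_continuous; exact: valI_continuous.
- by move=> x; exact: cvg_id.
- by rewrite val_zeroI clampI0//; lra.
- by rewrite val_oneI clampI1//; lra.
Qed.

Lemma homotopic_pcat_cstr f : continuous f -> homotopic (pcat f (cst (f one))) f.
Proof.
move=> cf; have -> : pcat f (cst (f one)) = f \o (fun t => clampI (2 * val t)).
  apply/funext => t; rewrite /pcat /=; case: leP => // h.
  by rewrite clampI1//; lra.
apply: (@homotopic_reparam f _ id) => //.
- by apply: clampI_comp; apply: scale_continuous; exact: valI_continuous.
- by move=> x; exact: cvg_id.
- by rewrite val_zeroI clampI0//; lra.
- by rewrite val_oneI clampI1//; lra.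
Qed.

Lemma homotopic_pcat_prev f : continuous f ->
  homotopic (pcat f (path_rev f)) (cst (f zero)).
Proof.
move=> cf.
have -> : pcat f (path_rev f) = f \o (fun t => clampI (Num.min (2 * val t) ((- 2) * val t + 2))).
  apply/funext => t; rewrite /pcat /path_rev /=; case: leP => h.
    by rewrite min_l//; lra.
  rewrite min_r; last by lra.
  have /= /andP[t0 t1] := valI_itv t.
  congr f; apply: val_inj; rewrite val_revI /= !clamp01_id; lra.
rewrite -[cst (f zero)]/(f \o cst zero).
apply: homotopic_reparam => //.
- apply: clampI_comp; apply: minr_continuous.
    by apply: scale_continuous; exact: valI_continuous.
  by apply: affine_continuous; exact: valI_continuous.
- exact: cst_continuous.
- by rewrite clampI0// val_zeroI ge_min; apply/orP; left; lra.
- by rewrite clampI0// val_oneI ge_min; apply/orP; right; lra.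
Qed.

Lemma homotopic_pcat_prevl f : continuous f ->
  homotopic (pcat (path_rev f) f) (cst (f one)).
Proof.
move=> cf; have := homotopic_pcat_prev (prev_continuous cf).
by rewrite prevK prev0.
Qed.

Lemma homotopic_pcatA f g h : continuous f -> continuous g -> continuous h ->
  f one = g zero -> g one = h zero ->
  homotopic (pcat (pcat f g) h) (pcat f (pcat g h)).
Proof.
move=> cf cg ch fg gh.
have -> : pcat (pcat f g) h = pcat f (pcat g h) \o
    (fun t => clampI (Num.min (2 * val t) (Num.min (1 * val t + 1 / 4) (1 / 2 * val t + 1 / 2)))).
  apply/funext => t; have /= /andP[t0 t1] := valI_itv t.
  rewrite /pcat /=.
  have [h1|h1] := leP (sval t) (1 / 2); last first.
    rewrite [Num.min (1 * _ + _) _]min_r; last by lra.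
    rewrite min_r; last by lra.
    rewrite clamp01_id; last by lra.
    rewrite ifF; last by lra.
    rewrite clamp01_id; last by lra.
    rewrite ifF; last by lra.
    by congr h; apply: val_inj => /=; congr clamp01; lra.
  rewrite [Num.min (1 * _ + _) _]min_l; last by lra.
  rewrite clamp01_id; last by lra.
  have [h2|h2] := leP (2 * sval t) (1 / 2).
    rewrite min_l; last by lra.
    rewrite clamp01_id; last by lra.
    by rewrite ifT; last lra.
  rewrite min_r; last by lra.
  rewrite clamp01_id; last by lra.
  rewrite ifF; last by lra.
  rewrite clamp01_id; last by lra.
  rewrite ifT; last by lra.
  by congr g; apply: val_inj => /=; congr clamp01; lra.
apply: (@homotopic_reparam _ _ id) => //.
- by apply: pcat_continuous; rewrite ?pcat0//; exact: pcat_continuous.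
- apply: clampI_comp; apply: minr_continuous.
    by apply: scale_continuous; exact: valI_continuous.
  by apply: minr_continuous; apply: affine_continuous; exact: valI_continuous.
- by move=> x; exact: cvg_id.
- by rewrite clampI0// val_zeroI ge_min; apply/orP; left; lra.
- by rewrite clampI1// val_oneI !le_min; apply/and3P; split; lra.
Qed.

End Raw.

Lemma homotopic_comp (T U : topologicalType) (f g : I -> T) (k : T -> U) :
  continuous k -> homotopic f g -> homotopic (k \o f) (k \o g).
Proof.
move=> ck [F [cF F0 F1 Fl Fr]]; exists (k \o F); split=> [|t|t|s|s] /=.
- exact: contcomp.
- by rewrite F0.
- by rewrite F1.
- by rewrite Fl.
- by rewrite Fr.
Qed.

Lemma pcat_comp (T U : Type) (f g : I -> T) (k : T -> U) :
  k \o pcat f g = pcat (k \o f) (k \o g).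
Proof. by apply/funext => t; rewrite /pcat /=; case: ifP. Qed.

End Homotopy.

Section FundamentalGroup.
Variables (R : realType) (T : topologicalType) (x0 : T).
Local Notation I := (unit_interval R).
Local Notation loop := {path I from x0 to x0 in T}.

Definition loop_homotopy (p q : loop) : bool := `[< homotopic (p : I -> T) q >].

Lemma loop_homotopy_refl : reflexive loop_homotopy.
Proof. by move=> p; apply/asboolP/homotopic_refl/cts_fun. Qed.

Lemma loop_homotopy_sym : symmetric loop_homotopy.
Proof. by move=> p q; apply: asbool_equiv_eq; split; exact: homotopic_sym. Qed.

Lemma loop_homotopy_trans : transitive loop_homotopy.
Proof.
by move=> q p r /asboolP pq /asboolP qr; apply/asboolP/(homotopic_trans pq qr).
Qed.

Definition loop_equiv :=
  EquivRel _ loop_homotopy_refl loop_homotopy_sym loop_homotopy_trans.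

Definition fundamental_group : Type := {eq_quot loop_equiv}.

HB.instance Definition _ := Choice.on fundamental_group.
HB.instance Definition _ := EqQuotient.on fundamental_group.

Section LoopClass.
Variables (f : I -> T) (cf : continuous f) (f0 : f zero = x0) (f1 : f one = x0).
Definition loop_class : fundamental_group :=
  \pi_fundamental_group (mk_path cf f0 f1 : loop).
End LoopClass.

Lemma loop_classP (f g : I -> T) (cf : continuous f) (f0 : f zero = x0)
    (f1 : f one = x0) (cg : continuous g) (g0 : g zero = x0) (g1 : g one = x0) :
  loop_class cf f0 f1 = loop_class cg g0 g1 <-> homotopic f g.
Proof.
split; first by move=> /eqmodP /asboolP.
by move=> fg; apply/eqmodP/asboolP.
Qed.

Lemma loop_class_repr (a : fundamental_group) :
  a = loop_class (@cts_fun _ _ (repr a : loop)) (path_zero (s := repr a))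
    (path_one (s := repr a)).
Proof.
rewrite -[LHS]reprK; apply/eqmodP/asboolP; apply: homotopic_refl; exact: cts_fun.
Qed.

Lemma pcat_loop_cont (p q : loop) : continuous (pcat p q).
Proof. by apply: pcat_continuous; rewrite ?path_one ?path_zero//; exact: cts_fun. Qed.

Lemma pcat_loop0 (p q : loop) : pcat p q zero = x0.
Proof. by rewrite pcat0 path_zero. Qed.

Lemma pcat_loop1 (p q : loop) : pcat p q one = x0.
Proof. by rewrite pcat1 path_one. Qed.

Lemma prev_loop_cont (p : loop) : continuous (path_rev p).
Proof. by apply: prev_continuous; exact: cts_fun. Qed.

Lemma prev_loop0 (p : loop) : path_rev p zero = x0.
Proof. by rewrite prev0 path_one. Qed.

Lemma prev_loop1 (p : loop) : path_rev p one = x0.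
Proof. by rewrite prev1 path_zero. Qed.

Definition fg_one : fundamental_group :=
  loop_class (@cst_continuous _ _ x0) erefl erefl.

Definition fg_mul (a b : fundamental_group) : fundamental_group :=
  loop_class (@pcat_loop_cont (repr a) (repr b)) (@pcat_loop0 _ _) (@pcat_loop1 _ _).

Definition fg_inv (a : fundamental_group) : fundamental_group :=
  loop_class (@prev_loop_cont (repr a)) (@prev_loop0 _) (@prev_loop1 _).

Lemma repr_loop_class (f : I -> T) (cf : continuous f) (f0 : f zero = x0)
    (f1 : f one = x0) :
  homotopic (repr (loop_class cf f0 f1) : I -> T) f.
Proof.
by have := loop_class_repr (loop_class cf f0 f1) => /loop_classP/homotopic_sym.
Qed.

Lemma fg_mulE (f g h : I -> T) (cf : continuous f) (f0 : f zero = x0)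
    (f1 : f one = x0) (cg : continuous g) (g0 : g zero = x0) (g1 : g one = x0)
    (ch : continuous h) (h0 : h zero = x0) (h1 : h one = x0) :
  homotopic (pcat f g) h ->
  fg_mul (loop_class cf f0 f1) (loop_class cg g0 g1) = loop_class ch h0 h1.
Proof.
move=> fgh; apply/loop_classP; apply: homotopic_trans fgh.
apply: homotopic_pcat; [exact: repr_loop_class..|].
by rewrite path_one path_zero.
Qed.

Lemma fg_mulA : associative fg_mul.
Proof.
move=> a b c; rewrite (loop_class_repr a) (loop_class_repr b) (loop_class_repr c).
move: (repr a) (repr b) (repr c) => p q r; apply/esym.
rewrite (fg_mulE (h := pcat p q) _ _ _ _ _ _ (@pcat_loop_cont p q) (@pcat_loop0 _ _) (@pcat_loop1 _ _));
  last by apply: homotopic_refl; exact: pcat_loop_cont.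
have cont : continuous (pcat p (pcat q r)).
  apply: pcat_continuous; [exact: cts_fun|exact: pcat_loop_cont|].
  by rewrite pcat_loop0 path_one.
have c0 : pcat p (pcat q r) zero = x0 by rewrite pcat0 path_zero.
have c1 : pcat p (pcat q r) one = x0 by rewrite pcat1 pcat_loop1.
rewrite (fg_mulE (f := q) (h := pcat q r) _ _ _ _ _ _ (@pcat_loop_cont q r) (@pcat_loop0 _ _) (@pcat_loop1 _ _));
  last by apply: homotopic_refl; exact: pcat_loop_cont.
rewrite (fg_mulE _ _ _ _ _ _ cont c0 c1).
  by apply/esym/fg_mulE; exact: homotopic_refl.
apply: homotopic_pcatA; [exact: cts_fun..| |].
  exact: (etrans (path_one (s := p)) (esym (path_zero (s := q)))).
exact: (etrans (path_one (s := q)) (esym (path_zero (s := r)))).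
Qed.

Lemma fg_mul1 : left_id fg_one fg_mul.
Proof.
move=> a; rewrite {2}(loop_class_repr a) [X in fg_mul _ X](loop_class_repr a).
apply: fg_mulE.
have := @homotopic_pcat_cstl R T (repr a) (@cts_fun _ _ _).
by rewrite (path_zero (s := repr a)).
Qed.

Lemma fg_mulr1 : right_id fg_one fg_mul.
Proof.
move=> a; rewrite {2}(loop_class_repr a) [X in fg_mul X _](loop_class_repr a).
apply: fg_mulE.
have := @homotopic_pcat_cstr R T (repr a) (@cts_fun _ _ _).
by rewrite (path_one (s := repr a)).
Qed.

Lemma fg_mulV : left_inverse fg_one fg_inv fg_mul.
Proof.
move=> a; rewrite [X in fg_mul _ X](loop_class_repr a).
apply: fg_mulE.
have := @homotopic_pcat_prevl R T (repr a) (@cts_fun _ _ _).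
by rewrite (path_one (s := repr a)).
Qed.

Lemma fg_mulrV : right_inverse fg_one fg_inv fg_mul.
Proof.
move=> a; rewrite [X in fg_mul X _](loop_class_repr a).
apply: fg_mulE.
have := @homotopic_pcat_prev R T (repr a) (@cts_fun _ _ _).
by rewrite (path_zero (s := repr a)).
Qed.

HB.instance Definition _ := isGroup.Build fundamental_group
  fg_mulA fg_mul1 fg_mulr1 fg_mulV fg_mulrV.

End FundamentalGroup.

Section Covering.
Variable R : realType.
Local Notation I := (unit_interval R).

Definition path_connected (T : topologicalType) : Prop :=
  [set: T] !=set0 /\ forall x y : T, inhabited {path I from x to y in T}.

Definition simply_connected (T : topologicalType) : Prop :=
  path_connected T /\ forall (x : T) (a : fundamental_group R x), a = 1%g.

Definition homeomorphism_on (Y Z : topologicalType) (f : Y -> Z)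
    (S : set Y) (U : set Z) : Prop :=
  [/\ set_bij S U f, {within S, continuous f}
    & exists g : Z -> Y, {within U, continuous g} /\ {in S, cancel f g}].

Definition covering_map (Y Z : topologicalType) (f : Y -> Z) : Prop :=
  [/\ path_connected Y, path_connected Z, continuous f
    & forall z : Z, exists2 U : set Z, nbhs z U &
      exists (J : Type) (S : J -> set Y),
        [/\ f @^-1` U = \bigcup_j S j,
            trivIset setT S,
            (* the sheets are open in the preimage of [U], so that the
               union is disjoint as a topological space *)
            forall j, exists2 O : set Y, open O & S j = f @^-1` U `&` O
          & forall j, homeomorphism_on f (S j) U]].

Definition universal_covering_map (Y Z : topologicalType) (f : Y -> Z) : Prop :=
  covering_map f /\ simply_connected Y.

End Covering.

Record sset := SSet {
  simplices :> nat -> choiceType;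
  face : forall n, 'I_n.+2 -> simplices n.+1 -> simplices n;
  degen : forall n, 'I_n.+1 -> simplices n -> simplices n.+1;
  (* In the five simplicial identities, [lift ord0 j] is j + 1 and
     [widen_ord _ i] is i as an element of the next larger ordinal. *)
  face_face : forall n (i j : 'I_n.+2) (x : simplices n.+2), (i <= j)%N ->
    face i (face (lift ord0 j) x) = face j (face (widen_ord (leqnSn _) i) x);
  degen_degen : forall n (i j : 'I_n.+1) (x : simplices n), (i <= j)%N ->
    degen (widen_ord (leqnSn _) i) (degen j x) = degen (lift ord0 j) (degen i x);
  face_degen_lt : forall n (i : 'I_n.+2) (j : 'I_n.+1) (x : simplices n.+1),
    (i <= j)%N ->
    face (widen_ord (leqnSn _) i) (degen (lift ord0 j) x) = degen j (face i x);
  face_degen_id : forall n (j : 'I_n.+1) (x : simplices n),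
    face (widen_ord (leqnSn _) j) (degen j x) = x;
  face_degen_succ : forall n (j : 'I_n.+1) (x : simplices n),
    face (lift ord0 j) (degen j x) = x;
  face_degen_gt : forall n (i : 'I_n.+2) (j : 'I_n.+1) (x : simplices n.+1),
    (j < i)%N ->
    face (lift ord0 i) (degen (widen_ord (leqnSn _) j) x) = degen j (face i x)
}.

Record smap (X Y : sset) := SMap {
  smap_fun :> forall n, X n -> Y n;
  smap_face : forall n (i : 'I_n.+2) (x : X n.+1),
    smap_fun (face i x) = face i (smap_fun x);
  smap_degen : forall n (i : 'I_n.+1) (x : X n),
    smap_fun (degen i x) = degen i (smap_fun x)
}.

Definition simplex (R : realType) (n : nat) : set 'rV[R]_n.+1 :=
  [set t | (forall i, 0 <= t ord0 i) /\ \sum_i t ord0 i = 1].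
Arguments simplex : clear implicits.

Section SimplexMap.
Variable R : realType.

(* The affine map sending the vertex [i] to the vertex [theta i]. *)
Definition push (m n : nat) (theta : 'I_m.+1 -> 'I_n.+1) (t : 'rV[R]_m.+1) :
    'rV[R]_n.+1 := \row_j \sum_(i | theta i == j) t ord0 i.

Lemma pushP (m n : nat) (theta : 'I_m.+1 -> 'I_n.+1) (t : simplex R m) :
  push theta (val t) \in simplex R n.
Proof.
have [t0 t1] := set_valP t; rewrite inE; split.
  by move=> i; rewrite mxE; apply: sumr_ge0 => j _; exact: t0.
rewrite -[RHS]t1 [RHS](partition_big theta xpredT)//=.
by apply: eq_bigr => j _; rewrite mxE.
Qed.

Definition simplex_map (m n : nat) (theta : 'I_m.+1 -> 'I_n.+1)
  (t : simplex R m) : simplex R n := SigSub (pushP theta t).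

Definition coface (n : nat) (i : 'I_n.+2) : simplex R n -> simplex R n.+1 :=
  simplex_map (lift i).

(* [unbump i] sends both [i] and [i.+1] to [i]. *)
Definition codegen (n : nat) (i : 'I_n.+1) : simplex R n.+1 -> simplex R n :=
  simplex_map (fun j : 'I_n.+2 => inord (unbump i j)).

End SimplexMap.

Section Realization.
Variable R : realType.

Section Space.
Variable X : sset.

Definition cell (x : {n & X n}) : topologicalType := simplex R (projT1 x).

Definition cells : Type := {x : {n & X n} & cell x}.

HB.instance Definition _ := Topological.on cells.

Definition in_cell (n : nat) (x : X n) (t : simplex R n) : cells :=
  existT cell (existT (fun n => X n) n x) t.

Inductive glue : cells -> cells -> Prop :=
| glue_face n (i : 'I_n.+2) (x : X n.+1) (t : simplex R n) :
    glue (in_cell (face i x) t) (in_cell x (coface i t))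
| glue_degen n (i : 'I_n.+1) (x : X n) (t : simplex R n.+1) :
    glue (in_cell (degen i x) t) (in_cell x (codegen i t))
| glue_refl a : glue a a
| glue_sym a b : glue a b -> glue b a
| glue_trans a b c : glue a b -> glue b c -> glue a c.

Definition glueb (a b : cells) : bool := `[< glue a b >].

Lemma glueb_refl : reflexive glueb.
Proof. by move=> a; apply/asboolP/glue_refl. Qed.

Lemma glueb_sym : symmetric glueb.
Proof. by move=> a b; apply: asbool_equiv_eq; split; exact: glue_sym. Qed.

Lemma glueb_trans : transitive glueb.
Proof. by move=> b a c /asboolP ab /asboolP bc; apply/asboolP/(glue_trans ab bc). Qed.

Definition glue_equiv := EquivRel _ glueb_refl glueb_sym glueb_trans.

Definition realization : Type := {eq_quot glue_equiv}.

HB.instance Definition _ := Topological.copy realization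
  (quotient_topology {eq_quot glue_equiv}).
HB.instance Definition _ := Quotient.on realization.

Definition point_of (n : nat) (x : X n) (t : simplex R n) : realization :=
  \pi_realization (in_cell x t).

Lemma pi_glueP (a b : cells) :
  \pi_realization a = \pi_realization b <-> glue a b.
Proof. by split=> [/eqmodP/asboolP|ab]; [|apply/eqmodP/asboolP]. Qed.

Lemma point_of_face n (i : 'I_n.+2) (x : X n.+1) (t : simplex R n) :
  point_of (face i x) t = point_of x (coface i t).
Proof. exact/pi_glueP/glue_face. Qed.

Lemma point_of_degen n (i : 'I_n.+1) (x : X n) (t : simplex R n.+1) :
  point_of (degen i x) t = point_of x (codegen i t).
Proof. exact/pi_glueP/glue_degen. Qed.

Lemma point_of_continuous n (x : X n) : continuous (point_of x).
Proof.
apply: (@contcomp _ _ _ (in_cell x) (\pi_realization)); last exact: pi_continuous.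
exact: (@existT_continuous _ cell (existT (fun n => X n) n x)).
Qed.

End Space.

Section Map.
Variables (X Y : sset) (f : smap X Y).

Definition cells_map (a : cells X) : cells Y :=
  in_cell (f _ (projT2 (projT1 a))) (projT2 a).

Definition realization_map (a : realization X) : realization Y :=
  \pi_(realization Y) (cells_map (repr a)).

Lemma cells_map_glue (a b : cells X) : glue a b -> glue (cells_map a) (cells_map b).
Proof.
elim=> [n i x t|n i x t|c|c d _|c d e _ + _] .
- by rewrite /cells_map /= smap_face; exact: glue_face.
- by rewrite /cells_map /= smap_degen; exact: glue_degen.
- exact: glue_refl.
- exact: glue_sym.
- exact: glue_trans.
Qed.

Lemma realization_mapE n (x : X n) (t : simplex R n) :
  realization_map (point_of x t) = point_of (f n x) t.
Proof.
apply/pi_glueP; apply: (@cells_map_glue _ (in_cell x t)).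
by apply/pi_glueP; rewrite reprK.
Qed.

End Map.
End Realization.

Section Graph.
Variable X : sset.

(* An edge goes from its vertex 0, which is face 1, to its vertex 1, which is
   face 0. *)
Definition edge_source (e : X 1) : X 0 := face ord_max e.
Definition edge_target (e : X 1) : X 0 := face ord0 e.

Definition degenerate_edge (e : X 1) : Prop := exists v : X 0, e = degen ord0 v.

(* The boolean is the direction of travel: [true] from vertex 0 to vertex 1. *)
Definition oriented_edge : Type := (X 1 * bool)%type.

HB.instance Definition _ := Choice.on oriented_edge.

Definition arc_source (a : oriented_edge) : X 0 :=
  if a.2 then edge_source a.1 else edge_target a.1.
Definition arc_target (a : oriented_edge) : X 0 :=
  if a.2 then edge_target a.1 else edge_source a.1.

Fixpoint is_walk (u : X 0) (p : seq oriented_edge) (v : X 0) : Prop :=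
  if p is a :: q then arc_source a = u /\ is_walk (arc_target a) q v else u = v.

Definition walk_in (E : set (X 1)) (u : X 0) (p : seq oriented_edge) (v : X 0) : Prop :=
  is_walk u p v /\ {in p, forall a, E a.1}.

Definition sset_connected : Prop := forall u v : X 0, exists p, is_walk u p v.

(* The vertex set [V] is part of the data because the tree with one vertex has
   no edge.  [tree_acyclic] excludes closed walks without repeated edges, hence
   also loops and pairs of parallel edges. *)
Record is_tree (V : set (X 0)) (E : set (X 1)) : Prop := IsTree {
  tree_nondegenerate : forall e, E e -> ~ degenerate_edge e;
  tree_ends : forall e, E e -> V (edge_source e) /\ V (edge_target e);
  tree_nonempty : V !=set0;
  tree_connected : forall u v, V u -> V v -> exists p, walk_in E u p v;
  tree_acyclic : forall u p, walk_in E u p u -> uniq (map fst p) -> p = [::]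
}.

Definition maximal_tree (T : set (X 1)) : Prop :=
  exists2 V : set (X 0), is_tree V T &
    forall V' T', is_tree V' T' -> V `<=` V' -> T `<=` T' -> V' = V /\ T' = T.

Lemma is_walk_cat u p v q w : is_walk u p v -> is_walk v q w -> is_walk u (p ++ q) w.
Proof. by elim: p u => [u -> //|a p IH u /= [-> h] hq]; split=> //; exact: IH. Qed.

Lemma is_walk_catE u p q w : is_walk u (p ++ q) w ->
  exists2 v, is_walk u p v & is_walk v q w.
Proof.
elim: p u => [u h|a p IH u /= [<- /IH[v h1 h2]]]; first by exists u.
by exists v.
Qed.

Lemma degenerate_ends (v : X 0) :
  edge_source (degen ord0 v) = v /\ edge_target (degen ord0 v) = v.
Proof.
split; rewrite /edge_source /edge_target.
  rewrite (_ : ord_max = lift ord0 ord0) ?face_degen_succ//; exact: val_inj.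
rewrite (_ : ord0 = widen_ord (leqnSn 1) ord0) ?face_degen_id//; exact: val_inj.
Qed.

Lemma walk_exit (V : set (X 0)) u p v : is_walk u p v -> V u -> ~ V v ->
  exists a, V (arc_source a) /\ ~ V (arc_target a).
Proof.
elim: p u => [u /= -> //|a p IH u /= [<- h] Vu nVv].
by have [Vt|nVt] := pselect (V (arc_target a)); [exact: IH h Vt nVv|exists a].
Qed.

Lemma walk_in_ends (V : set (X 0)) (E : set (X 1)) u p v : is_tree V E ->
  walk_in E u p v -> p != [::] -> V u /\ V v.
Proof.
move=> tV; elim: p u => // a p IH u [/= [<- h] Ea] _.
have Vend : V (arc_source a) /\ V (arc_target a).
  have [] := tree_ends tV (Ea a (mem_head _ _)).
  by rewrite /arc_source /arc_target; case: a.2.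
split; first by case: Vend.
case: p IH h Ea => [_ <- _|b p IH h Ea]; first by case: Vend.
have [] // := IH (arc_target a).
by split=> // c cp; apply: Ea; rewrite inE cp orbT.
Qed.

Lemma maximal_tree_spanning (T : set (X 1)) : sset_connected -> maximal_tree T ->
  exists2 V, is_tree V T & V = setT.
Proof.
move=> cX [V tV maxV]; exists V => //; apply/seteqP; split=> // w _.
apply: contrapT => nVw; have [v0 Vv0] := tree_nonempty tV.
have [p0 wp0] := cX v0 w.
have [a [Vs nVt]] := walk_exit wp0 Vv0 nVw.
have ndeg : ~ degenerate_edge a.1.
  move=> [v dv]; apply: nVt; move: Vs; rewrite /arc_source /arc_target dv.
  by have [-> ->] := degenerate_ends v; case: a.2.
have nTa : ~ T a.1.
  move=> /(tree_ends tV)[V1 V2]; apply: nVt.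
  by rewrite /arc_target; case: a.2.
pose V' := V `|` [set arc_target a]; pose T' := T `|` [set a.1].
have wT' u p v : walk_in T u p v -> walk_in T' u p v.
  by move=> [h Tp]; split=> // b bp; left; exact: Tp.
have wcat u p v q x : walk_in T' u p v -> walk_in T' v q x -> walk_in T' u (p ++ q) x.
  move=> [h1 h2] [h3 h4]; split; first exact: is_walk_cat h1 h3.
  by move=> b; rewrite mem_cat => /orP[/h2|/h4].
have wa : walk_in T' (arc_source a) [:: a] (arc_target a).
  by split=> // b; rewrite inE => /eqP ->; right.
have wa' : walk_in T' (arc_target a) [:: (a.1, ~~ a.2)] (arc_source a).
  split=> [|b].
    by rewrite /= /arc_source /arc_target /=; case: a.2.
  by rewrite inE => /eqP -> /=; right.
have tV' : is_tree V' T'.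
  split.
  - by move=> e [/(tree_nondegenerate tV)|->].
  - move=> e [/(tree_ends tV)[]|->]; first by split; left.
    move: Vs; rewrite /V' /arc_source /arc_target; case: a.2 => Vs.
      by split; [left|right].
    by split; [right|left].
  - by exists v0; left.
  - move=> u v [Vu|->] [Vv|->].
    + by have [p /wT'] := tree_connected tV Vu Vv; exists p.
    + have [p /wT' wp] := tree_connected tV Vu Vs.
      by exists (p ++ [:: a]); exact: wcat wp wa.
    + have [p /wT' wp] := tree_connected tV Vs Vv.
      by exists ([:: (a.1, ~~ a.2)] ++ p); exact: wcat wa' wp.
    + by exists [::].
  - move=> u p [wp T'p] up.
    have [ap|nap] := boolP (a.1 \in map fst p); last first.
      apply: (tree_acyclic tV (u := u)) => //; split=> // b bp.
      have [//|/= ba] := T'p b bp.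
      by case/negP: nap; apply/mapP; exists b.
    exfalso; have [b bp ab] := mapP ap.
    case/splitPr: bp wp T'p up {ap} => p1 p2 wp T'p.
    rewrite map_cat /= cat_uniq /= => /and3P[_ /norP[nb1 _] /andP[nb2 _]].
    have Tp c : c \in p2 ++ p1 -> T c.1.
      move=> cp; have cp' : c \in p1 ++ b :: p2.
        by move: cp; rewrite !mem_cat inE => /orP[]->; rewrite ?orbT.
      have [//|/= ca] := T'p c cp'.
      exfalso; move: cp; rewrite mem_cat => /orP[] cp.
        by case/negP: nb2; rewrite -ab -ca; apply: map_f.
      by case/negP: nb1; rewrite -ab -ca; apply: map_f.
    have [x w1 /= [sb w2]] := is_walk_catE wp.
    have w21 : is_walk (arc_target b) (p2 ++ p1) (arc_source b).
      by rewrite sb; exact: is_walk_cat w2 w1.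
    have nVb : ~ (V (arc_target b) /\ V (arc_source b)).
      move=> [Vt' Vs']; apply: nVt; move: Vt' Vs'.
      rewrite /arc_target /arc_source -ab; case: a.2; case: b.2 => //.
    have [p21|p21] := eqVneq (p2 ++ p1) [::].
      move: w21; rewrite p21 /= => tb; move: Vs nVt tb.
      rewrite /arc_source /arc_target -ab.
      by case: a.2; case: b.2 => Vs' nVt' tb; apply: nVt'; first [by rewrite tb | by rewrite -tb].
    exact/nVb/(walk_in_ends tV (conj w21 Tp)).
have [eV' _] := maxV _ _ tV' (@subsetUl _ _ _) (@subsetUl _ _ _).
by apply: nVt; rewrite -eV'; right.
Qed.

Lemma tree_path_exists (T : set (X 1)) (vs : X 0) :
  sset_connected -> maximal_tree T -> forall v, exists p, walk_in T vs p v.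
Proof.
move=> cX /(maximal_tree_spanning cX)[V tV eV] v.
by apply: (tree_connected tV); rewrite eV.
Qed.

Definition tree_path (T : set (X 1)) (vs : X 0) (cX : sset_connected)
    (mT : maximal_tree T) (v : X 0) : seq oriented_edge :=
  sval (cid (tree_path_exists vs cX mT v)).

Lemma tree_pathP (T : set (X 1)) (vs : X 0) (cX : sset_connected)
    (mT : maximal_tree T) (v : X 0) : walk_in T vs (tree_path vs cX mT v) v.
Proof. exact: (svalP (cid (tree_path_exists vs cX mT v))). Qed.

End Graph.

Section EdgePaths.
Variables (R : realType) (X : sset).
Local Notation I := (unit_interval R).

Lemma segment_subproof (n : nat) (i j : 'I_n.+1) (t : I) :
  (1 - val t) *: delta_mx ord0 i + val t *: delta_mx ord0 j \in simplex R n.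
Proof.
rewrite inE; split=> [k|].
  rewrite !mxE !eqxx /=; have /= := valI_itv t.
  by case: (k == i); case: (k == j) => /= /andP[t0 t1]; lra.
under eq_bigr do rewrite !mxE !eqxx /=.
rewrite big_split /= -!mulr_sumr.
have s1 k : \sum_(i0 < n.+1) (i0 == k)%:R = 1 :> R.
  rewrite (bigD1 k)//= eqxx big1 ?addr0// => l /negbTE ->//.
by rewrite !s1; lra.
Qed.

(* The segment from the vertex [i] to the vertex [j] of the simplex. *)
Definition segment (n : nat) (i j : 'I_n.+1) (t : I) : simplex R n :=
  SigSub (segment_subproof i j t).

Definition vertex (v : X 0) : realization R X :=
  point_of v (segment ord0 ord0 zero).

Definition edge_path (e : X 1) (t : I) : realization R X :=
  point_of e (segment ord0 ord_max t).

Definition arc_path (a : oriented_edge X) : I -> realization R X :=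
  if a.2 then edge_path a.1 else path_rev (edge_path a.1).

Fixpoint walk_path (u : X 0) (p : seq (oriented_edge X)) : I -> realization R X :=
  if p is a :: q then pcat (arc_path a) (walk_path (arc_target a) q)
  else cst (vertex u).

Lemma segment_continuous (n : nat) (i j : 'I_n.+1) : continuous (segment i j).
Proof.
apply: continuous_to_set.
have sc (V : normedModType R) (x y : V) :
    continuous (fun t : I => (1 - val t) *: x + val t *: y).
  have c1 : continuous (fun t : I => 1 - val t).
    rewrite (_ : (fun t => _) = fun t : I => (- 1) * val t + 1).
      exact: (affine_continuous (@valI_continuous R)).
    by apply/funext => z; lra.
  have h1 : continuous (fun t : I => (1 - val t) *: x).
    exact: (contcomp c1 (@scalel_continuous R V x)).
  have h2 : continuous (fun t : I => val t *: y).
    exact: (contcomp (@valI_continuous R) (@scalel_continuous R V y)).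
  by move=> t; exact: (cvgD (h1 t) (h2 t)).
exact: sc.
Qed.

Lemma segment_vertex (n : nat) (i : 'I_n.+1) (s t : I) :
  segment i i s = segment i i t.
Proof. by apply: val_inj; rewrite /= -!scalerDl !subrK. Qed.

Lemma segment0 (n : nat) (i j : 'I_n.+1) : segment i j zero = segment i i zero.
Proof.
apply: val_inj => /=.
by rewrite clamp01_id ?lexx ?ler01// !scale0r.
Qed.

Lemma segment1 (n : nat) (i j : 'I_n.+1) : segment i j one = segment j j zero.
Proof.
apply: val_inj => /=.
by rewrite !clamp01_id ?lexx ?ler01// subrr subr0 !scale0r add0r addr0.
Qed.

Lemma simplex_map_segment (m n : nat) (theta : 'I_m.+1 -> 'I_n.+1)
    (i j : 'I_m.+1) (t : I) :
  simplex_map theta (segment i j t) = segment (theta i) (theta j) t.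
Proof.
have pd (k : 'I_m.+1) (l : 'I_n.+1) (c : R) :
    \sum_(i0 < m.+1 | theta i0 == l) c * (i0 == k)%:R = c * (l == theta k)%:R.
  rewrite big_mkcond (bigD1 k)//= eqxx big1 ?addr0.
    by rewrite eq_sym; case: ifP => _; rewrite ?mulr1 ?mulr0.
  by move=> i0 /negbTE ->; rewrite mulr0; case: ifP.
apply: val_inj; apply/rowP => l; rewrite /= !mxE !eqxx /=.
by under eq_bigr do rewrite !mxE !eqxx /=; rewrite big_split /= !pd.
Qed.

Lemma edge_path_face (s : X 2) (i : 'I_3) (t : I) :
  edge_path (face i s) t = point_of s (segment (lift i ord0) (lift i ord_max) t).
Proof. by rewrite /edge_path point_of_face /coface simplex_map_segment. Qed.

Lemma vertex_face (e : X 1) (i : 'I_2) :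
  vertex (face i e) = point_of e (segment (lift i ord0) (lift i ord0) zero).
Proof. by rewrite /vertex point_of_face /coface simplex_map_segment. Qed.

Lemma edge_path_continuous (e : X 1) : continuous (edge_path e).
Proof. exact: (contcomp (@segment_continuous _ _ _) (@point_of_continuous R X 1 e)). Qed.

Lemma edge_path0 (e : X 1) : edge_path e zero = vertex (edge_source e).
Proof.
rewrite /edge_path segment0 vertex_face; congr (point_of e (segment _ _ _));
by apply: val_inj.
Qed.

Lemma edge_path1 (e : X 1) : edge_path e one = vertex (edge_target e).
Proof.
rewrite /edge_path segment1 vertex_face; congr (point_of e (segment _ _ _));
by apply: val_inj.
Qed.

Lemma edge_path_degenerate (v : X 0) (t : I) : edge_path (degen ord0 v) t = vertex v.
Proof.
rewrite /edge_path point_of_degen /codegen simplex_map_segment /vertex.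
congr point_of; rewrite (segment_vertex _ zero t); congr segment;
by apply: val_inj; rewrite /= inordK.
Qed.

Definition is_path (T : topologicalType) (x y : T) (f : I -> T) : Prop :=
  [/\ continuous f, f zero = x & f one = y].

Section PathAlgebra.
Variable T : topologicalType.
Implicit Types x y z w : T.

Lemma is_path_pcat x y z f g : is_path x y f -> is_path y z g -> is_path x z (pcat f g).
Proof.
move=> [cf f0 f1] [cg g0 g1]; split; rewrite ?pcat0 ?pcat1//.
by apply: pcat_continuous; rewrite ?f1 ?g0.
Qed.

Lemma is_path_prev x y f : is_path x y f -> is_path y x (path_rev f).
Proof.
by move=> [cf f0 f1]; split; rewrite ?prev0 ?prev1//; exact: prev_continuous.
Qed.

Lemma is_path_cst x : is_path x x (cst x).
Proof. by split=> //; exact: cst_continuous. Qed.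

Lemma hrefl x y f : is_path x y f -> homotopic f f.
Proof. by case=> cf _ _; exact: homotopic_refl. Qed.

Lemma hpcat x y z f f' g g' : is_path x y f -> is_path y z g ->
  homotopic f f' -> homotopic g g' -> homotopic (pcat f g) (pcat f' g').
Proof. by move=> [_ _ f1] [_ g0 _] ff gg; apply: homotopic_pcat; rewrite ?f1 ?g0. Qed.

Lemma hassoc x y z w f g h : is_path x y f -> is_path y z g -> is_path z w h ->
  homotopic (pcat (pcat f g) h) (pcat f (pcat g h)).
Proof.
move=> [cf f0 f1] [cg g0 g1] [ch h0 h1].
by apply: homotopic_pcatA; rewrite ?f1 ?g0 ?g1 ?h0.
Qed.

Lemma hidl x y f : is_path x y f -> homotopic (pcat (cst x) f) f.
Proof. by move=> [cf f0 f1]; have := homotopic_pcat_cstl cf; rewrite f0. Qed.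

Lemma hidr x y f : is_path x y f -> homotopic (pcat f (cst y)) f.
Proof. by move=> [cf f0 f1]; have := homotopic_pcat_cstr cf; rewrite f1. Qed.

Lemma hinvr x y f : is_path x y f -> homotopic (pcat f (path_rev f)) (cst x).
Proof. by move=> [cf f0 f1]; have := homotopic_pcat_prev cf; rewrite f0. Qed.

Lemma hinvl x y f : is_path x y f -> homotopic (pcat (path_rev f) f) (cst y).
Proof. by move=> [cf f0 f1]; have := homotopic_pcat_prevl cf; rewrite f1. Qed.

Lemma hcancel x y z f g : is_path x y f -> is_path y z g ->
  homotopic (pcat (path_rev f) (pcat f g)) g.
Proof.
move=> pf pg; apply: homotopic_trans (hidl pg).
apply: homotopic_trans (homotopic_sym (hassoc (is_path_prev pf) pf pg)) _.
apply: hpcat (hinvl pf) (hrefl pg); last exact: pg.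
exact: is_path_pcat (is_path_prev pf) pf.
Qed.

Lemma prev_pcat x y z f g : is_path x y f -> is_path y z g ->
  path_rev (pcat f g) = pcat (path_rev g) (path_rev f).
Proof.
move=> [_ _ f1] [_ g0 _]; apply/funext => t.
have /= /andP[t0 t1] := valI_itv t.
rewrite -[LHS]/(pcat f g (revI t)) /pcat val_revI /path_rev /=.
have [h1|h1] := leP (1 - sval t) (1 / 2).
  have [h2|h2] := leP (sval t) (1 / 2).
    have -> : sval t = 1 / 2 by lra.
    rewrite clampI1; last by lra.
    by rewrite clampI1 ?revI1 ?f1 ?g0//; lra.
  congr f; apply: val_inj; rewrite val_revI /= !clamp01_id; lra.
rewrite ifT; last by lra.
congr g; apply: val_inj; rewrite val_revI /= !clamp01_id; lra.
Qed.

End PathAlgebra.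

Lemma edge_is_path (e : X 1) :
  is_path (vertex (edge_source e)) (vertex (edge_target e)) (edge_path e).
Proof. by split; [exact: edge_path_continuous|exact: edge_path0|exact: edge_path1]. Qed.

Lemma arc_is_path (a : oriented_edge X) :
  is_path (vertex (arc_source a)) (vertex (arc_target a)) (arc_path a).
Proof.
rewrite /arc_source /arc_target /arc_path; case: a.2; first exact: edge_is_path.
exact: is_path_prev (edge_is_path _).
Qed.

Lemma walk_is_path u p v : is_walk u p v ->
  is_path (vertex u) (vertex v) (walk_path u p).
Proof.
elim: p u => [u /= ->|a p IH u /= [<- /IH h]]; first exact: is_path_cst.
exact: is_path_pcat (arc_is_path a) h.
Qed.

Lemma walk_path_cat u p v q w : is_walk u p v -> is_walk v q w ->
  homotopic (walk_path u (p ++ q)) (pcat (walk_path u p) (walk_path v q)).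
Proof.
elim: p u => [u /= -> wq|a p IH u /= [su wp] wq].
  exact: homotopic_sym (hidl (walk_is_path wq)).
have pa := arc_is_path a; have pp := walk_is_path wp; have pq := walk_is_path wq.
apply: homotopic_trans (homotopic_sym (hassoc pa pp pq)).
apply: hpcat pa _ (hrefl pa) (IH _ wp wq).
exact: walk_is_path (is_walk_cat wp wq).
Qed.

Definition arc_inv (a : oriented_edge X) : oriented_edge X := (a.1, ~~ a.2).

Lemma arc_path_inv a : arc_path (arc_inv a) = path_rev (arc_path a).
Proof. by rewrite /arc_path /=; case: a.2; rewrite //= prevK. Qed.

Lemma arc_source_inv a : arc_source (arc_inv a) = arc_target a.
Proof. by rewrite /arc_source /arc_target /=; case: a.2. Qed.

Lemma arc_target_inv a : arc_target (arc_inv a) = arc_source a.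
Proof. by rewrite /arc_source /arc_target /=; case: a.2. Qed.

Fixpoint walk_inv (p : seq (oriented_edge X)) : seq (oriented_edge X) :=
  if p is a :: q then walk_inv q ++ [:: arc_inv a] else [::].

Lemma is_walk_inv u p v : is_walk u p v -> is_walk v (walk_inv p) u.
Proof.
elim: p u => [u -> //|a p IH u /= [<- /IH h]]; apply: is_walk_cat h _.
by rewrite /= arc_source_inv arc_target_inv.
Qed.

Lemma walk_path_inv u p v : is_walk u p v ->
  homotopic (walk_path v (walk_inv p)) (path_rev (walk_path u p)).
Proof.
elim: p u => [u /= -> |a p IH u /= [su wp]].
  exact: homotopic_refl (@cst_continuous _ _ _).
have pa := arc_is_path a; have pp := walk_is_path wp.
rewrite (prev_pcat pa pp).
have wa : is_walk (arc_target a) [:: arc_inv a] (arc_source a).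
  by rewrite /= arc_source_inv arc_target_inv.
apply: homotopic_trans (walk_path_cat (is_walk_inv wp) wa) _.
apply: hpcat (walk_is_path (is_walk_inv wp)) (walk_is_path wa) (IH _ wp) _.
rewrite /= arc_target_inv arc_path_inv; exact: hidr (is_path_prev pa).
Qed.

Lemma walk_inv_in (E : set (X 1)) u p v : walk_in E u p v ->
  walk_in E v (walk_inv p) u.
Proof.
move=> [wp Ep]; split; first exact: is_walk_inv.
elim: p {wp} Ep => //= a p IH Ep b; rewrite mem_cat inE => /orP[bp|/eqP ->].
  by apply: IH bp => c cp; apply: Ep; rewrite inE cp orbT.
by apply: (Ep a); exact: mem_head.
Qed.

Lemma walk_in_cat (E : set (X 1)) u p v q w :
  walk_in E u p v -> walk_in E v q w -> walk_in E u (p ++ q) w.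
Proof.
move=> [h1 h2] [h3 h4]; split; first exact: is_walk_cat h1 h3.
by move=> b; rewrite mem_cat => /orP[/h2|/h4].
Qed.

Lemma walk_in_catE (E : set (X 1)) u p q w : walk_in E u (p ++ q) w ->
  exists2 v, walk_in E u p v & walk_in E v q w.
Proof.
move=> [/is_walk_catE[v h1 h2] Ep]; exists v; split=> // a ap; apply: Ep;
by rewrite mem_cat ap ?orbT.
Qed.

Lemma not_uniq_split (A : eqType) (B : eqType) (f : A -> B) (p : seq A) :
  ~~ uniq (map f p) ->
  exists p1 a p2 b p3, p = p1 ++ a :: p2 ++ b :: p3 /\ f a = f b.
Proof.
elim: p => //= a p IH; rewrite negb_and negbK => /orP[|/IH].
  move=> /mapP[b bp fab]; case/splitPr: bp => p2 p3.
  by exists [::], a, p2, b, p3.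
by move=> [p1 [c [p2 [b [p3 [-> h]]]]]]; exists (a :: p1), c, p2, b, p3.
Qed.

Lemma tree_walk_null (V : set (X 0)) (E : set (X 1)) u p : is_tree V E ->
  walk_in E u p u -> homotopic (walk_path u p) (cst (vertex u)).
Proof.
move=> tV; have [n] := ubnP (size p); elim: n p u => // n IH p u pn wp.
have [up|/not_uniq_split] := boolP (uniq (map fst p)).
  by rewrite (tree_acyclic tV wp up) /=; exact: homotopic_refl (@cst_continuous _ _ _).
move=> [p1 [a [p2 [b [p3 [ep ab]]]]]]; subst p.
have [x w1 w2] := walk_in_catE wp.
have [y w3 w4] := walk_in_catE (p := a :: p2) w2.
have [wpath Eab] := w3.
have [sa wp2] : arc_source a = x /\ is_walk (arc_target a) p2 y by case: wpath.
have [sb wp3] : arc_source b = y /\ is_walk (arc_target b) p3 u.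
  by case: w4 => -[].
have Ep2 : {in p2, forall c, E c.1}.
  by move=> c cp; apply: Eab; rewrite inE cp orbT.
have Ep3 : {in p3, forall c, E c.1}.
  by move=> c cp; case: w4 => _; apply; rewrite inE cp orbT.
move: pn; rewrite !size_cat /= size_cat /= => pn.
have P1 := walk_is_path (proj1 w1); have P2 := walk_is_path wp2.
have P3 := walk_is_path wp3; have Pa := arc_is_path a; have Pb := arc_is_path b.
rewrite sa in Pa; rewrite sb in Pb.
have key : homotopic (walk_path u (p1 ++ a :: p2 ++ b :: p3))
    (pcat (walk_path u p1) (pcat (pcat (arc_path a) (walk_path (arc_target a) p2))
       (pcat (arc_path b) (walk_path (arc_target b) p3)))).
  apply: homotopic_trans (walk_path_cat (proj1 w1) (proj1 w2)) _.
  apply: hpcat P1 (walk_is_path (proj1 w2)) (hrefl P1) _.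
  exact: (walk_path_cat (p := a :: p2) (proj1 w3) (proj1 w4)).
apply: homotopic_trans key _.
have [same|opp] := eqVneq a.2 b.2.
  have eab : a = b by move: ab same; case: a {Eab w1 w2 w3 w4 wp sa wpath wp2 Pa P2 pn} => ? ?;
    case: b {sb wp3 Pb P3} => ? ? /= -> ->.
  have exy : x = y by rewrite -sa -sb eab.
  rewrite -exy in w3 w4 P2 Pb.
  have null := IH (a :: p2) x _ w3.
  have w13 : walk_in E u (p1 ++ b :: p3) u by exact: walk_in_cat w1 w4.
  have null' := IH (p1 ++ b :: p3) u _ w13.
  apply: homotopic_trans (null' _); last by rewrite size_cat /=; lia.
  apply: homotopic_trans (homotopic_sym (walk_path_cat (proj1 w1) (proj1 w4))).
  apply: hpcat P1 _ (hrefl P1) _.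
    exact: is_path_pcat (is_path_pcat Pa P2) (is_path_pcat Pb P3).
  apply: homotopic_trans (hidl (is_path_pcat Pb P3)).
  apply: hpcat (is_path_pcat Pa P2) (is_path_pcat Pb P3) (null _) (hrefl (is_path_pcat Pb P3)).
  by rewrite /=; lia.
have eab : b = arc_inv a.
  move: ab opp; rewrite /arc_inv; case: a {Eab w1 w2 w3 w4 wp sa wpath wp2 Pa P2 pn} => e1 b1;
    case: b {sb wp3 Pb P3} => e2 b2 /= ->; by case: b1; case: b2.
have ey : y = arc_target a by rewrite -sb eab arc_source_inv.
have ex : arc_target b = x by rewrite eab arc_target_inv sa.
have null := IH p2 (arc_target a) _ (conj _ Ep2).
rewrite ey in wp2 P2 Pb.
rewrite ex in wp3 P3 Pb *.
have w13 : walk_in E u (p1 ++ p3) u by apply: walk_in_cat w1 _; split.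
have null' := IH (p1 ++ p3) u _ w13.
apply: homotopic_trans (null' _); last by rewrite size_cat /=; lia.
apply: homotopic_trans (homotopic_sym (walk_path_cat (proj1 w1) wp3)).
apply: hpcat P1 _ (hrefl P1) _.
  exact: is_path_pcat (is_path_pcat Pa P2) (is_path_pcat Pb P3).
have -> : arc_path b = path_rev (arc_path a) by rewrite eab arc_path_inv.
have PA := is_path_prev Pa.
apply: homotopic_trans.
  apply: hpcat (hrefl (is_path_pcat PA P3)); [exact: is_path_pcat Pa P2|exact: is_path_pcat PA P3|].
  apply: homotopic_trans (hidr Pa).
  by apply: hpcat Pa P2 (hrefl Pa) (null _ _) => //; lia.
have := hcancel PA P3; rewrite prevK; exact.
Qed.

End EdgePaths.

Section Generators.
Variables (R : realType) (X : sset) (T : set (X 1)) (vs : X 0).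
Hypotheses (cX : sset_connected X) (mT : maximal_tree T).
Local Notation I := (unit_interval R).

(* The loop that goes along [T] from the base vertex to the source of [e], then
   through [e], then back along [T].  The path chosen in [T] is irrelevant: two
   paths in [T] with the same endpoints are homotopic by [tree_walk_null]. *)
Definition edge_loop (e : X 1) : I -> realization R X :=
  pcat (walk_path vs (tree_path vs cX mT (edge_source e)))
    (pcat (edge_path e)
       (path_rev (walk_path vs (tree_path vs cX mT (edge_target e))))).

Lemma tree_path_is_path (v : X 0) : is_path (vertex R vs) (vertex R v)
  (walk_path vs (tree_path vs cX mT v)).
Proof. by apply: walk_is_path; case: (tree_pathP vs cX mT v). Qed.

Lemma edge_loop_is_path (e : X 1) :
  is_path (vertex R vs) (vertex R vs) (edge_loop e).
Proof.
apply: is_path_pcat (tree_path_is_path _) _.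
apply: is_path_pcat (edge_is_path _ _) _.
exact: is_path_prev (tree_path_is_path _).
Qed.

(* The standard identification of the fundamental group with the group generated
   by the nondegenerate edges outside [T] sends the generator g_e to the class of
   [edge_loop e].  In particular g_e = 1 if e is in [T] ([tau'_tree]) or degenerate
   ([tau'_degenerate]), and every 2-simplex gives its relation ([tau'_relation]). *)
Definition tau' (e : X 1) : fundamental_group R (vertex R vs) :=
  let: And3 c l r := edge_loop_is_path e in loop_class c l r.

Lemma tau'E (e : X 1) (g : I -> realization R X) (cg : continuous g)
    (g0 : g zero = vertex R vs) (g1 : g one = vertex R vs) :
  homotopic (edge_loop e) g -> tau' e = loop_class cg g0 g1.
Proof. by rewrite /tau'; case: (edge_loop_is_path e) => c l r h; apply/loop_classP. Qed.

Lemma tau'_tree (e : X 1) : T e -> tau' e = 1%g.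
Proof.
move=> Te; apply: tau'E.
have [V tV _] := mT.
set p := tree_path vs cX mT (edge_source e).
set q := tree_path vs cX mT (edge_target e).
have wp : walk_in T vs p (edge_source e) by exact: tree_pathP.
have wq : walk_in T vs q (edge_target e) by exact: tree_pathP.
have we : walk_in T (edge_source e) [:: (e, true)] (edge_target e).
  by split=> // b; rewrite inE => /eqP ->.
have wr := walk_in_cat we (walk_inv_in wq).
have := tree_walk_null R tV (walk_in_cat wp wr).
apply: homotopic_trans; apply: homotopic_sym.
apply: homotopic_trans (walk_path_cat R (proj1 wp) (proj1 wr)) _.
have Pp := walk_is_path R (proj1 wp); have Pr := walk_is_path R (proj1 wr).
apply: hpcat Pp Pr (hrefl Pp) _.
have Pe := edge_is_path R e.
exact: hpcat Pe (walk_is_path R (is_walk_inv (proj1 wq))) (hrefl Pe)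
  (walk_path_inv R (proj1 wq)).
Qed.

Lemma tau'_degenerate (v : X 0) : tau' (degen ord0 v) = 1%g.
Proof.
apply: tau'E; rewrite /edge_loop.
have [-> ->] := degenerate_ends v.
have -> : @edge_path R X (degen ord0 v) = cst (vertex R v).
  by apply/funext => t; rewrite edge_path_degenerate.
have Pv := tree_path_is_path v; have Pr := is_path_prev Pv.
apply: homotopic_trans (hinvr Pv).
exact: hpcat Pv (is_path_pcat (is_path_cst _ _) Pr) (hrefl Pv) (hidl Pr).
Qed.

Lemma triangle_homotopic (s : X 2) :
  homotopic (pcat (@edge_path R X (face ord_max s)) (edge_path (face ord0 s)))
    (edge_path (face (inord 1) s)).
Proof.
pose a0 : 'I_3 := ord0; pose a1 : 'I_3 := inord 1; pose a2 : 'I_3 := ord_max.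
have E (i : 'I_3) (j k : 'I_3) : lift i ord0 = j -> lift i ord_max = k ->
    @edge_path R X (face i s) = point_of s \o segment j k.
  by move=> <- <-; apply/funext => t; rewrite edge_path_face.
rewrite (E _ a0 a1); try (by apply: val_inj; rewrite /= ?inordK).
rewrite (E _ a1 a2); try (by apply: val_inj; rewrite /= ?inordK).
rewrite (E _ a0 a2); try (by apply: val_inj; rewrite /= ?inordK).
rewrite -pcat_comp; apply: homotopic_convex.
- move=> x y c [x0 x1] [y0 y1] /andP[c0 c1]; split=> [i|].
    by rewrite !mxE addr_ge0// mulr_ge0// subr_ge0.
  under eq_bigr do rewrite !mxE.
  by rewrite big_split /= -!mulr_sumr x1 y1; lra.
- exact: point_of_continuous.
- apply: pcat_continuous; [exact: segment_continuous..|].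
  by rewrite segment1 [RHS]segment0.
- exact: segment_continuous.
- by rewrite pcat0 segment0 [RHS]segment0.
- by rewrite pcat1 segment1 [RHS]segment1.
Qed.

Lemma triangle_vertices (s : X 2) :
  [/\ edge_source (face ord_max s) = edge_source (face (inord 1) s),
      edge_target (face ord_max s) = edge_source (face ord0 s)
    & edge_target (face ord0 s) = edge_target (face (inord 1) s)].
Proof.
pose a1 : 'I_2 := ord_max.
have e2 : lift ord0 (ord_max : 'I_2) = ord_max :> 'I_3 by exact: val_inj.
have e1 : lift ord0 (ord0 : 'I_2) = inord 1 :> 'I_3 by apply: val_inj; rewrite /= inordK.
have w1 : widen_ord (leqnSn 2) (ord_max : 'I_2) = inord 1.
  by apply: val_inj; rewrite /= inordK.
have w0 : widen_ord (leqnSn 2) (ord0 : 'I_2) = ord0 by exact: val_inj.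
rewrite /edge_source /edge_target; split.
- by rewrite -{1}e2 face_face// w1.
- by rewrite -{1}e2 face_face// w0.
- by rewrite -e1 face_face// w0.
Qed.

Lemma tau'_relation (s : X 2) :
  (tau' (face ord_max s) * tau' (face ord0 s))%g = tau' (face (inord 1) s).
Proof.
rewrite /tau'.
case: (edge_loop_is_path _) => c1 l1 r1; case: (edge_loop_is_path _) => c2 l2 r2.
case: (edge_loop_is_path _) => c3 l3 r3; apply: fg_mulE.
rewrite /edge_loop; have [v0 v1 v2] := triangle_vertices s.
rewrite -v0 -v2 -v1.
have := triangle_homotopic s.
have := edge_is_path R (face ord_max s).
have := edge_is_path R (face ord0 s).
rewrite -v1.
have PA := tree_path_is_path (edge_source (face ord_max s)).
have PB := tree_path_is_path (edge_target (face ord_max s)).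
have PC := tree_path_is_path (edge_target (face ord0 s)).
move: PA PB PC.
set A := walk_path _ _; set B := walk_path _ _; set C := walk_path _ _.
set f := edge_path _; set g := edge_path _; set h := edge_path _.
move=> PA PB PC Pg Pf fgh.
have PB' := is_path_prev PB; have PC' := is_path_prev PC.
have PX := is_path_pcat Pg PC'.
apply: homotopic_trans (hassoc PA (is_path_pcat Pf PB') (is_path_pcat PB PX)) _.
apply: hpcat PA (is_path_pcat (is_path_pcat Pf PB') (is_path_pcat PB PX)) (hrefl PA) _.
apply: homotopic_trans (hassoc Pf PB' (is_path_pcat PB PX)) _.
apply: homotopic_trans (hpcat Pf (is_path_pcat PB' (is_path_pcat PB PX)) (hrefl Pf) (hcancel PB PX)) _.
apply: homotopic_trans (homotopic_sym (hassoc Pf Pg PC')) _.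
exact: hpcat (is_path_pcat Pf Pg) PC' fgh (hrefl PC').
Qed.

Section Tau.
Variables (H : groupType) (chi : fundamental_group R (vertex R vs) -> H).

Definition tau1 (e : X 1) : H :=
  if `[< T e \/ degenerate_edge e >] then 1%g else chi (tau' e).

Fixpoint tau (n : nat) : X n -> H :=
  match n return X n -> H with
  | 0 => fun=> 1%g
  | m.+1 => match m return (X m -> H) -> X m.+1 -> H with
            | 0 => fun _ e => tau1 e
            | _.+1 => fun tau_m s => tau_m (face ord0 s)
            end (@tau m)
  end.

End Tau.
End Generators.

Section Twisted.
Variables (X : sset) (H : groupType) (t : forall n, X n -> H).

(* The conditions on [t] under which the twisted structure maps below satisfy
   the simplicial identities. *)
Record twisting : Prop := Twisting {
  twist_face_face : forall n (s : X n.+2),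
    (t (face ord_max s) * t s)%g = t (face (widen_ord (leqnSn _) ord_max) s);
  twist_face : forall n (i : 'I_n.+2) (s : X n.+2), (i <= n)%N ->
    t (face (widen_ord (leqnSn _) i) s) = t s;
  twist_degen : forall n (j : 'I_n.+1) (s : X n.+1),
    t (degen (widen_ord (leqnSn _) j) s) = t s;
  twist_degen_max : forall n (s : X n), t (degen ord_max s) = 1%g
}.

Definition twisted_simplices (n : nat) : choiceType := (H * X n)%type.

Definition twisted_face (n : nat) (i : 'I_n.+2) (hs : twisted_simplices n.+1) :
    twisted_simplices n :=
  (if i == ord_max then (hs.1 * (t hs.2)^-1)%g else hs.1, face i hs.2).

Definition twisted_degen (n : nat) (i : 'I_n.+1) (hs : twisted_simplices n) :
    twisted_simplices n.+1 := (hs.1, degen i hs.2).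

Hypothesis twt : twisting.

Lemma widen_max n (i : 'I_n) : (widen_ord (leqnSn n) i == ord_max) = false.
Proof. by apply/eqP => /(congr1 val) /= h; have := ltn_ord i; rewrite h ltnn. Qed.

Lemma lift0_max n (i : 'I_n.+1) : (lift ord0 i == ord_max) = (i == ord_max).
Proof. by rewrite -!val_eqE /= /bump /= add1n eqSS. Qed.

Lemma not_max n (i : 'I_n.+1) : (i < n)%N -> (i == ord_max) = false.
Proof. by move=> h; rewrite -val_eqE /=; apply/eqP => e; rewrite e ltnn in h. Qed.

Definition twisted_sset : sset.
Proof.
refine (@SSet twisted_simplices twisted_face twisted_degen _ _ _ _ _ _).
- move=> n i j [h s] ij; rewrite /twisted_face /=.
  rewrite widen_max lift0_max (face_face s ij); congr pair.
  have [->|jn] := eqVneq j ord_max; last first.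
    rewrite not_max//; apply: leq_ltn_trans ij _.
    by rewrite ltn_neqAle jn -ltnS ltn_ord.
  have [->|im] := eqVneq i ord_max.
    rewrite -(twist_face_face twt) (_ : lift ord0 ord_max = ord_max).
      by rewrite invgM mulgA.
    by apply/eqP; rewrite lift0_max.
  rewrite (twist_face twt)//.
  by rewrite -ltnS ltn_neqAle im -ltnS ltn_ord.
- by move=> n i j [h s] ij; rewrite /twisted_degen /= degen_degen.
- move=> n i j [h s] ij; rewrite /twisted_face /twisted_degen /=.
  by rewrite widen_max face_degen_lt// not_max// (leq_ltn_trans ij).
- move=> n j [h s]; rewrite /twisted_face /twisted_degen /=.
  by rewrite widen_max face_degen_id.
- move=> n j [h s]; rewrite /twisted_face /twisted_degen /=.
  rewrite lift0_max face_degen_succ; case: eqP => // ->.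
  by rewrite (twist_degen_max twt) invg1 mulg1.
- move=> n i j [h s] ij; rewrite /twisted_face /twisted_degen /=.
  by rewrite lift0_max face_degen_gt// (twist_degen twt).
Defined.

Definition twisted_proj : smap twisted_sset X :=
  @SMap twisted_sset X (fun n => snd) (fun _ _ _ => erefl) (fun _ _ _ => erefl).

End Twisted.

Section TauTwisting.
Variables (R : realType) (X : sset) (T : set (X 1)) (vs : X 0).
Hypotheses (cX : sset_connected X) (mT : maximal_tree T).
Variables (H : groupType).
Variable chi : {multiplicative fundamental_group R (vertex R vs) -> H}.
Local Notation tau := (tau cX mT chi).

Lemma chi1 : chi 1%g = 1%g.
Proof. by apply: (@mulgI H (chi 1%g)); rewrite -gmulfM !mulg1. Qed.

Lemma tau1E (e : X 1) : tau e = chi (tau' R vs cX mT e).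
Proof.
rewrite /= /tau1; case: asboolP => // -[Te|[v ->]].
  by rewrite tau'_tree// chi1.
by rewrite tau'_degenerate chi1.
Qed.

Lemma tau_twisting : twisting tau.
Proof.
split.
- elim=> [|n IH] s.
    rewrite -[tau s]/(tau (face ord0 s)) !tau1E -gmulfM tau'_relation.
    congr (chi (tau' _ _ _ _ (face _ s))).
    by apply: val_inj; rewrite /= inordK.
  have e1 : ord_max = lift ord0 (ord_max : 'I_n.+3) by exact: val_inj.
  have e2 : widen_ord (leqnSn n.+3) ord_max = lift ord0 (widen_ord (leqnSn n.+2) ord_max).
    exact: val_inj.
  have e0 : widen_ord (leqnSn n.+3) ord0 = ord0 by exact: val_inj.
  rewrite -[LHS]/(tau (face ord0 (face ord_max s)) * tau (face ord0 s))%g.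
  rewrite -[RHS]/(tau (face ord0 (face (widen_ord (leqnSn n.+3) ord_max) s))).
  by rewrite e2 {1}e1 !face_face// !e0 IH.
- elim=> [|n IH] i s.
    move=> i0; rewrite (_ : widen_ord _ i = ord0)//.
    by apply: val_inj => /=; case: (val i) i0.
  have e0 : widen_ord (leqnSn n.+3) ord0 = ord0 by exact: val_inj.
  have [j ->|->] := unliftP ord0 i => hi; last by rewrite e0.
  rewrite -[LHS]/(tau (face ord0 (face (widen_ord (leqnSn n.+3) (lift ord0 j)) s))).
  rewrite -[RHS]/(tau (face ord0 s)).
  have -> : widen_ord (leqnSn n.+3) (lift ord0 j) = lift ord0 (widen_ord (leqnSn n.+2) j).
    exact: val_inj.
  by rewrite face_face// e0 IH.
- elim=> [|n IH] j s.
    rewrite -[LHS]/(tau (face ord0 (degen (widen_ord (leqnSn 1) j) s))).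
    rewrite (_ : ord0 = widen_ord (leqnSn 2) (widen_ord (leqnSn 1) j)) ?face_degen_id//.
    by apply: val_inj; rewrite /= ord1.
  rewrite -[LHS]/(tau (face ord0 (degen (widen_ord (leqnSn n.+2) j) s))).
  have e0 : ord0 = widen_ord (leqnSn n.+3) ord0 by exact: val_inj.
  have [k ->|->] := unliftP ord0 j; last first.
    have -> : ord0 = widen_ord (leqnSn n.+3) (widen_ord (leqnSn n.+2) ord0).
      exact: val_inj.
    by rewrite face_degen_id.
  have -> : widen_ord (leqnSn n.+2) (lift ord0 k) = lift ord0 (widen_ord (leqnSn n.+1) k).
    exact: val_inj.
  by rewrite e0 face_degen_lt// IH.
- elim=> [|n IH] s.
    by rewrite /= /tau1 asboolT//; right; exists s; congr degen; exact: val_inj.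
  rewrite -[LHS]/(tau (face ord0 (degen ord_max s))).
  have e0 : ord0 = widen_ord (leqnSn n.+2) ord0 by exact: val_inj.
  have -> : ord_max = lift ord0 (ord_max : 'I_n.+1) by exact: val_inj.
  by rewrite e0 face_degen_lt// IH.
Qed.

Definition twisted_cover : sset := twisted_sset tau_twisting.

Definition twisted_cover_proj : smap twisted_cover X := twisted_proj tau_twisting.

End TauTwisting.

(* Main.v *)
From HB Require Import structures.
Require Import Defs.
From mathcomp Require Import all_boot all_order all_algebra.
From mathcomp Require Import generic_quotient lra zify.
From mathcomp Require Import all_classical all_reals all_analysis.
From mathcomp Require Import homotopy.

Set Implicit Arguments.
Unset Strict Implicit.
Unset Printing Implicit Defensive.

Import Order.TTheory GRing.Theory Num.Theory.
Import numFieldTopology.Exports numFieldNormedType.Exports.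

Local Open Scope classical_set_scope.
Local Open Scope ring_scope.
Local Open Scope quotient_scope.

(* The key construction is local contractibility of |X|.  For a nondegenerate
   simplex x0, consider the points of |X| that flow into the open cell of x0 when,
   in a closed simplex whose own cell is not that of x0, one moves away from the
   barycenter until the boundary is hit, and then continues in the face that was
   hit.  They form an open set, the star of x0.  Every closed simplex containing
   a point of the star also contains a point over the barycenter of x0, chosen
   continuously; moving linearly towards it contracts the star.  The construction
   commutes with maps of simplicial sets that preserve nondegeneracy, so the
   preimage in the twisted set of the star of x0 is the disjoint union of the
   stars of the lifts of x0: the projection is a covering map.

   Since the contraction moves every point inside one closed simplex, each path
   between vertices of |X| is homotopic to an edge walk, by an open-and-closed
   argument along the path.  A closed walk p at the base vertex lifts to a walk
   from (1, vs) to (h, vs), where h is the image of the class of p under chi.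
   As chi is onto, the twisted set is connected.  A loop upstairs at (1, vs) is
   homotopic to a walk, whose projection is killed by the injective map chi;
   lifting the null-homotopy shows that the loop is null-homotopic. *)

(** * Simplicial identities on indices *)

(** The vertices of a simplex in a simplicial set may coincide, so the usual star of a vertex, cut
    out by a positive coordinate, would contain the whole of a loop edge and not be contractible.
    Flowing away from the barycenter leaves out the barycenter of every nondegenerate simplex other
    than [x0], which avoids this. To descend to the realization, the flow must agree on faces and on
    degenerate simplices. On a face the minimal coordinate is 0 and nothing is subtracted; a
    degenerate simplex borrows the outcome of its root and splits it in the proportions of the
    point. Vectors are not normalized, so that a barycenter simply flows to the zero vector. The
    sheets over a star are translates of one another by left multiplication with [H], which commutes
    with a twist acting on the right; hence one lift of each point suffices. Homotopies are lifted
    along rays from the origin of the plane, which reduces existence and uniqueness to the lifting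
    of paths. *)

Ltac ordlia := rewrite /bump /=;
  repeat match goal with |- context [nat_of_bool (leq ?a ?b)] =>
    case: (leqP a b) => ? /= end; lia.

Section Indices.
Local Open Scope nat_scope.

Definition collapse (n : nat) (j : 'I_n.+1) (k : 'I_n.+2) : 'I_n.+1 :=
  inord (unbump j k).

Lemma val_collapse n (j : 'I_n.+1) (k : 'I_n.+2) :
  collapse j k = k - (j < k) :> nat.
Proof.
rewrite /collapse /unbump inordK//.
by have := ltn_ord j; have := ltn_ord k; case: ltnP => /=; lia.
Qed.

Variable X : sset.

Lemma degen_inj n (j : 'I_n.+1) : injective (@degen X n j).
Proof. by move=> x y /(congr1 (face (lift ord0 j))); rewrite !face_degen_succ. Qed.

Lemma face_degen_adj n (i : 'I_n.+2) (j : 'I_n.+1) (y : X n) :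
  (i == j :> nat) || (i == j.+1 :> nat) ->
  face i (degen j y) = y /\ forall k, collapse j (lift i k) = k.
Proof.
case/orP => /eqP ij.
  split=> [|k].
    by rewrite (_ : i = widen_ord (leqnSn _) j) ?face_degen_id//; exact: val_inj.
  by apply: ord_inj; rewrite val_collapse /= ij; ordlia.
split=> [|k].
  by rewrite (_ : i = lift ord0 j) ?face_degen_succ//; apply: val_inj.
by apply: ord_inj; rewrite val_collapse /= ij; ordlia.
Qed.

Lemma face_degen_far n (i : 'I_n.+3) (j : 'I_n.+2) (y : X n.+1) :
  ~~ ((i == j :> nat) || (i == j.+1 :> nat)) ->
  exists i' j', [/\ face i (degen j y) = degen j' (face i' y),
    forall k, collapse j (lift i k) = lift i' (collapse j' k)
    & collapse j i = i'].
Proof.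
move=> /norP[/eqP h1 /eqP h2]; have := ltn_ord i; have := ltn_ord j => jn im.
have [ij|ij] := ltnP i j.
  have hi : i < n.+2 by lia.
  have hj : j.-1 < n.+1 by lia.
  exists (Ordinal hi), (Ordinal hj); split.
  - rewrite -face_degen_lt /=; last by lia.
    by congr (face _ (degen _ y)); apply: ord_inj => /=; ordlia.
  - move=> k; apply: ord_inj; rewrite val_collapse /= val_collapse /=.
    by have := ltn_ord k; move: ij h1 h2 => /= *; ordlia.
  - by apply: ord_inj; rewrite val_collapse /=; ordlia.
have hi : i.-1 < n.+2 by lia.
have hj : j < n.+1 by lia.
exists (Ordinal hi), (Ordinal hj); split.
- rewrite -face_degen_gt /=; last by lia.
  by congr (face _ (degen _ y)); apply: ord_inj => /=; ordlia.
- move=> k; apply: ord_inj; rewrite val_collapse /= val_collapse /=.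
  by have := ltn_ord k; move: ij h1 h2 => /= *; ordlia.
- by apply: ord_inj; rewrite val_collapse /=; ordlia.
Qed.

(** The local confluence behind the uniqueness of the nondegenerate root of a simplex. The common
    root is the [j]-th face of [z], found by applying that face map to the equation. *)
Lemma degen_diamond_lt n (j k : 'I_n.+2) (y z : X n.+1) : j < k ->
  degen j y = degen k z ->
  exists a (j' k' : 'I_n.+1), [/\ y = degen k' a, z = degen j' a
    & forall i, collapse k' (collapse j i) = collapse j' (collapse k i)].
Proof.
move=> jk e; have := ltn_ord k; have := ltn_ord j => jn kn.
have hj : j < n.+1 by lia.
have hk : k.-1 < n.+1 by lia.
have ey : y = degen (Ordinal hk) (face j z).
  rewrite -face_degen_lt /=; last by lia.
  rewrite -[LHS](face_degen_id j) e; congr (face _ (degen _ z)).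
  by apply: ord_inj => /=; ordlia.
exists (face j z), (Ordinal hj), (Ordinal hk); split=> //.
  have -> : face j z = face k y.
    have ek : lift ord0 (Ordinal hk) = k by apply: ord_inj => /=; ordlia.
    by have := face_degen_succ (Ordinal hk) (face j z); rewrite ek -ey.
  rewrite -face_degen_gt /=; last by lia.
  rewrite -[LHS](face_degen_succ k) -e; congr (face _ (degen _ y)).
  exact: val_inj.
move=> i; apply: ord_inj; rewrite !val_collapse /=.
by have := ltn_ord i => *; ordlia.
Qed.

Lemma degen_diamond n (j k : 'I_n.+2) (y z : X n.+1) :
  degen j y = degen k z -> (j, y) = (k, z) \/
  exists a (j' k' : 'I_n.+1), [/\ y = degen k' a, z = degen j' a
    & forall i, collapse k' (collapse j i) = collapse j' (collapse k i)].
Proof.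
move=> e; case: (ltngtP j k) => jk.
- by right; exact: degen_diamond_lt jk e.
- have [a [j' [k' [h1 h2 h3]]]] := degen_diamond_lt jk (esym e).
  by right; exists a, k', j'; split=> // i; rewrite h3.
- have jk' : j = k by exact: ord_inj.
  by left; rewrite jk' in e *; rewrite (degen_inj e).
Qed.

(** Here [a] is the position of [i] once [i'] has been deleted, and [b] that of [i'] once [i] has
    been deleted. *)
Lemma face_swap n (i i' : 'I_n.+3) (w : X n.+2) : i != i' ->
  exists a b, [/\ lift i' a = i, lift i b = i',
    face a (face i' w) = face b (face i w)
    & forall k, lift i' (lift a k) = lift i (lift b k)].
Proof.
wlog ii : i i' / i < i'.
  move=> H h; have [ii|ii|ii] := ltngtP i i'.
  - exact: H.
  - rewrite eq_sym in h; have [a [b [h1 h2 h3 h4]]] := H _ _ ii h.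
    by exists b, a; split=> //; move=> k; rewrite h4.
  - by case/eqP: h; exact: val_inj.
move=> _; have := ltn_ord i; have := ltn_ord i' => jn kn.
have ha : i < n.+2 by lia.
have hb : i'.-1 < n.+2 by lia.
exists (Ordinal ha), (Ordinal hb); split.
- by apply: ord_inj => /=; ordlia.
- by apply: ord_inj => /=; ordlia.
- have ei : lift ord0 (Ordinal hb) = i' by apply: ord_inj => /=; ordlia.
  have /(_ w) := @face_face X n (Ordinal ha) (Ordinal hb); rewrite ei /= => -> //.
    by congr (face _ (face _ w)); exact: ord_inj.
  by lia.
- by move=> k; apply: ord_inj => /=; have := ltn_ord k => *; ordlia.
Qed.

End Indices.

(** * The attractor of a nondegenerate cell *)

Section PushForward.
Variable R : realType.

(** The action of [push] on arbitrary vectors, because the vectors met by [attract] need not have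
    sum 1. *)
Definition pushc (m n : nat) (theta : 'I_m -> 'I_n) (t : 'I_m -> R) : 'I_n -> R :=
  fun l => \sum_(k | theta k == l) t k.

Lemma pushc_ge0 m n (theta : 'I_m -> 'I_n) (t : 'I_m -> R) :
  (forall k, 0 <= t k) -> forall l, 0 <= pushc theta t l.
Proof. by move=> t0 l; apply: sumr_ge0. Qed.

Lemma pushc_eq0 m n (theta : 'I_m -> 'I_n) (t : 'I_m -> R) k :
  (forall k, 0 <= t k) -> pushc theta t (theta k) = 0 -> t k = 0.
Proof.
move=> t0 /eqP; rewrite psumr_eq0// => /allP /(_ k).
by rewrite mem_index_enum eqxx => /(_ isT) /eqP.
Qed.

Lemma pushc_sum m n (theta : 'I_m -> 'I_n) (t : 'I_m -> R) :
  \sum_l pushc theta t l = \sum_k t k.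
Proof. by rewrite [RHS](partition_big theta xpredT). Qed.

Lemma pushc_comp m n p (theta : 'I_m -> 'I_n) (eta : 'I_n -> 'I_p) (t : 'I_m -> R) :
  pushc eta (pushc theta t) = pushc (eta \o theta) t.
Proof.
apply/funext => l; rewrite /pushc [RHS](partition_big theta (fun k => eta k == l))//=.
apply: eq_bigr => k /eqP <-; apply: eq_bigl => i.
by case: (eqVneq (theta i) k) => [->|]; rewrite ?andbF ?eqxx.
Qed.

Lemma pushc_lift n (i : 'I_n.+1) (t : 'I_n -> R) k : pushc (lift i) t (lift i k) = t k.
Proof.
rewrite /pushc (big_pred1 k)// => l /=; rewrite (inj_eq lift_inj)//.
Qed.

Lemma pushc_lift0 n (i : 'I_n.+1) (t : 'I_n -> R) : pushc (lift i) t i = 0.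
Proof. by rewrite /pushc big_pred0// => l; rewrite eq_sym (negbTE (neq_lift _ _)). Qed.

Lemma pushc_drop n p (theta : 'I_n.+1 -> 'I_p) (i : 'I_n.+1) (t : 'I_n.+1 -> R) :
  t i = 0 -> pushc theta t = pushc (theta \o lift i) (t \o lift i).
Proof.
move=> ti; apply/funext => l; rewrite /pushc big_mkcond [RHS]big_mkcond /=.
by rewrite (bigD1_ord i)//= ti if_same add0r.
Qed.

Lemma pushc_id n (theta : 'I_n -> 'I_n) (t : 'I_n -> R) :
  (forall k, theta k = k) -> pushc theta t = t.
Proof.
by move=> h; apply/funext => l; rewrite /pushc (big_pred1 l)// => k; rewrite h.
Qed.

Lemma pushc_collapse_near n (i : 'I_n.+2) (j : 'I_n.+1) (t : 'I_n.+2 -> R) :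
  (forall k, collapse j (lift i k) = k) -> t i = 0 ->
  pushc (collapse j) t = t \o lift i.
Proof. by move=> h ti; rewrite (pushc_drop _ ti) pushc_id. Qed.

Lemma pushc_collapse_far n (i : 'I_n.+3) (j i' : 'I_n.+2) (j' : 'I_n.+1)
    (t : 'I_n.+3 -> R) :
  (forall k, collapse j (lift i k) = lift i' (collapse j' k)) -> t i = 0 ->
  pushc (collapse j) t i' = 0 /\
  pushc (collapse j) t \o lift i' = pushc (collapse j') (t \o lift i).
Proof.
move=> h ti; rewrite (pushc_drop _ ti).
rewrite (_ : collapse j \o lift i = lift i' \o collapse j'); last exact/funext.
rewrite -pushc_comp pushc_lift0; split=> //.
by apply/funext => k /=; rewrite pushc_lift.
Qed.

End PushForward.

Section Attract.
Variables (R : realType) (X : sset) (x0 : {n & X n}).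

Definition degenerate (n : nat) : X n -> Prop :=
  match n return X n -> Prop with
  | 0 => fun=> False
  | m.+1 => fun w => exists jy : 'I_m.+1 * X m, w = degen jy.1 jy.2
  end.

(** The strict inequalities keep the boundary of [x0] out of its own star, in agreement with the
    value 0 in lower dimensions ([attract_lowdim]). *)
Definition core (n : nat) (w : X n) (t : 'I_n.+1 -> R) : 'I_n.+1 -> R :=
  fun=> if `[< existT (fun n => X n) n w = x0 >] && [forall k, 0 < t k] then n.+1%:R^-1 else 0.

Definition argmin (n : nat) (t : 'I_n.+1 -> R) : 'I_n.+1 :=
  [arg min_(i < ord0 | true) t i]%O.

(* Splits each coordinate of [v] over the fibre of [collapse j] in the proportions
   of [t].  Where the fibre has total weight 0 the quotient is the junk value 0,
   which is correct as soon as [v] vanishes there ([pushc_spread]). *)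
Definition spread (n : nat) (j : 'I_n.+1) (t : 'I_n.+2 -> R) (v : 'I_n.+1 -> R)
  (k : 'I_n.+2) : R := t k * (v (collapse j k) / pushc (collapse j) t (collapse j k)).

Definition insert0 (n : nat) (i : 'I_n.+1) (v : 'I_n -> R) (k : 'I_n.+1) : R :=
  if unlift i k is Some l then v l else 0.

(** Up to a positive factor this is the projection from the barycenter onto the facet opposite to
    [i], when [t i] is minimal. The barycenter itself goes to the zero vector, whose attractor is 0
    by [attract_supp]. *)
Definition drop_min (n : nat) (i : 'I_n.+1) (t : 'I_n.+1 -> R) : 'I_n -> R :=
  fun l => t (lift i l) - t i.

(* Either zero or the coordinates of a point lying over the barycenter of [x0]
   ([point_of_attract]), reached by repeatedly projecting [t] from the barycenter
   of its simplex to the boundary.  The vector [t] is not renormalized after the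
   smallest coordinate has been subtracted. *)
Fixpoint attract (n : nat) : X n -> ('I_n.+1 -> R) -> 'I_n.+1 -> R :=
  match n return X n -> ('I_n.+1 -> R) -> 'I_n.+1 -> R with
  | 0 => fun w t => core w t
  | m.+1 => fun w t =>
    match pselect (degenerate w) with
    | left P => let jy := sval (cid P) in
        spread jy.1 t (attract jy.2 (pushc (collapse jy.1) t))
    | right _ => if `[< existT (fun n => X n) m.+1 w = x0 >] then core w t else
        insert0 (argmin t) (attract (face (argmin t) w) (drop_min (argmin t) t))
    end
  end.

Lemma argmin_le n (t : 'I_n.+1 -> R) k : t (argmin t) <= t k.
Proof. by rewrite /argmin; case: arg_minP => // i _ h; exact: h. Qed.

Lemma insert0_lift n (i : 'I_n.+1) (v : 'I_n -> R) k : insert0 i v (lift i k) = v k.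
Proof. by rewrite /insert0 liftK. Qed.

Lemma insert0_id n (i : 'I_n.+1) (v : 'I_n -> R) : insert0 i v i = 0.
Proof. by rewrite /insert0 unlift_none. Qed.

Lemma insert0E n (i : 'I_n.+1) (v : 'I_n -> R) : insert0 i v = pushc (lift i) v.
Proof.
apply/funext => k; case: (unliftP i k) => [l ->|->].
  by rewrite insert0_lift pushc_lift.
by rewrite insert0_id pushc_lift0.
Qed.

Lemma drop_min_ge0 n (i : 'I_n.+1) (t : 'I_n.+1 -> R) :
  (forall k, t i <= t k) -> forall l, 0 <= drop_min i t l.
Proof. by move=> h l; rewrite subr_ge0. Qed.

Lemma pushc_spread n (j : 'I_n.+1) (t : 'I_n.+2 -> R) (v : 'I_n.+1 -> R) :
  (forall l, pushc (collapse j) t l = 0 -> v l = 0) ->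
  pushc (collapse j) (spread j t v) = v.
Proof.
move=> h; apply/funext => l.
rewrite /pushc (eq_bigr (fun k => t k * (v l / pushc (collapse j) t l))).
  rewrite -mulr_suml -/(pushc _ _ _).
  have [e|ne] := eqVneq (pushc (collapse j) t l) 0; first by rewrite e h// mul0r.
  by rewrite mulrC divfK.
by move=> k /eqP <-.
Qed.

Lemma attract_nondegenerate n (w : X n.+1) (t : 'I_n.+2 -> R) :
  ~ degenerate w -> existT (fun n => X n) n.+1 w <> x0 ->
  attract w t = insert0 (argmin t) (attract (face (argmin t) w) (drop_min (argmin t) t)).
Proof. by move=> nd ne /=; case: pselect => // _; rewrite asboolF. Qed.

Lemma attract_core n (w : X n) (t : 'I_n.+1 -> R) :
  ~ degenerate w -> existT (fun n => X n) n w = x0 -> attract w t = core w t.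
Proof. by case: n w t => // n w t nd e /=; case: pselect => // _; rewrite asboolT. Qed.

(** Supplies the hypothesis of [pushc_spread]. In the flow case a zero coordinate makes the minimum
    0, so the subtraction changes nothing. *)
Lemma attract_supp n (w : X n) (t : 'I_n.+1 -> R) : (forall k, 0 <= t k) ->
  forall k, t k = 0 -> attract w t k = 0.
Proof.
have core0 m (x : X m) (u : 'I_m.+1 -> R) k : u k = 0 -> core x u k = 0.
  move=> uk; rewrite /core; case: ifP => // /andP[_ /forallP /(_ k)].
  by rewrite uk ltxx.
elim: n w t => [|n IH] w t t0 k tk; first exact: core0.
have [[[j y] /= ->]|nd] := pselect (degenerate w).
  by rewrite /=; case: pselect => [? /=|[]]; [rewrite /spread tk mul0r|exists (j, y)].
have [e|ne] := pselect (existT (fun n => X n) n.+1 w = x0); first by rewrite attract_core// core0.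
rewrite attract_nondegenerate//; case: (unliftP (argmin t) k) => [l kl|->]; last first.
  by rewrite insert0_id.
rewrite kl insert0_lift; apply: IH; first by apply: drop_min_ge0; exact: argmin_le.
rewrite /drop_min -kl tk; have := argmin_le t k; have := t0 (argmin t).
by rewrite tk; lra.
Qed.

(** The intermediate fibre weights cancel: in either order, the value of [v] is multiplied by [t i]
    over the weight of the composite fibre. *)
Lemma spread_spread n (j k : 'I_n.+2) (j' k' : 'I_n.+1) (t : 'I_n.+3 -> R)
    (v : 'I_n.+1 -> R) : (forall k, 0 <= t k) ->
  (forall i, collapse k' (collapse j i) = collapse j' (collapse k i)) ->
  spread j t (spread k' (pushc (collapse j) t) v) =
  spread k t (spread j' (pushc (collapse k) t) v).
Proof.
move=> t0 h; have hc : collapse k' \o collapse j = collapse j' \o collapse k.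
  exact/funext.
apply/funext => i; rewrite /spread !pushc_comp hc -h.
have [ti|ti] := eqVneq (t i) 0; first by rewrite ti !mul0r.
have p1 : pushc (collapse j) t (collapse j i) != 0.
  by apply: contra_neq ti; exact: pushc_eq0.
have p2 : pushc (collapse k) t (collapse k i) != 0.
  by apply: contra_neq ti; exact: pushc_eq0.
by congr (_ * _); rewrite [LHS]mulrC [RHS]mulrC !mulrA !mulVf// !mul1r.
Qed.

Lemma attract_chosen n (w : X n.+1) : degenerate w -> exists j y, w = degen j y /\
  forall t, attract w t = spread j t (attract y (pushc (collapse j) t)).
Proof.
move=> P; rewrite /=; case: pselect => // Q.
by exists (sval (cid Q)).1, (sval (cid Q)).2; split=> //; case: (cid Q).
Qed.

(** The definition uses a presentation picked by choice. Any other one shares a root with it by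
    [degen_diamond], and [spread_spread] equates the two splittings. *)
Lemma attract_degen n (j : 'I_n.+1) (y : X n) (t : 'I_n.+2 -> R) :
  (forall k, 0 <= t k) ->
  attract (degen j y) t = spread j t (attract y (pushc (collapse j) t)).
Proof.
elim: n j y t => [|n IH] j y t t0.
  have [|k [z [e ->]]] := @attract_chosen _ (degen j y); first by exists (j, y).
  rewrite (ord1 k) (ord1 j) in e *.
  by rewrite (degen_inj e).
have [|k [z [e ->]]] := @attract_chosen _ (degen j y); first by exists (j, y).
have [[-> ->]//|[a [j' [k' [ey ez h]]]]] := degen_diamond e.
rewrite ey ez !IH; try exact: pushc_ge0.
rewrite !pushc_comp (_ : collapse k' \o _ = collapse j' \o collapse k); last exact/funext.
exact/esym/spread_spread.
Qed.

Lemma attract_lowdim n (w : X n) (t : 'I_n.+1 -> R) : (n < projT1 x0)%N ->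
  attract w t = fun=> 0.
Proof.
have ne m (x : X m) : (m < projT1 x0)%N -> existT (fun n => X n) m x <> x0.
  by move=> mx e; rewrite -e /= ltnn in mx.
elim: n w t => [|n IH] w t nx; first by rewrite /= /core asboolF//; exact: ne.
have nx' : (n < projT1 x0)%N by exact: ltn_trans nx.
have [P|nd] := pselect (degenerate w).
  have [j [y [_ ->]]] := attract_chosen P; rewrite IH//.
  by apply/funext => k; rewrite /spread mul0r mulr0.
rewrite attract_nondegenerate//; last exact: ne.
by apply/funext => k; rewrite IH// /insert0; case: unlift.
Qed.

End Attract.

Arguments attract : simpl never.

(** * Compatibility of the attractor with faces *)

Section AttractFace.
Variables (R : realType) (X : sset) (x0 : {n & X n}).
Local Notation attract := (attract (R := R) x0).
Local Notation cellof w := (existT (fun n => X n) _ w).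

(** Both sides come from the common face of codimension 2. The hypothesis is [attract_face] in lower
    dimension, so that the lemma serves inside that induction and again after it. *)
Lemma insert0_swap n (w : X n.+1) (t : 'I_n.+2 -> R) i i' :
  (forall m (v : X m.+1) (u : 'I_m.+2 -> R) j, (m < n)%N -> (forall k, 0 <= u k) ->
     u j = 0 -> attract v u = insert0 j (attract (face j v) (u \o lift j))) ->
  (forall k, 0 <= t k) -> t i = 0 -> t i' = 0 ->
  insert0 i' (attract (face i' w) (t \o lift i')) =
  insert0 i (attract (face i w) (t \o lift i)).
Proof.
move=> H t0 ti ti'; have [->//|ii] := eqVneq i i'.
case: n w t i i' H t0 ti ti' ii => [|n] w t i i' H t0 ti ti' ii.
  (* A 1-simplex has no face of codimension 2, but then both coordinates vanish and so do both
     sides. *)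
  have tz k : t k = 0.
    case: (unliftP i k) => [l ->|->//]; case: (unliftP i i') => [l' e|e].
      by rewrite (ord1 l) -(ord1 l') -e.
    by rewrite e eqxx in ii.
  by apply/funext => k; rewrite /insert0; case: unlift => [l|];
    case: unlift => [l'|//]; rewrite !attract_supp//= ?tz.
have [a [b [h1 h2 h3 h4]]] := face_swap w ii.
rewrite (H _ (face i' w) _ a)//=; last by rewrite h1.
rewrite (H _ (face i w) _ b)//=; last by rewrite h2.
rewrite !insert0E !pushc_comp h3.
have -> : lift i' \o lift a = lift i \o lift b by apply/funext => k /=.
by congr (pushc _ (attract _ _)); apply/funext => k /=; rewrite h4.
Qed.

(** In the flow case the minimum is 0, so nothing is subtracted, and [insert0_swap] exchanges the
    chosen facet for facet [i]. If [w] is [x0] itself, both sides are 0. *)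
Lemma attract_face n (w : X n.+1) (t : 'I_n.+2 -> R) i :
  (forall k, 0 <= t k) -> t i = 0 ->
  attract w t = insert0 i (attract (face i w) (t \o lift i)).
Proof.
elim/ltn_ind: n w t i => n IH w t i t0 ti.
have t0i k : 0 <= (t \o lift i) k by exact: t0.
have [[[j y] /= ->]|nd] := pselect (degenerate w).
  rewrite attract_degen//.
  have [ij|ij] := boolP ((i == j :> nat) || (i == j.+1 :> nat)).
    have [-> h] := face_degen_adj y ij.
    apply/funext => k; rewrite /spread (pushc_collapse_near h ti).
    case: (unliftP i k) => [l ->|->]; last by rewrite ti mul0r insert0_id.
    rewrite h insert0_lift /=; have [e|ne] := eqVneq (t (lift i l)) 0.
      by rewrite e mul0r attract_supp.
    by rewrite mulrC divfK.
  case: n IH w t i t0 t0i ti j y ij => [|n] IH w t i t0 t0i ti j y ij.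
    by case/negP: ij; rewrite (ord1 j); case: i {t0i ti} => -[|[|]].
  have [i' [j' [-> h _]]] := face_degen_far y ij.
  rewrite attract_degen//.
  have [h1 h2] := pushc_collapse_far h ti.
  rewrite (IH n _ _ _ i')//; last exact: pushc_ge0.
  rewrite h2; apply/funext => k; rewrite {1}/spread.
  case: (unliftP i k) => [l ->|->]; last by rewrite ti mul0r insert0_id.
  by rewrite insert0_lift /spread h insert0_lift -h2.
have [e|ne] := pselect (cellof w = x0).
  rewrite attract_core// /core.
  have -> : [forall k, 0 < t k] = false.
    by apply/negbTE/forallPn; exists i; rewrite ti ltxx.
  rewrite andbF attract_lowdim; last by rewrite -e.
  by apply/funext => k; rewrite /insert0; case: unlift.
rewrite attract_nondegenerate//.
have tm : t (argmin t) = 0.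
  by apply/eqP; rewrite eq_le t0 -ti argmin_le.
rewrite (_ : drop_min _ _ = t \o lift (argmin t)).
  by apply: insert0_swap => // *; exact: IH.
by apply/funext => k; rewrite /drop_min tm subr0.
Qed.

(** Ties are immaterial: after subtraction all tied coordinates are 0 and [insert0_swap] applies. *)
Lemma attract_argmin n (w : X n.+1) (t : 'I_n.+2 -> R) i :
  ~ degenerate w -> cellof w <> x0 -> (forall k, t i <= t k) ->
  attract w t = insert0 i (attract (face i w) (drop_min i t)).
Proof.
move=> nd ne h; rewrite attract_nondegenerate//.
have e : t (argmin t) = t i by apply/eqP; rewrite eq_le h argmin_le.
have eD j : t j = t i -> drop_min j t = (fun k => t k - t i) \o lift j.
  by move=> ej; apply/funext => l; rewrite /drop_min ej.
rewrite !eD//; apply: insert0_swap => [m v u j _||//|//]; rewrite ?e ?subrr//.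
  exact: attract_face.
by move=> k; rewrite subr_ge0.
Qed.

Lemma attract_ge0 n (w : X n) (t : 'I_n.+1 -> R) :
  (forall k, 0 <= t k) -> forall k, 0 <= attract w t k.
Proof.
have core0 m (x : X m) (u : 'I_m.+1 -> R) k : 0 <= core x0 x u k.
  by rewrite /core; case: ifP => // _; rewrite invr_ge0.
elim: n w t => [|n IH] w t t0 k; first exact: core0.
have [[[j y] /= ->]|nd] := pselect (degenerate w).
  rewrite attract_degen// /spread mulr_ge0// divr_ge0//; last exact: pushc_ge0.
  by apply: IH; exact: pushc_ge0.
have [e|ne] := pselect (cellof w = x0); first by rewrite attract_core.
rewrite attract_nondegenerate// /insert0; case: unlift => // l.
by apply: IH; apply: drop_min_ge0; exact: argmin_le.
Qed.

Lemma spread_supp n (j : 'I_n.+1) (y : X n) (t : 'I_n.+2 -> R) : (forall k, 0 <= t k) ->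
  pushc (collapse j) (attract (degen j y) t) = attract y (pushc (collapse j) t).
Proof.
move=> t0; rewrite attract_degen// pushc_spread// => l; apply: attract_supp.
exact: pushc_ge0.
Qed.

(** The sum 1 is that of the barycenter in [core]; inserting a zero and splitting preserve it,
    whatever the sum of [t]. *)
Lemma attract_sum n (w : X n) (t : 'I_n.+1 -> R) : (forall k, 0 <= t k) ->
  (exists k, attract w t k != 0) -> \sum_k attract w t k = 1.
Proof.
have core1 m (x : X m) (u : 'I_m.+1 -> R) k : core x0 x u k != 0 ->
    \sum_k core x0 x u k = 1.
  rewrite /core; case: ifP => [_ _|]; last by rewrite eqxx.
  by rewrite sumr_const card_ord -[X in X = _]mulr_natl mulfV// pnatr_eq0.
elim: n w t => [|n IH] w t t0 [k]; first exact: core1.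
have [[[j y] /= ->]|nd] := pselect (degenerate w).
  move=> ne; rewrite -(pushc_sum (collapse j)) spread_supp//.
  apply: IH; first exact: pushc_ge0.
  exists (collapse j k); apply: contra_neq ne; rewrite attract_degen// /spread => ->.
  by rewrite mul0r mulr0.
have [e|ne] := pselect (cellof w = x0).
  by rewrite attract_core//; exact: core1.
rewrite attract_nondegenerate//; case: (unliftP (argmin t) k) => [l ->|->]; last first.
  by rewrite insert0_id eqxx.
rewrite insert0_lift insert0E pushc_sum => nz; apply: IH; last by exists l.
by apply: drop_min_ge0; exact: argmin_le.
Qed.

End AttractFace.

(** * Continuity of the attractor *)

Section AttractLimit.
Variables (R : realType) (X : sset) (x0 : {n & X n}).
Local Notation attract := (attract (R := R) x0).
Local Notation cellof w := (existT (fun n => X n) _ w).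

Lemma cvg_paste (S : Type) (Z : topologicalType) (A : finType) (F : set_system S) {FF : Filter F}
    (P : pred A) (f : S -> Z) (g : A -> S -> Z) (z : Z) :
  (forall a, P a -> g a s @[s --> F] --> z) ->
  (\forall s \near F, exists2 a, P a & f s = g a s) -> f s @[s --> F] --> z.
Proof.
move=> cg fg U zU.
have Hn : \forall s \near F, forall a, P a -> U (g a s).
  apply: filter_forall => a; case: (boolP (P a)) => Pa; last by apply: nearW.
  have H : F (g a @^-1` U) := cg a Pa U zU.
  by apply: filterS H => s Us _.
apply: filterS2 fg Hn => s [a Pa e] /(_ a Pa) Us.
by change (U (f s)); rewrite e.
Qed.

Lemma pushc_cvg (S : Type) (F : set_system S) {FF : Filter F} m n (theta : 'I_m -> 'I_n)
    (t : S -> 'I_m -> R) (u : 'I_m -> R) :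
  (forall k, t s k @[s --> F] --> u k) ->
  forall l, pushc theta (t s) l @[s --> F] --> pushc theta u l.
Proof.
by move=> ct l; apply: cvg_big => [|k _]; [exact: add_continuous|exact: ct].
Qed.

(* Near [u], only the faces opposite to a minimal coordinate of [u] are chosen. *)
Lemma attract_cvg (S : Type) (F : set_system S) {FF : Filter F} n (w : X n)
    (t : S -> 'I_n.+1 -> R) (u : 'I_n.+1 -> R) :
  (forall s k, 0 <= t s k) -> (forall k, 0 <= u k) ->
  (forall k, t s k @[s --> F] --> u k) -> (exists k, attract w u k != 0) ->
  forall k, attract w (t s) k @[s --> F] --> attract w u k.
Proof.
have core_cvg m (x : X m) (v : S -> 'I_m.+1 -> R) (a : 'I_m.+1 -> R) :
    (forall k, v s k @[s --> F] --> a k) -> (exists k, core x0 x a k != 0) ->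
    forall k, core x0 x (v s) k @[s --> F] --> core x0 x a k.
  move=> cv [k]; rewrite /core; case: ifP => [/andP[e /forallP a0] _ l|]; last by rewrite eqxx.
  have : \forall s \near F, forall k, 0 < v s k.
    by apply: filter_forall => i; exact: (cvgr_gt _ (cv i)).
  move=> H; apply: cvg_near_cst; apply: filterS H => s H.
  by rewrite e (introT forallP H).
elim: n w t u => [|n IH] w t u t0 u0 ct al; first exact: core_cvg.
have [[[j y] /= e]|nd] := pselect (degenerate w).
  subst w; move=> k; have cT l : pushc (collapse j) (t s) l @[s --> F] --> pushc (collapse j) u l.
    exact: pushc_cvg.
  have al' : exists k, attract y (pushc (collapse j) u) k != 0.
    case: al => l; rewrite attract_degen// => h; exists (collapse j l).
    by apply: contra_neq h; rewrite /spread => ->; rewrite mul0r mulr0.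
  have T0 s := pushc_ge0 (collapse j) (t0 s); have U0 := pushc_ge0 (collapse j) u0.
  have cy : attract y (pushc (collapse j) (t s)) (collapse j k) @[s --> F] -->
      attract y (pushc (collapse j) u) (collapse j k).
    exact: IH.
  have eq s : attract (degen j y) (t s) k = spread j (t s) (attract y (pushc (collapse j) (t s))) k.
    by rewrite attract_degen.
  rewrite (funext eq) attract_degen//.
  (* Where the limit of the fibre weight is 0, the quotient has no limit to rely on; instead the
     split value is squeezed between 0 and a coordinate of the attractor of [y] that tends to 0. *)
  have [z|nz] := eqVneq (pushc (collapse j) u (collapse j k)) 0; last first.
    apply: cvgM; first exact: ct.
    by apply: cvgM; [exact: cy|exact: cvgV (cT _)].
  have -> : spread j u (attract y (pushc (collapse j) u)) k = 0.
    by rewrite /spread (attract_supp _ _ U0 z) mul0r mulr0.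
  rewrite (attract_supp _ _ U0 z) in cy.
  apply: squeeze_cvgr (cvg_cst 0) cy; apply: nearW => s.
  have a0 := attract_ge0 x0 y (T0 s) (collapse j k).
  have [Tz|Tnz] := eqVneq (pushc (collapse j) (t s) (collapse j k)) 0.
    by rewrite /spread Tz invr0 !mulr0 lexx.
  rewrite /spread mulr_ge0 ?divr_ge0//= mulrCA ler_piMr//.
  rewrite ler_pdivrMr ?lt0r ?Tnz ?T0// mul1r.
  by rewrite /pushc (bigD1 k)//= lerDl sumr_ge0.
have [e|ne] := pselect (cellof w = x0).
  rewrite attract_core// in al *; move=> k.
  by under eq_fun do rewrite attract_core//; exact: core_cvg.
(* Truncation at 0 makes this branch nonnegative for every [s], as the induction hypothesis demands;
   it has no effect when [i] is minimal for [t s]. *)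
move=> k; pose g (i : 'I_n.+2) s :=
  insert0 i (attract (face i w) (fun l => Num.max 0 (drop_min i (t s) l))) k.
apply: (@cvg_paste _ _ _ _ _ (fun i => [forall l, u i <= u l]) _ g).
  move=> i /forallP ui; rewrite (attract_argmin nd ne ui).
  rewrite /g /insert0; case: unliftP => [l kl|_]; last exact: cvg_cst.
  apply: IH => [s l'||l'|].
  - by rewrite le_max lexx.
  - exact: drop_min_ge0.
  - rewrite -(max_idPr (drop_min_ge0 ui l')).
    have Hm : {for drop_min i u l', continuous (fun x : R => Num.max 0 x)}.
      move: (drop_min i u l'); apply: (@maxr_continuous R R (fun=> 0) (fun x => x)).
        exact: cst_continuous.
      by move=> x; exact: cvg_id.
    have Hc : drop_min i (t s) l' @[s --> F] --> drop_min i u l'.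
      by apply: (@cvgB R R^o); exact: ct.
    exact: (@continuous_cvg S R R F FF (fun s => drop_min i (t s) l') _ _ Hm Hc).
  - case: al => l'; rewrite (attract_argmin nd ne ui) /insert0; case: unlift => [l2|].
      by exists l2.
    by rewrite eqxx.
have Hm : \forall s \near F, forall i l, ~~ (u i <= u l) -> ~~ (t s i <= t s l).
  apply: filter_forall => i; apply: filter_forall => l; case: (boolP (u i <= u l)) => h.
    by apply: nearW.
  have Hc : t s i - t s l @[s --> F] --> u i - u l by apply: (@cvgB R R^o).
  have h' : 0 < u i - u l by rewrite subr_gt0 ltNge.
  have Hn : \forall s \near F, 0 < t s i - t s l by exact: cvgr_gt h'.
  by apply: filterS Hn => s + _; rewrite subr_gt0 -ltNge.
apply: filterS Hm => s hs; exists (argmin (t s)).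
  apply/forallP => l; apply: contraT => /hs; by rewrite argmin_le.
rewrite attract_nondegenerate// /g; congr (insert0 _ (attract _ _) _).
by apply/funext => l; rewrite (max_idPr _)// drop_min_ge0//; exact: argmin_le.
Qed.

End AttractLimit.

(** * Contraction of the open stars *)

Section Coords.
Variable R : realType.

Definition coords (n : nat) (t : simplex R n) (k : 'I_n.+1) : R := val t ord0 k.

Lemma coords_ge0 n (t : simplex R n) k : 0 <= coords t k.
Proof. by have [h0 h1] := set_valP t; first [exact: h0|exact: h1]. Qed.

Lemma coords_sum n (t : simplex R n) : \sum_k coords t k = 1.
Proof. by have [h0 h1] := set_valP t; first [exact: h0|exact: h1]. Qed.

Lemma coords_inj n : injective (@coords n).
Proof. by move=> s t st; apply: val_inj; apply/rowP => k; exact: (congr1 (@^~ k) st). Qed.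

Lemma coords_map m n (theta : 'I_m.+1 -> 'I_n.+1) (t : simplex R m) :
  coords (simplex_map theta t) = pushc theta (coords t).
Proof. by apply/funext => k; rewrite /coords /= mxE. Qed.

Lemma row_simplex n (v : 'I_n.+1 -> R) : (forall k, 0 <= v k) -> \sum_k v k = 1 ->
  (\row_k v k) \in simplex R n.
Proof.
move=> v0 v1; rewrite inE; split=> [k|]; first by rewrite mxE.
by under eq_bigr do rewrite mxE.
Qed.

Definition mk_simplex n (v : 'I_n.+1 -> R) (v0 : forall k, 0 <= v k)
  (v1 : \sum_k v k = 1) : simplex R n := SigSub (row_simplex v0 v1).

Lemma coords_mk n (v : 'I_n.+1 -> R) v0 v1 : coords (@mk_simplex n v v0 v1) = v.
Proof. by apply/funext => k; rewrite /coords /= mxE. Qed.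

Lemma cvg_simplex (S : Type) (F : set_system S) {FF : Filter F} n
    (f : S -> simplex R n) (a : simplex R n) :
  (forall k, coords (f s) k @[s --> F] --> coords a k) -> f s @[s --> F] --> a.
Proof.
move=> cf U; rewrite nbhsE; case=> O [oO Oa] OU; move: oO Oa OU.
case=> V oV <- /= Va OU.
have [P aP PV] : nbhs (set_val a) V by apply: open_nbhs_nbhs.
have H : \forall s \near F, forall k, P ord0 k (coords (f s) k).
  by apply: filter_forall => k; apply: (cf k); exact: aP.
apply: filterS H => s H; apply: OU => /=; apply: PV => i k.
by rewrite (ord1 i); exact: H.
Qed.

Lemma coords_continuous n k : continuous (fun t : simplex R n => coords t k).
Proof.
have h : continuous (fun M : 'rV[R]_n.+1 => M ord0 k) by exact: coord_continuous.
exact: (contcomp (@val_continuous_set _ _) h).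
Qed.

Lemma clamp01_itv (r : R) : 0 <= clamp01 r <= 1.
Proof. by have := clamp01P r; rewrite inE /= in_itv. Qed.

Lemma mix_proof n (a b : simplex R n) (r : R) :
  (forall k, 0 <= (1 - clamp01 r) * coords a k + clamp01 r * coords b k) /\
  \sum_k ((1 - clamp01 r) * coords a k + clamp01 r * coords b k) = 1.
Proof.
have /andP[r0 r1] := clamp01_itv r; split=> [k|].
  by rewrite addr_ge0// mulr_ge0 ?coords_ge0// subr_ge0.
by rewrite big_split /= -!mulr_sumr !coords_sum; lra.
Qed.

(** Clamping defines the segment for all real times, so that continuity has no boundary case at 0
    and 1. *)
Definition mix n (a b : simplex R n) (r : R) : simplex R n :=
  mk_simplex (mix_proof a b r).1 (mix_proof a b r).2.

Lemma coords_mix n (a b : simplex R n) r k :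
  coords (mix a b r) k = (1 - clamp01 r) * coords a k + clamp01 r * coords b k.
Proof. by rewrite coords_mk. Qed.

Lemma mix0 n (a b : simplex R n) : mix a b 0 = a.
Proof.
apply: coords_inj; apply/funext => k; rewrite coords_mix clamp01_id ?lexx ?ler01//.
by lra.
Qed.

Lemma mix1 n (a b : simplex R n) : mix a b 1 = b.
Proof.
apply: coords_inj; apply/funext => k; rewrite coords_mix clamp01_id ?lexx ?ler01//.
by lra.
Qed.

Lemma simplex_map_mix m n (theta : 'I_m.+1 -> 'I_n.+1) (a b : simplex R m) r :
  simplex_map theta (mix a b r) = mix (simplex_map theta a) (simplex_map theta b) r.
Proof.
apply: coords_inj; apply/funext => k; rewrite coords_mix !coords_map /pushc.
under eq_bigr do rewrite coords_mix.
by rewrite big_split /= -!mulr_sumr.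
Qed.

End Coords.

(** * Stars and drift on the realization *)

Section Star.
Variables (R : realType) (X : sset) (x0 : {n & X n}).
Local Notation attract := (attract (R := R) x0).
Local Notation cellof w := (existT (fun n => X n) _ w).

Definition alive (n : nat) (w : X n) (t : simplex R n) : Prop :=
  exists k, attract w (coords t) k != 0.

(** The fallback value [t] also commutes with cofaces and codegeneracies, so [drift] is well defined
    on the whole realization and stationary off the star. *)
Definition target (n : nat) (w : X n) (t : simplex R n) : simplex R n :=
  if pselect (alive w t) is left h then
    mk_simplex (attract_ge0 x0 w (coords_ge0 t)) (attract_sum (coords_ge0 t) h)
  else t.

Lemma coords_target n (w : X n) (t : simplex R n) : alive w t ->
  coords (target w t) = attract w (coords t).
Proof. by rewrite /target; case: pselect => // h _; rewrite coords_mk. Qed.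

Lemma target_dead n (w : X n) (t : simplex R n) : ~ alive w t -> target w t = t.
Proof. by rewrite /target; case: pselect. Qed.

Lemma attract_coface n (w : X n.+1) (i : 'I_n.+2) (t : simplex R n) :
  attract w (coords (coface i t)) = pushc (lift i) (attract (face i w) (coords t)).
Proof.
rewrite (@attract_face _ _ _ _ _ _ i); last by rewrite coords_map pushc_lift0.
  rewrite insert0E (_ : coords _ \o _ = coords t)//.
  by apply/funext => k /=; rewrite coords_map pushc_lift.
exact: coords_ge0.
Qed.

Lemma attract_codegen n (w : X n) (i : 'I_n.+1) (t : simplex R n.+1) :
  attract w (coords (codegen i t)) = pushc (collapse i) (attract (degen i w) (coords t)).
Proof. by rewrite coords_map spread_supp//; exact: coords_ge0. Qed.

Lemma alive_coface n (w : X n.+1) (i : 'I_n.+2) (t : simplex R n) :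
  alive w (coface i t) <-> alive (face i w) t.
Proof.
rewrite /alive attract_coface; split=> -[k].
  case: (unliftP i k) => [l ->|->]; last by rewrite pushc_lift0 eqxx.
  by rewrite pushc_lift; exists l.
by move=> h; exists (lift i k); rewrite pushc_lift.
Qed.

Lemma alive_codegen n (w : X n) (i : 'I_n.+1) (t : simplex R n.+1) :
  alive w (codegen i t) <-> alive (degen i w) t.
Proof.
have a0 := attract_ge0 x0 (degen i w) (coords_ge0 t).
rewrite /alive attract_codegen; split=> -[k] h.
  apply: contrapT => /forallNP H; case/eqP: h.
  by rewrite /pushc big1// => l _; have /negP := H l; rewrite negbK => /eqP.
by exists (collapse i k); apply: contra_neq h => /(pushc_eq0 a0).
Qed.

Lemma target_coface n (w : X n.+1) (i : 'I_n.+2) (t : simplex R n) :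
  target w (coface i t) = coface i (target (face i w) t).
Proof.
have [h|h] := pselect (alive (face i w) t).
  have h' : alive w (coface i t) by apply/alive_coface.
  apply: coords_inj; rewrite coords_target// attract_coface coords_map coords_target//.
by rewrite !target_dead// => /alive_coface.
Qed.

Lemma target_codegen n (w : X n) (i : 'I_n.+1) (t : simplex R n.+1) :
  target w (codegen i t) = codegen i (target (degen i w) t).
Proof.
have [h|h] := pselect (alive (degen i w) t).
  have h' : alive w (codegen i t) by apply/alive_codegen.
  apply: coords_inj; rewrite coords_target// attract_codegen coords_map coords_target//.
by rewrite !target_dead// => /alive_codegen.
Qed.

Definition star : set (realization R X) :=
  [set z | alive (projT2 (projT1 (repr z))) (projT2 (repr z))].

Definition drift (z : realization R X) (r : R) : realization R X :=
  let w := projT2 (projT1 (repr z)) in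
  let t := projT2 (repr z) in point_of w (mix t (target w t) r).

Lemma star_drift_glue (a b : cells R X) : Defs.glue a b ->
  (alive (projT2 (projT1 a)) (projT2 a) <-> alive (projT2 (projT1 b)) (projT2 b)) /\
  forall r, point_of (projT2 (projT1 a)) (mix (projT2 a) (target (projT2 (projT1 a)) (projT2 a)) r)
   = point_of (projT2 (projT1 b)) (mix (projT2 b) (target (projT2 (projT1 b)) (projT2 b)) r).
Proof.
elim=> [n i x t|n i x t|c|c d _ [h1 h2]|c d e _ [h1 h2] _ [h3 h4]] /=.
- split=> [|r]; first exact: (iff_sym (alive_coface _ _ _)).
  by rewrite point_of_face target_coface /coface simplex_map_mix.
- split=> [|r]; first exact: (iff_sym (alive_codegen _ _ _)).
  by rewrite point_of_degen target_codegen /codegen simplex_map_mix.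
- by [].
- split; [exact: (iff_sym h1)|by move=> r; rewrite h2].
- split; [exact: (iff_trans h1 h3)|by move=> r; rewrite h2 h4].
Qed.

Lemma repr_glue n (w : X n) (t : simplex R n) :
  Defs.glue (repr (point_of w t)) (in_cell w t).
Proof. by apply/pi_glueP; rewrite reprK. Qed.

Lemma starE n (w : X n) (t : simplex R n) : star (point_of w t) <-> alive w t.
Proof. by have [h _] := star_drift_glue (repr_glue w t); exact: h. Qed.

Lemma driftE n (w : X n) (t : simplex R n) r :
  drift (point_of w t) r = point_of w (mix t (target w t) r).
Proof. by have [_ h] := star_drift_glue (repr_glue w t); exact: h. Qed.

End Star.

Section RealizationTopology.
Variables (R : realType) (X : sset).

Lemma realization_open (A : set (realization R X)) :
  (forall n (w : X n), open [set t : simplex R n | A (point_of w t)]) -> open A.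
Proof.
move=> H; suff : open (\pi_(realization R X) @^-1` A) by [].
by apply/sigT_openP => -[n w]; exact: H.
Qed.

Lemma realization_continuous (Z : topologicalType) (f : realization R X -> Z) :
  (forall n (w : X n), continuous (fun t : simplex R n => f (point_of w t))) -> continuous f.
Proof.
move=> H; apply/continuousP => O oO; apply: realization_open => n w.
by have /continuousP := H n w; apply.
Qed.

Lemma point_ofP (z : realization R X) : exists n (w : X n) t, z = point_of w t.
Proof.
exists (projT1 (projT1 (repr z))), (projT2 (projT1 (repr z))), (projT2 (repr z)).
rewrite -[LHS]reprK /point_of; congr (\pi_(realization R X) _).
by case: (repr z) => -[].
Qed.

End RealizationTopology.

Section StarTopology.
Variables (R : realType) (X : sset) (x0 : {n & X n}).
Local Notation attract := (attract (R := R) x0).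
Local Notation cellof w := (existT (fun n => X n) _ w).
Local Notation star := (star (R := R) x0).
Local Notation drift := (drift (R := R) x0).

Lemma attract_coords_cvg n (w : X n) (t : simplex R n) : alive x0 w t ->
  forall k, attract w (coords s) k @[s --> t] --> attract w (coords t) k.
Proof.
move=> al; apply: (@attract_cvg R X x0 _ (nbhs t) (nbhs_filter t) _ w (@coords R n)) => //.
- exact: coords_ge0.
- exact: coords_ge0.
- by move=> k; exact: coords_continuous.
Qed.

Lemma near_alive n (w : X n) (t : simplex R n) : alive x0 w t ->
  \forall s \near t, alive x0 w s.
Proof.
move=> al; have [k ak] := al; have ck := @attract_coords_cvg _ _ _ al k.
have ak0 : 0 < attract w (coords t) k.
  by rewrite lt0r ak attract_ge0//; exact: coords_ge0.
have H : \forall s \near t, 0 < attract w (coords s) k by exact: (cvgr_gt _ ck).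
by apply: filterS H => s s0; exists k; rewrite gt_eqF.
Qed.

Lemma open_star : open star.
Proof.
apply: realization_open => n w; rewrite openE => t /= /starE /near_alive.
by apply: filterS => s /starE.
Qed.

Lemma target_cvg n (w : X n) (t : simplex R n) : alive x0 w t ->
  target x0 w s @[s --> t] --> target x0 w t.
Proof.
move=> al; have FF := nbhs_filter t; apply: (@cvg_simplex _ _ _ FF) => k.
rewrite coords_target//.
have H : \forall s \near t, attract w (coords s) k = coords (target x0 w s) k.
  by apply: filterS (near_alive al) => s als; rewrite coords_target.
apply: cvg_trans (@attract_coords_cvg _ _ _ al k).
exact: near_eq_cvg.
Qed.

Lemma mix_cvg n (S : Type) (F : set_system S) {FF : Filter F} (a b : S -> simplex R n)
    (r : S -> R) (a0 b0 : simplex R n) (r0 : R) :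
  a s @[s --> F] --> a0 -> b s @[s --> F] --> b0 -> r s @[s --> F] --> r0 ->
  mix (a s) (b s) (r s) @[s --> F] --> mix a0 b0 r0.
Proof.
move=> ca cb cr; apply: cvg_simplex => k; rewrite coords_mix.
under eq_fun do rewrite coords_mix.
have ca' : coords (a s) k @[s --> F] --> coords a0 k.
  exact: (@continuous_cvg S _ _ F FF a (fun t => coords t k) a0 (@coords_continuous _ _ k _) ca).
have cb' : coords (b s) k @[s --> F] --> coords b0 k.
  exact: (@continuous_cvg S _ _ F FF b (fun t => coords t k) b0 (@coords_continuous _ _ k _) cb).
have cr' : clamp01 (r s) @[s --> F] --> clamp01 r0.
  exact: (@continuous_cvg S _ _ F FF r (@clamp01 R) r0 (@clamp01_continuous R _) cr).
apply: (@cvgD R R^o); apply: cvgM => //.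
by apply: (@cvgB R R^o) => //; exact: cvg_cst.
Qed.

Lemma point_of_mix_cvg n (w : X n) (S : Type) (F : set_system S) {FF : Filter F}
    (a b : S -> simplex R n) (r : S -> R) (a0 b0 : simplex R n) (r0 : R) :
  a s @[s --> F] --> a0 -> b s @[s --> F] --> b0 -> r s @[s --> F] --> r0 ->
  point_of w (mix (a s) (b s) (r s)) @[s --> F] --> point_of w (mix a0 b0 r0).
Proof.
move=> ca cb cr; have cm := @mix_cvg _ _ _ FF _ _ _ _ _ _ ca cb cr.
exact: (@continuous_cvg S _ _ F FF _ (@point_of R X n w) _ (@point_of_continuous R X n w _) cm).
Qed.

(* The product of |X| and the line is not known to carry the quotient topology;
   compactness of a small segment of times (tube lemma) is used instead. *)
Lemma drift_continuous (z : realization R X) (r : R) : star z ->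
  drift y.1 y.2 @[y --> (z, r)] --> drift z r.
Proof.
move=> sz O; rewrite nbhsE; case=> V [oV Vz] VO.
have [n [w [t zE]]] := point_ofP z.
have cr : continuous (drift z).
  have -> : drift z = fun r' => point_of w (mix t (target x0 w t) r').
    by apply/funext => r'; rewrite zE driftE.
  by move=> r'; apply: point_of_mix_cvg; [exact: cvg_cst|exact: cvg_cst|exact: cvg_id].
have /nbhs_ballP[e e0 Ve] : nbhs r (drift z @^-1` V).
  by apply: cr; exact: open_nbhs_nbhs.
rewrite /= in e0; pose J := `[r - e / 2, r + e / 2]%classic : set R.
pose W := star `&` [set y | forall r', J r' -> V (drift y r')].
have oW : open W.
  apply: realization_open => m v; rewrite openE => s [/starE al Hs].
  have Hn : \forall s' \near s, J `<=` (fun r' => V (drift (point_of v s') r')).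
    have /compact_near_coveringP := @segment_compact R (r - e / 2) (r + e / 2).
    move=> /(_ _ (nbhs s) (fun s' r' => V (drift (point_of v s') r'))); apply.
    move=> r' Jr'.
    have Hc : point_of v (mix y.2 (target x0 v y.2) y.1) @[y --> (r', s)] -->
        point_of v (mix s (target x0 v s) r').
      apply: point_of_mix_cvg; [exact: cvg_snd| |exact: cvg_fst].
      by apply: (cvg_comp snd (target x0 v)); [exact: cvg_snd|exact: target_cvg].
    have nV : nbhs (point_of v (mix s (target x0 v s) r')) V.
      by apply: open_nbhs_nbhs; split=> //; rewrite -driftE; exact: Hs.
    have H : \forall y \near (r', s), V (point_of v (mix y.2 (target x0 v y.2) y.1)).
      exact: (Hc _ nV).
    by apply: (@filterS _ _ (nbhs_filter (r', s))) H => y /=; rewrite -driftE.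
  apply: filterS2 (near_alive al) Hn => s' al' Hs'; split; first exact/starE.
  by move=> r' /Hs'.
have Wz : W z.
  split=> // r'; rewrite /J /= in_itv /= => /andP[h1 h2]; apply: Ve.
  by rewrite /ball /= ltr_distlC; apply/andP; split; lra.
exists (W, ball r (e / 2)).
  split; first exact: open_nbhs_nbhs.
  by apply: nbhsx_ballx; rewrite divr_gt0.
move=> [y r'] [/= [_ Wy]]; rewrite /ball /= ltr_distlC => /andP[h1 h2]; apply: VO.
by apply: Wy; rewrite /J /= in_itv /=; apply/andP; split; lra.
Qed.

Lemma drift0 z : drift z 0 = z.
Proof. by have [n [w [t ->]]] := point_ofP z; rewrite driftE mix0. Qed.

Lemma barycenter_proof n : (forall k : 'I_n.+1, 0 <= n.+1%:R^-1 :> R) /\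
  \sum_(k < n.+1) n.+1%:R^-1 = 1 :> R.
Proof.
split=> [k|]; first by rewrite invr_ge0.
by rewrite sumr_const card_ord -[X in X = _]mulr_natl mulfV// pnatr_eq0.
Qed.

Definition star_center : realization R X := point_of (projT2 x0)
  (mk_simplex (barycenter_proof (projT1 x0)).1 (barycenter_proof (projT1 x0)).2).

(** Stated for any nonnegative [v], because the induction leaves the vectors of sum 1. *)
Lemma point_of_attract n (w : X n) (v : 'I_n.+1 -> R) (a : simplex R n) :
  (forall k, 0 <= v k) -> coords a = attract w v -> point_of w a = star_center.
Proof.
have core_star_center m (x : X m) (u : 'I_m.+1 -> R) (b : simplex R m) :
    coords b = core x0 x u -> point_of x b = star_center.
  rewrite /core; case: ifP => [/andP[/asboolP e _] eb|_ eb]; last first.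
    have := coords_sum b; rewrite eb big1// => /eqP.
    by rewrite eq_sym oner_eq0.
  rewrite /star_center -e /=; congr point_of; apply: coords_inj.
  by rewrite eb coords_mk.
elim: n w v a => [|n IH] w v a v0 ea; first exact: core_star_center ea.
have [[[j y] /= e]|nd] := pselect (degenerate w).
  subst w; rewrite point_of_degen; apply: (IH _ (pushc (collapse j) v)).
    exact: pushc_ge0.
  by rewrite coords_map ea spread_supp.
have [e|ne] := pselect (cellof w = x0).
  by apply: core_star_center; rewrite ea attract_core.
rewrite attract_nondegenerate// insert0E in ea.
have d0 := drop_min_ge0 (argmin_le v); set d := drop_min _ v in d0 ea.
have a1 : \sum_k attract (face (argmin v) w) d k = 1.
  by rewrite -(pushc_sum (lift (argmin v))) -ea coords_sum.
rewrite (_ : a = coface (argmin v) (mk_simplex (attract_ge0 x0 _ d0) a1)).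
  by rewrite -point_of_face; apply: (IH _ d); rewrite ?coords_mk.
by apply: coords_inj; rewrite coords_map coords_mk.
Qed.

Lemma point_of_target n (w : X n) (t : simplex R n) : alive x0 w t ->
  point_of w (target x0 w t) = star_center.
Proof.
by move=> al; apply: (@point_of_attract _ _ (coords t)); [exact: coords_ge0|exact: coords_target].
Qed.

Lemma drift1 z : star z -> drift z 1 = star_center.
Proof.
have [n [w [t ->]]] := point_ofP z.
by rewrite driftE mix1 => /starE; exact: point_of_target.
Qed.

End StarTopology.

(* A representative of minimal dimension is nondegenerate and interior. *)
Lemma star_cover (R : realType) (X : sset) (z : realization R X) :
  exists2 x0 : {n & X n}, ~ degenerate (projT2 x0) & star x0 z.
Proof.
have ex : exists n, `[< exists (w : X n) t, z = point_of w t >].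
  by have [n [w [t ->]]] := point_ofP z; exists n; apply/asboolP; exists w, t.
case: (ex_minnP ex) => n /asboolP[w [t zE]] nmin.
have nd : ~ degenerate w.
  case: n w t zE nmin => [|n] w t zE nmin; first by case.
  move=> [[j y] /= e].
  have /nmin : `[< exists (w : X n) t, z = point_of w t >].
    by apply/asboolP; exists y, (codegen j t); rewrite zE e point_of_degen.
  by rewrite ltnn.
exists (existT (fun n => X n) n w) => //; rewrite zE; apply/starE.
exists ord0; rewrite attract_core// /core asboolT//=.
have -> : [forall k, 0 < coords t k].
  apply/forallP => k; rewrite lt0r coords_ge0 andbT; apply/negP => /eqP tk.
  case: n w t zE nmin nd k tk => [|n] w t zE nmin nd k tk.
    have := coords_sum t; rewrite big_ord1 (ord1 k) in tk *; rewrite tk => /eqP.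
    by rewrite eq_sym oner_eq0.
  suff /nmin : `[< exists (w : X n) t, z = point_of w t >] by rewrite ltnn.
  have v0 l : 0 <= (coords t \o lift k) l by exact: coords_ge0.
  have v1 : \sum_l (coords t \o lift k) l = 1.
    by rewrite -[RHS](coords_sum t) (bigD1_ord k)//= tk add0r.
  apply/asboolP; exists (face k w), (mk_simplex v0 v1); rewrite point_of_face zE.
  congr point_of; apply: coords_inj; rewrite coords_map coords_mk -insert0E.
  apply/funext => l; case: (unliftP k l) => [l' ->|->]; first by rewrite insert0_lift.
  by rewrite insert0_id.
by rewrite invr_eq0 pnatr_eq0.
Qed.

(** * Even covering of the stars *)

Section Naturality.
Variables (R : realType) (A B : sset) (f : smap A B).
Hypothesis f_nondeg : forall n (w : A n), degenerate (f n w) -> degenerate w.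
Local Notation cellof w := (existT _ _ w).

Definition map_cell (a : {n & A n}) : {n & B n} :=
  existT (fun n => B n) (projT1 a) (f _ (projT2 a)).

(** Nonvanishing is assumed because [f] may send a cell other than [a] to the image of [a]; then the
    attractor downstairs can be nonzero while the one upstairs is 0. *)
Lemma attract_map (a : {n & A n}) n (w : A n) (t : 'I_n.+1 -> R) :
  (forall k, 0 <= t k) -> (exists k, attract a w t k != 0) ->
  attract (map_cell a) (f n w) t = attract a w t.
Proof.
have core_map m (x : A m) (u : 'I_m.+1 -> R) k : core a x u k != 0 ->
    core (map_cell a) (f m x) u = core a x u.
  rewrite /core; case: ifP => [/andP[/asboolP e up] _|]; last by rewrite eqxx.
  by rewrite up asboolT// -e.
elim: n w t => [|n IH] w t t0 [k ak]; first exact: core_map ak.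
have [[[j y] /= e]|nd] := pselect (degenerate w).
  subst w; rewrite smap_degen !attract_degen// IH//; first exact: pushc_ge0.
  exists (collapse j k); apply: contra_neq ak; rewrite attract_degen// /spread => ->.
  by rewrite mul0r mulr0.
have nd' : ~ degenerate (f n.+1 w) by move=> /f_nondeg.
have [e|ne] := pselect (existT (fun n => A n) n.+1 w = a).
  rewrite attract_core// in ak; rewrite !attract_core ?(core_map _ _ _ _ ak)//.
  by rewrite -e.
(* If [w] had the image of [a] without being [a], the flow upstairs would continue below the
   dimension of [a] and give 0. *)
have ne' : existT (fun n => B n) n.+1 (f n.+1 w) <> map_cell a.
  move=> /(congr1 (fun x => projT1 x)) /= e; case/eqP: ak; rewrite attract_nondegenerate//.
  by rewrite attract_lowdim -?e// /insert0; case: unlift.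
rewrite !attract_nondegenerate// -smap_face IH//.
  by apply: drop_min_ge0; exact: argmin_le.
move: ak; rewrite attract_nondegenerate// /insert0; case: unlift => [l|]; first by exists l.
by rewrite eqxx.
Qed.

(** Since [f] preserves nondegeneracy, the flow downstairs can be followed upstairs; the cell where
    it stops is the lift [a]. *)
Lemma attract_lift (b : {n & B n}) n (w : A n) (t : 'I_n.+1 -> R) :
  (forall k, 0 <= t k) -> (exists k, attract b (f n w) t k != 0) ->
  exists2 a, map_cell a = b & attract a w t = attract b (f n w) t.
Proof.
have core_lift m (x : A m) (u : 'I_m.+1 -> R) k : core b (f m x) u k != 0 ->
    [/\ map_cell (existT (fun n => A n) m x) = b, existT (fun n => B n) m (f m x) = b
    & core (existT (fun n => A n) m x) x u = core b (f m x) u].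
  rewrite /core; case: ifP => [/andP[/asboolP e up] _|]; last by rewrite eqxx.
  by rewrite up asboolT.
elim: n w t => [|n IH] w t t0 [k ak].
  by have [h1 h2 h3] := core_lift _ _ _ _ ak; exists (existT (fun n => A n) 0%N w).
have [[[j y] /= e]|nd] := pselect (degenerate w).
  subst w; rewrite smap_degen attract_degen// in ak *.
  have [|a ea e] := IH y (pushc (collapse j) t) (pushc_ge0 _ t0).
    exists (collapse j k); apply: contra_neq ak; rewrite /spread => ->.
    by rewrite mul0r mulr0.
  by exists a => //; rewrite attract_degen// e.
have nd' : ~ degenerate (f n.+1 w) by move=> /f_nondeg.
have [e|ne] := pselect (existT (fun n => B n) n.+1 (f n.+1 w) = b).
  rewrite attract_core// in ak *; have [h1 h2 h3] := core_lift _ _ _ _ ak.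
  by exists (existT (fun n => A n) n.+1 w) => //; rewrite attract_core.
rewrite attract_nondegenerate// in ak *; rewrite -smap_face in ak *.
have [||a ea e] := IH (face (argmin t) w) (drop_min (argmin t) t).
- by apply: drop_min_ge0; exact: argmin_le.
- move: ak; rewrite /insert0; case: unlift => [l|]; first by exists l.
  by rewrite eqxx.
exists a => //; rewrite attract_nondegenerate//; first by rewrite e.
by move=> e'; apply: ne; rewrite -ea -e'.
Qed.

End Naturality.

(** Both flows take the same faces until one of the two cells is met; beyond it the dimension is too
    low for the other ([attract_lowdim]). This makes the sheets disjoint. *)
Lemma attract_unique (R : realType) (A : sset) (a a' : {n & A n}) n (w : A n)
    (t : 'I_n.+1 -> R) : projT1 a = projT1 a' -> (forall k, 0 <= t k) ->
  (exists k, attract a w t k != 0) -> (exists k, attract a' w t k != 0) -> a = a'.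
Proof.
move=> aa; have core_eq m (x : A m) (u : 'I_m.+1 -> R) b k : core b x u k != 0 ->
    existT (fun n => A n) m x = b.
  by rewrite /core; case: ifP => [/andP[/asboolP ]//|]; rewrite eqxx.
elim: n w t => [|n IH] w t t0 [k ak] [k' ak'].
  by rewrite -(core_eq _ _ _ _ _ ak) -(core_eq _ _ _ _ _ ak').
have [[[j y] /= e]|nd] := pselect (degenerate w).
  subst w; apply: (IH y (pushc (collapse j) t)); first exact: pushc_ge0.
    exists (collapse j k); apply: contra_neq ak; rewrite attract_degen// /spread => ->.
    by rewrite mul0r mulr0.
  exists (collapse j k'); apply: contra_neq ak'; rewrite attract_degen// /spread => ->.
  by rewrite mul0r mulr0.
have key b : projT1 b = n.+1 -> (exists k, attract b w t k != 0) ->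
    existT (fun n => A n) n.+1 w = b.
  move=> e [l h]; apply: contrapT => ne; case/eqP: h.
  rewrite attract_nondegenerate// attract_lowdim ?e//.
  by rewrite /insert0; case: unlift.
have [e|ne] := pselect (existT (fun n => A n) n.+1 w = a).
  by rewrite -e; apply: key; [rewrite -aa -e|exists k'].
have [e|ne'] := pselect (existT (fun n => A n) n.+1 w = a').
  by rewrite -e; apply/esym; apply: key; [rewrite aa -e|exists k].
apply: (IH (face (argmin t) w) (drop_min (argmin t) t)).
- by apply: drop_min_ge0; exact: argmin_le.
- move: ak; rewrite attract_nondegenerate// /insert0; case: unlift => [l|]; first by exists l.
  by rewrite eqxx.
- move: ak'; rewrite attract_nondegenerate// /insert0; case: unlift => [l|]; first by exists l.
  by rewrite eqxx.
Qed.

(** The rest of the preimage is open too, so that a path over [U] cannot leave its sheet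
    ([path_stays]). The section [g] is total but constrained only on [U]. *)
Definition even_sheet (Y Z : topologicalType) (p : Y -> Z) (U : set Z) (S : set Y)
    (g : Z -> Y) : Prop :=
  [/\ open U, open S, S `<=` p @^-1` U, open (p @^-1` U `\` S)
    & [/\ forall u, U u -> g x @[x --> u] --> g u,
          forall u, U u -> S (g u) /\ p (g u) = u
        & forall y, S y -> g (p y) = y]].

(** * Sheets of the twisted projection *)

Section TwistedCovering.
Variables (R : realType) (X : sset) (H : groupType) (t : forall n, X n -> H).
Hypothesis twt : twisting t.
Local Notation tX := (twisted_sset twt).
Local Notation p := (realization_map (R := R) (twisted_proj twt)).

(** The deck transformations of the covering. *)
Definition translate (k : H) : smap tX tX.
Proof.
refine (@SMap tX tX (fun n hs => ((k * hs.1)%g, hs.2)) _ _).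
- move=> n i [h s]; rewrite /= /twisted_face /=; case: ifP => // _.
  by rewrite mulgA.
- by [].
Defined.

Lemma proj_nondeg n (w : tX n) : degenerate (twisted_proj twt n w) -> degenerate w.
Proof.
case: n w => // n [h w] [[j y] /= ->]; exists (j, (h, y)) => //.
Qed.

Lemma translate_nondeg k n (w : tX n) : degenerate (translate k n w) -> degenerate w.
Proof. by case: n w => // n [h w] [[j [h' y]] /= [_ ->]]; exists (j, (h, y)). Qed.

Lemma realization_map_continuous (A B : sset) (f : smap A B) :
  continuous (realization_map (R := R) f).
Proof.
apply: realization_continuous => n w.
rewrite (_ : (fun s => _) = point_of (f n w)); first exact: point_of_continuous.
by apply/funext => s; rewrite realization_mapE.
Qed.

(* Both directions are proved at once because of the symmetry rule of [glue]. *)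
Lemma glue_lift (a b : cells R X) : Defs.glue a b ->
  (forall h : H, exists h' : H, Defs.glue
     (@in_cell R tX _ (h, projT2 (projT1 a)) (projT2 a))
     (@in_cell R tX _ (h', projT2 (projT1 b)) (projT2 b))) /\
  (forall h' : H, exists h : H, Defs.glue
     (@in_cell R tX _ (h, projT2 (projT1 a)) (projT2 a))
     (@in_cell R tX _ (h', projT2 (projT1 b)) (projT2 b))).
Proof.
elim=> [n i x s|n i x s|c|c d _ [h1 h2]|c d e _ [h1 h2] _ [h3 h4]] /=.
- have key (h' : H) : Defs.glue
      (@in_cell R tX n (if i == ord_max then h' * (t x)^-1 else h', face i x)%g s)
      (@in_cell R tX n.+1 (h', x) (coface i s)).
    exact: (@glue_face R tX n i (h', x) s).
  split=> [h|h']; last by eexists; exact: key.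
  have := key h; have := key (h * t x)%g; case: ifP => _ k1 k2; last by exists h.
  by exists (h * t x)%g; rewrite mulgK in k1.
- by split=> h; exists h; exact: (@glue_degen R tX n i (h, x) s).
- by split=> h; exists h; exact: glue_refl.
- split=> h; first by have [h' g] := h2 h; exists h'; exact: glue_sym.
  by have [h' g] := h1 h; exists h'; exact: glue_sym.
- split=> h.
    have [h' g] := h1 h; have [h'' g'] := h3 h'.
    by exists h''; exact: glue_trans g g'.
  have [h' g] := h4 h; have [h'' g'] := h2 h'.
  by exists h''; exact: glue_trans g' g.
Qed.

Lemma fiberP (z : realization R tX) n (w : X n) (s : simplex R n) :
  p z = point_of w s -> exists h : H, z = @point_of R tX n (h, w) s.
Proof.
have [m [[h v] [u ->]]] := point_ofP z; rewrite realization_mapE /= => /pi_glueP.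
move=> /glue_lift[/(_ h)[h' g] _]; exists h'; exact/pi_glueP.
Qed.

Lemma proj_open (O : set (realization R tX)) : open O -> open (p @` O).
Proof.
move=> oO; apply: realization_open => n w.
rewrite (_ : [set s | _] = \bigcup_(h : H) [set s | O (@point_of R tX n (h, w) s)]).
  apply: bigcup_open => h _; have /continuousP := @point_of_continuous R tX n (h, w).
  exact.
apply/seteqP; split=> s /=.
  by move=> [z Oz /fiberP[h e]]; exists h => //=; rewrite -e.
by move=> [h _ /= Oz]; exists (@point_of R tX n (h, w) s) => //; rewrite realization_mapE.
Qed.

Definition sheet (x0 : {n & X n}) (h : H) : set (realization R tX) :=
  star (existT (fun n => tX n) (projT1 x0) (h, projT2 x0)).

Variable x0 : {n & X n}.

Lemma sheet_translate h k n (w : X n) (s : simplex R n) k' :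
  sheet x0 h (@point_of R tX n (k, w) s) ->
  sheet x0 (k' * h)%g (@point_of R tX n ((k' * k)%g, w) s).
Proof.
move=> /starE al; apply/starE.
have := attract_map (@translate_nondeg k') (coords_ge0 s) al.
by move: al; rewrite /alive /map_cell /= => al ->.
Qed.

Lemma sheet_disjoint h h' z : sheet x0 h z -> sheet x0 h' z -> h = h'.
Proof.
have [m [w [u ->]]] := point_ofP z => /starE al /starE al'.
have e := @attract_unique R tX _ _ m w (coords u) _ (coords_ge0 u) al al'.
exact: (congr1 (fun c : {n & tX n} => (projT2 c).1) (e erefl)).
Qed.

Lemma sheet_star h z : sheet x0 h z -> star x0 (p z).
Proof.
have [m [w [u ->]]] := point_ofP z => /starE al; rewrite realization_mapE; apply/starE.
have := attract_map proj_nondeg (coords_ge0 u) al.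
case: x0 al => n y; rewrite /map_cell /= /alive /= => al e.
by rewrite [attract _ _ _]e.
Qed.

(** Lifting the flow gives a point in an uncontrolled sheet [h']; translation by [h * h'^-1] carries
    it to sheet [h]. *)
Lemma star_sheet h u : star x0 u -> exists2 z, sheet x0 h z & p z = u.
Proof.
have [n [w [s ->]]] := point_ofP u => /starE al.
have [[m [h' y]] e0 e] := attract_lift (w := (1%g, w) : tX n) proj_nondeg (coords_ge0 s) al.
exists (@point_of R tX n ((h * h'^-1) * 1, w)%g s); last by rewrite realization_mapE.
rewrite -{1}(mulgVK h' h); apply: sheet_translate; apply/starE.
by case: al => k ak; exists k; rewrite -e0 /= [attract _ _ _]e.
Qed.

(** Points with the same projection differ by a translation, and disjointness of the sheets forces a
    translation between points of one sheet to be trivial. *)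
Lemma sheet_inj h y z : sheet x0 h y -> sheet x0 h z -> p y = p z -> y = z.
Proof.
have [n [[k w] [s ->]]] := point_ofP y; rewrite realization_mapE /= => sy sz.
move=> /esym/fiberP[k' zE]; rewrite zE in sz *.
have := sheet_translate (k' * k^-1)%g sy; rewrite mulgVK => /sheet_disjoint/(_ sz) e.
suff -> : k = k' by [].
have : (k' * k^-1 = 1)%g by apply: (@mulIg H h); rewrite e mul1g.
by move=> e1; rewrite -[RHS]mulg1 -(mulVg k) mulgA e1 mul1g.
Qed.

Lemma sheet_cover z : star x0 (p z) -> exists h, sheet x0 h z.
Proof.
move=> /(@star_sheet 1%g)[y sy yz].
have [n [[k w] [s yE]]] := point_ofP y; rewrite yE in sy yz.
rewrite realization_mapE /= in yz.
have [k' zE] := fiberP (esym yz); exists ((k' * k^-1) * 1)%g.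
by have := sheet_translate (k' * k^-1)%g sy; rewrite mulgVK -zE.
Qed.

Lemma open_sheet h : open (sheet x0 h).
Proof. exact: open_star. Qed.

Definition section_at (h : H) (u : realization R X) : realization R tX :=
  if pselect (star x0 u) is left su then sval (cid2 (star_sheet h su))
  else @point_of R tX _ (h, projT2 x0)
    (mk_simplex (barycenter_proof R (projT1 x0)).1 (barycenter_proof R (projT1 x0)).2).

Lemma section_atP h u : star x0 u -> sheet x0 h (section_at h u) /\ p (section_at h u) = u.
Proof. by rewrite /section_at; case: pselect => // su _; case: cid2. Qed.

(** The section inverts an open map that is injective on the sheet, so the arbitrary choice in its
    definition does no harm. *)
Lemma section_at_cvg h u : star x0 u -> section_at h v @[v --> u] --> section_at h u.
Proof.
move=> su O; rewrite nbhsE; case=> V [oV Vu] VO.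
have [su1 su2] := section_atP h su.
have oW : open (p @` (V `&` sheet x0 h)).
  by apply: proj_open; apply: openI => //; exact: open_sheet.
have Hn : \forall v \near u, (p @` (V `&` sheet x0 h)) v.
  by apply: open_nbhs_nbhs; split=> //; exists (section_at h u).
apply: filterS Hn => v [z [Vz sz] <-]; apply: VO.
have [s1 s2] := section_atP h (sheet_star sz).
by rewrite (sheet_inj s1 sz s2).
Qed.

Lemma even_sheetP h : even_sheet p (star x0) (sheet x0 h) (section_at h).
Proof.
split.
- exact: open_star.
- exact: open_sheet.
- by move=> z /sheet_star.
- rewrite (_ : _ `\` _ = \bigcup_(k in [set k | k <> h]) sheet x0 k).
    by apply: bigcup_open => k _; exact: open_sheet.
  apply/seteqP; split=> z /=.
    by move=> [/sheet_cover[k sk] nz]; exists k => //= kh; rewrite kh in sk.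
  move=> [k /= kh sk]; split; first exact: sheet_star sk.
  by move=> /(sheet_disjoint sk).
- split=> [u|u|y sy]; [exact: section_at_cvg|exact: section_atP|].
  have [s1 s2] := section_atP h (sheet_star sy).
  exact: sheet_inj s1 sy s2.
Qed.

End TwistedCovering.

(** * Lifting homotopies *)

(** The hypothesis makes [P] and its negation relatively open in the unit interval, which is
    connected. This stands in for subdivisions of the interval. *)
Lemma unit_induction (R : realType) (P : R -> Prop) :
  (forall s0, 0 <= s0 <= 1 -> exists2 e, 0 < e & forall s s', 0 <= s <= 1 -> 0 <= s' <= 1 ->
     `|s - s0| < e -> `|s' - s0| < e -> P s -> P s') ->
  P 0 -> P 1.
Proof.
move=> loc P0; pose A : set R := `[0, 1]%classic.
have cA : connected A by exact: segment_connected.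
have key (Q : R -> Prop) (hQ : forall s0, 0 <= s0 <= 1 -> exists2 e, 0 < e &
    forall s, 0 <= s <= 1 -> `|s - s0| < e -> Q s0 -> Q s) :
    exists C : set R, open C /\ forall s, A s -> (C s <-> Q s).
  exists (\bigcup_(x in [set x : R * R | [/\ 0 < x.2, A x.1 & forall s, A s ->
      `|s - x.1| < x.2 -> Q s]]) ball x.1 x.2); split.
    by apply: bigcup_open => -[x e] /= [e0 _ _]; exact: ball_open.
  move=> s As; split.
    by move=> [[x e] /= [e0 Ax H]]; rewrite /ball /= distrC => /H; apply.
  move=> Qs; have [|e e0 H] := hQ s; first by move: As; rewrite /A /= in_itv.
  exists (s, e) => /=; last exact: ballxx.
  by split=> // s' As' d; apply: H => //; move: As'; rewrite /A /= in_itv.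
have [C [oC CP]] : exists C : set R, open C /\ forall s, A s -> (C s <-> P s).
  apply: key => s0 /[dup] h /loc[e e0 H]; exists e => // s hs ds; apply: H => //.
  by rewrite subrr normr0.
have [D [oD DP]] : exists C : set R, open C /\ forall s, A s -> (C s <-> ~ P s).
  apply: key => s0 /[dup] h /loc[e e0 H]; exists e => // s hs ds nP Ps; apply: nP.
  by apply: (H s) => //; rewrite subrr normr0.
have A0 : A 0 by rewrite /A /= in_itv /= lexx ler01.
have A1 : A 1 by rewrite /A /= in_itv /= lexx ler01.
have e : [set s | A s /\ P s] = A.
  apply: cA.
  - by exists 0.
  - by exists C => //; apply/seteqP; split=> s /= [As h]; split=> //; apply/(CP s As).
  - exists (~` D); first exact: open_closedC.
    apply/seteqP; split=> s /= [As h]; split=> //; first by move=> /(DP s As).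
    by apply: contrapT => /(DP s As).
by have : [set s | A s /\ P s] 1; [rewrite e|case].
Qed.

Lemma ball_segment (R : realType) (V : normedModType R) (v0 v v' : V) (e x : R) :
  `|v - v0| < e -> `|v' - v0| < e -> 0 <= x <= 1 ->
  `|(1 - x) *: v + x *: v' - v0| < e.
Proof.
move=> h h' /andP[x0 x1].
have -> : (1 - x) *: v + x *: v' - v0 = (1 - x) *: (v - v0) + x *: (v' - v0).
  rewrite !scalerBr addrACA -opprD -scalerDl subrK scale1r.
  by [].
apply: le_lt_trans (ler_normD _ _) _; rewrite !normrZ (ger0_norm x0) ger0_norm ?subr_ge0//.
move: h h'.
move: (`|v - v0|) (`|v' - v0|) => a b ha hb.
have /(le_lt_trans _) : Num.max a b < e by rewrite gt_max ha hb.
apply; have ma : a <= Num.max a b by rewrite le_max lexx.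
have mb : b <= Num.max a b by rewrite le_max lexx orbT.
by nra.
Qed.

Section Lifting.
Variables (R : realType) (Y Z : topologicalType) (p : Y -> Z).
Hypothesis cp : continuous p.
Hypothesis even : forall z, exists U : set Z, [/\ open U, U z &
  forall y, U (p y) -> exists S g, S y /\ even_sheet p U S g].

Lemma path_stays (U : set Z) S g (c : R -> Y) : even_sheet p U S g -> continuous c ->
  (forall x, 0 <= x <= 1 -> U (p (c x))) -> S (c 0) -> S (c 1).
Proof.
move=> [oU oS SU oC _] cc cU; apply: (@unit_induction R (fun x => S (c x))) => s0 hs0.
have [Ss|nSs] := pselect (S (c s0)).
  have /nbhs_ballP[e /= e0 He] : nbhs s0 (c @^-1` S).
    by apply: cc; exact: open_nbhs_nbhs.
  by exists e => // s s' _ _ _ d _; apply: He; rewrite /ball /= distrC.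
have /nbhs_ballP[e /= e0 He] : nbhs s0 (c @^-1` (p @^-1` U `\` S)).
  by apply: cc; apply: open_nbhs_nbhs; split=> //; split=> //; exact: cU.
exists e => // s s' _ _ d _ Ss; have [] : (p @^-1` U `\` S) (c s).
  by apply: He; rewrite /ball /= distrC.
by move=> _ /(_ Ss).
Qed.

Lemma near_dist (V : normedModType R) (T : topologicalType) (f : V -> T) (v : V) (U : set T) :
  continuous f -> open U -> U (f v) -> exists2 e, 0 < e & forall v', `|v' - v| < e -> U (f v').
Proof.
move=> cf oU Uv; have : nbhs v (f @^-1` U) by apply: cf; exact: open_nbhs_nbhs.
move=> /nbhs_ballP[e /= e0 He]; exists e => // v' d; apply: He.
by rewrite -ball_normE /= distrC.
Qed.

Lemma segment_continuousR (a b : R) : continuous (fun x : R => a + x * b).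
Proof.
rewrite (_ : (fun x => _) = fun x : R => b * x + a).
  by apply: affine_continuous => x; exact: cvg_id.
by apply/funext => x; rewrite addrC mulrC.
Qed.

(** Near [s0] both lifts stay in the sheet through [c s], where [p] is injective. The segment from
    [s] to [s'] is rescaled to the unit interval for [path_stays]. *)
Lemma lift_unique (c c' : R -> Y) : continuous c -> continuous c' ->
  (forall x, 0 <= x <= 1 -> p (c x) = p (c' x)) -> c 0 = c' 0 -> c 1 = c' 1.
Proof.
move=> cc cc' pc; apply: (@unit_induction R (fun x => c x = c' x)) => s0 hs0.
have [U [oU Us0 HU]] := even (p (c s0)).
have [e e0 He] := @near_dist R^o _ (p \o c) s0 _ (contcomp cc cp) oU Us0.
exists e => // s s' hs hs' ds ds' css.
have seg x : 0 <= x <= 1 -> 0 <= s + x * (s' - s) <= 1 /\ `|s + x * (s' - s) - s0| < e.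
  move=> hx; split.
    by move: hs hs' hx => /andP[? ?] /andP[? ?] /andP[? ?]; apply/andP; split; nra.
  rewrite (_ : s + x * (s' - s) = (1 - x) *: (s : R^o) + x *: (s' : R^o)).
    exact: (@ball_segment R R^o).
  by rewrite /GRing.scale /=; lra.
have [S [g [Sy ev]]] := HU (c s) (He s ds).
have e1 : s + 1 * (s' - s) = s' by lra.
have e2 : s + 0 * (s' - s) = s by lra.
have Ss : S (c s').
  have := @path_stays U S g (fun x => c (s + x * (s' - s))) ev; rewrite e1 e2; apply=> //.
    exact: (contcomp (@segment_continuousR _ _) cc).
  by move=> x /seg[_ h]; exact: He h.
have Ss' : S (c' s').
  have := @path_stays U S g (fun x => c' (s + x * (s' - s))) ev; rewrite e1 e2 -css; apply=> //.
    exact: (contcomp (@segment_continuousR _ _) cc').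
  by move=> x /seg[h1 h]; rewrite -pc//; exact: He h.
by case: ev => _ _ _ _ [_ _ gp]; rewrite -(gp _ Ss) -(gp _ Ss') pc.
Qed.

Lemma path_lift (c : R -> Z) (y0 : Y) : continuous c -> p y0 = c 0 ->
  exists c' : R -> Y, [/\ continuous c', c' 0 = y0 & forall x, 0 <= x <= 1 -> p (c' x) = c x].
Proof.
move=> cc py0; apply: (@unit_induction R (fun s => exists c' : R -> Y, [/\ continuous c', c' 0 = y0
  & forall x, 0 <= x <= s -> p (c' x) = c x])); last first.
  exists (fun=> y0); split=> [|//|x /andP[x0 x1]]; first exact: cst_continuous.
  by rewrite py0; congr c; lra.
move=> s0 hs0; have [U [oU Us0 HU]] := even (c s0).
have [e e0 He] := @near_dist R^o _ c s0 _ cc oU Us0.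
exists e => // s s' /andP[hs _] /andP[hs' _] ds ds' [c' [cc' c'0 c'P]].
have [ss|ss] := leP s' s.
  by exists c'; split=> // x /andP[x0 x1]; rewrite c'P// x0 (le_trans x1).
have pcs : p (c' s) = c s by rewrite c'P// hs lexx.
have [|S [g [Sy [_ _ _ _ [cg gS gp]]]]] := HU (c' s); first by rewrite pcs; exact: He.
(* Clamping to the interval from [s] to [s'] keeps [c (m x)] in [U] for every real [x], so the new
   piece is continuous on the whole line before pasting. *)
pose m x := Num.max s (Num.min x s').
have mP x : s <= m x <= s'.
  by rewrite /m le_max lexx /= ge_max ge_min lexx orbT (ltW ss).
have Um x : U (c (m x)).
  apply: He; have /andP[m1 m2] := mP x.
  by move: ds ds'; rewrite !ltr_distl => /andP[? ?] /andP[? ?]; apply/andP; split; lra.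
have cm : continuous m.
  apply: (@maxr_continuous R R (fun=> s) (fun x => Num.min x s')).
    exact: cst_continuous.
  apply: (@minr_continuous R R (fun x => x) (fun=> s')); last exact: cst_continuous.
  by move=> x; exact: cvg_id.
have ms x : s <= x <= s' -> m x = x.
  by move=> /andP[h1 h2]; rewrite /m (min_idPl h2) (max_idPr h1).
exists (fun x => if x <= s then c' x else g (c (m x))); split.
- apply: (@paste_continuous R R Y (fun x => x) s c' (fun x => g (c (m x)))) => //.
  + by move=> x; exact: cvg_id.
  + move=> x; apply: (@continuous_cvg _ _ _ _ _ (c \o m) g); first exact: (cg _ (Um x)).
    exact: (contcomp cm cc).
  + by move=> x ->; rewrite ms ?lexx ?(ltW ss)// -pcs gp.
- by rewrite hs.
- move=> x /andP[x0 x1]; case: ifP => [xs|/negbT]; first by rewrite c'P// x0.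
  rewrite -ltNge => xs; have [_] := gS _ (Um x).
  by rewrite ms// (ltW xs).
Qed.

Section PlaneLift.
Variables (V : normedModType R) (f : V -> Z) (y0 : Y).
Hypotheses (cf : continuous f) (py0 : p y0 = f 0).

Lemma ray_continuous (v : V) : continuous (fun x : R => x *: v).
Proof. exact: scalel_continuous. Qed.

Lemma ray_lift_exists (v : V) : exists c : R -> Y,
  [/\ continuous c, c 0 = y0 & forall x, 0 <= x <= 1 -> p (c x) = f (x *: v)].
Proof.
apply: (@path_lift (fun x => f (x *: v))); last by rewrite scale0r.
exact: (contcomp (@ray_continuous v) cf).
Qed.

Definition ray_lift (v : V) : R -> Y := sval (cid (ray_lift_exists v)).

Lemma ray_liftP (v : V) : [/\ continuous (ray_lift v), ray_lift v 0 = y0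
  & forall x, 0 <= x <= 1 -> p (ray_lift v x) = f (x *: v)].
Proof. exact: svalP (cid (ray_lift_exists v)). Qed.

(** The value at [v] is the end of the lifted ray from the origin; only continuity across rays
    remains to be shown. *)
Definition star_lift (v : V) : Y := ray_lift v 1.

Lemma p_star_lift v : p (star_lift v) = f v.
Proof. by have [_ _ ->] := ray_liftP v; rewrite ?scale1r// ler01 lexx. Qed.

Lemma ray_liftE v x : 0 <= x <= 1 -> ray_lift v x = star_lift (x *: v).
Proof.
move=> hx; have [c1 d1 e1] := ray_liftP v; have [c2 d2 e2] := ray_liftP (x *: v).
have h (z : R) : 0 <= z <= 1 -> 0 <= 0 + z * x <= 1.
  by move: hx => /andP[? ?] /andP[? ?]; apply/andP; split; nra.
have := @lift_unique (fun z => ray_lift v (0 + z * x)) (ray_lift (x *: v)).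
rewrite /= !(mul1r, mul0r, add0r); apply=> //.
- exact: (contcomp (@segment_continuousR 0 x) c1).
- by move=> z hz; rewrite e1 ?h// e2// scalerA add0r.
- by rewrite d1 d2.
Qed.

Lemma star_lift0 : star_lift 0 = y0.
Proof.
by have [_ <- _] := ray_liftP 0; rewrite (ray_liftE 0) ?lexx ?ler01// scale0r.
Qed.

Lemma star_lift_stays U S g (v : V) (k : R) : even_sheet p U S g -> 0 <= k <= 1 ->
  (forall x, 0 <= x <= 1 -> U (f ((1 - x) *: v + x *: (k *: v)))) ->
  S (star_lift v) <-> S (star_lift (k *: v)).
Proof.
move=> ev hk HU; have [c _ e] := ray_liftP v.
have h (a b x : R) : 0 <= a <= 1 -> 0 <= b <= 1 -> 0 <= x <= 1 ->
    0 <= a + x * (b - a) <= 1.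
  by move=> /andP[? ?] /andP[? ?] /andP[? ?]; apply/andP; split; nra.
have h1 : (0 <= (1 : R)) && ((1 : R) <= 1) by rewrite ler01 lexx.
rewrite -(ray_liftE v hk) [star_lift v]/(ray_lift v 1); split.
- have e0 : 1 + 0 * (k - 1) = 1 by rewrite mul0r addr0.
  have e1 : 1 + 1 * (k - 1) = k by rewrite mul1r addrC subrK.
  have := @path_stays U S g (fun x => ray_lift v (1 + x * (k - 1))) ev.
  rewrite e0 e1; apply.
    exact: (contcomp (@segment_continuousR _ _) c).
  move=> x hx; rewrite e; last exact: h.
  have -> : (1 + x * (k - 1)) *: v = (1 - x) *: v + x *: (k *: v).
    by rewrite scalerA -scalerDl; congr (_ *: _); lra.
  exact: HU.
- have e0 : k + 0 * (1 - k) = k by rewrite mul0r addr0.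
  have e1 : k + 1 * (1 - k) = 1 by rewrite mul1r addrC subrK.
  have := @path_stays U S g (fun x => ray_lift v (k + x * (1 - k))) ev.
  rewrite e0 e1; apply.
    exact: (contcomp (@segment_continuousR _ _) c).
  move=> x hx; rewrite e; last exact: h.
  have hx' : 0 <= 1 - x <= 1 by move: hx => /andP[? ?]; apply/andP; split; lra.
  have -> : (k + x * (1 - k)) *: v = (1 - (1 - x)) *: v + (1 - x) *: (k *: v).
    by rewrite scalerA -scalerDl; congr (_ *: _); lra.
  exact: HU.
Qed.

(* Continuity at the end of a ray is propagated along the ray from the origin. *)
Lemma star_lift_continuous : continuous star_lift.
Proof.
move=> z.
have near_lift U S g v : even_sheet p U S g -> U (f v) ->
    (\forall v' \near v, S (star_lift v')) -> star_lift v' @[v' --> v] --> star_lift v.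
  move=> [oU _ _ _ [cg _ gp]] Uv Sn.
  have Sv : S (star_lift v) by exact: nbhs_singleton Sn.
  have cfv : f v' @[v' --> v] --> f v by exact: cf.
  have gfv : g (f v') @[v' --> v] --> g (f v).
    exact: (@continuous_cvg V Z Y (nbhs v) (nbhs_filter v) f g (f v) (cg _ Uv) cfv).
  have e : star_lift v = g (f v) by rewrite -p_star_lift gp.
  rewrite e; apply: cvg_trans gfv; apply: (@near_eq_cvg _ _ _ (nbhs_filter v)).
  by apply: filterS Sn => v' Sv'; rewrite -p_star_lift gp.
pose P s := star_lift v @[v --> s *: z] --> star_lift (s *: z).
have P0 : P 0.
  rewrite /P scale0r; have [U [oU U0 HU]] := even (f 0).
  have [|S [g [Sy ev]]] := HU (star_lift 0); first by rewrite p_star_lift.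
  have [e e0 He] := near_dist cf oU U0.
  apply: (near_lift U S g) => //; apply/nbhs_ballP; exists e => // v.
  rewrite -ball_normE /= distrC => dv.
  have hs := @star_lift_stays U S g v 0 ev; rewrite scale0r in hs.
  case: hs => [||_]; [by rewrite lexx ler01| |by apply].
  by move=> x hx; apply: He; apply: ball_segment => //; rewrite subrr normr0.
suff : P 1 by rewrite /P scale1r.
apply: (@unit_induction R P) => // s0 hs0.
have [U [oU U0 HU]] := even (f (s0 *: z)).
have [e e0 He] := near_dist cf oU U0.
have [d d0 Hd] := @near_dist R^o _ (fun x : R => x *: z) s0 _ (@ray_continuous z)
  (@ball_open _ V (s0 *: z) e) (ballxx _ e0).
exists d => // s s' hs hs' /Hd ds /Hd ds' Ps.
have [->//|s'0] := eqVneq s' 0.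
move: ds ds'; rewrite -ball_normE /= ![`|s0 *: z - _|]distrC => ds ds'.
have [|S [g [Sy ev]]] := HU (star_lift (s *: z)).
  by rewrite p_star_lift; exact: He.
apply: (near_lift U S g) => //; first exact: He.
have oS : open S by case: ev.
have Sn : \forall v \near s *: z, S (star_lift v) /\ `|v - s0 *: z| < e.
  apply: filterI; first by apply: Ps; exact: open_nbhs_nbhs.
  have : nbhs (s *: z) (ball (s0 *: z) e).
    by apply: open_nbhs_nbhs; split; [exact: ball_open|rewrite -ball_normE /= distrC].
  by apply: filterS => v; rewrite -ball_normE /= distrC.
(* A point near [s' *: z] is moved along its own ray to a point near [s *: z], whose lift lies in
   [S] by continuity there; the ray between the two stays over [U]. *)
have Sn' : \forall v \near s' *: z, S (star_lift ((s / s') *: v)) /\ `|(s / s') *: v - s0 *: z| < e.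
  have ez : (s / s') *: (s' *: z) = s *: z by rewrite scalerA divfK.
  have cs : continuous (fun v : V => (s / s') *: v) by exact: scaler_continuous.
  have cs' : (s / s') *: v @[v --> s' *: z] --> s *: z by rewrite -ez; exact: cs.
  exact: (cs' _ Sn).
have Bn : \forall v \near s' *: z, `|v - s0 *: z| < e.
  have : nbhs (s' *: z) (ball (s0 *: z) e).
    by apply: open_nbhs_nbhs; split; [exact: ball_open|rewrite -ball_normE /= distrC].
  by apply: filterS => v; rewrite -ball_normE /= distrC.
apply: filterS2 Sn' Bn => v [Sv dv] dv'.
have s'p : 0 < s' by rewrite lt0r s'0; case/andP: hs'.
have /andP[s0' s1] := hs.
(* [star_lift_stays] only shrinks vectors, so it starts from the point belonging to the larger of
   [s] and [s']. *)
have [ss|ss] := leP s s'.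
  apply/(@star_lift_stays U S g v (s / s') ev) => //.
    by rewrite divr_ge0 ?(ltW s'p)//= ler_pdivrMr// mul1r.
  by move=> x hx; apply: He; exact: ball_segment.
have sp : 0 < s by exact: lt_trans ss.
have vE : v = (s' / s) *: ((s / s') *: v).
  by rewrite scalerA mulrA divfK ?gt_eqF// divff ?scale1r// gt_eqF.
have h := @star_lift_stays U S g ((s / s') *: v) (s' / s) ev; rewrite -vE in h.
apply: (h _ _).1 => //; first by rewrite divr_ge0 ?(ltW s'p) ?(ltW sp)//= ler_pdivrMr// mul1r ltW.
by move=> x hx; apply: He; exact: ball_segment.
Qed.

End PlaneLift.

End Lifting.

(** The homotopy, extended to the plane by clamping, is lifted there. Each side of the lifted square
    is identified by [lift_unique] with an evident lift: [f] on one side, constants on the other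
    three. *)
Lemma lift_null (R : realType) (Y Z : topologicalType) (p : Y -> Z) :
  continuous p ->
  (forall z, exists U : set Z, [/\ open U, U z &
     forall y, U (p y) -> exists S g, S y /\ even_sheet p U S g]) ->
  forall f : unit_interval R -> Y, continuous f ->
  homotopic (p \o f) (cst (p (f zero))) -> homotopic f (cst (f zero)).
Proof.
move=> cp even f cf [F [cF F0 F1 Fl Fr]].
pose G (v : (R^o * R^o)%type) : Z := F (clampI v.1, clampI v.2).
have cG : continuous G.
  apply: (contcomp _ cF); apply: contpair; apply: clampI_comp => x.
    exact: cvg_fst.
  exact: cvg_snd.
have pG : p (f zero) = G 0 by rewrite /G clampI0// F0.
pose L := star_lift even cG pG.
have cL : continuous L by exact: star_lift_continuous.
have pL v : p (L v) = F (clampI v.1, clampI v.2) by exact: p_star_lift.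
have L0 : L (0, 0) = f zero by exact: star_lift0.
have cid : continuous (fun x : R => x) by move=> x; exact: cvg_id.
have lineL (a b a' b' : R) : continuous (fun x : R => L (x * a + a', x * b + b')).
  have caff (c d : R) : continuous (fun x : R => x * c + d).
    rewrite (_ : (fun x => _) = fun x => c * x + d); first exact: affine_continuous.
    by apply/funext => x; rewrite mulrC.
  by apply: (contcomp _ cL); apply: contpair; exact: caff.
have uniq := @lift_unique R Y Z p cp even.
have K0 (t : unit_interval R) : L (0, val t) = f t.
  have := uniq (fun x => L (x * 0 + 0, x * val t + 0)) (fun x => f (clampI (x * val t))).
  rewrite /= !(mulr0, mul0r, mul1r, addr0) clampIK clampI0//; apply=> //.
    apply: (contcomp _ cf); apply: clampI_comp.
    rewrite (_ : (fun x => _) = fun x => val t * x + 0); first exact: affine_continuous.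
    by apply/funext => x; rewrite mulrC addr0.
  by move=> x _; rewrite pL /= !(mulr0, addr0) clampI0// F0.
have Kl (s : unit_interval R) : L (val s, 0) = f zero.
  have := uniq (fun x => L (x * val s + 0, x * 0 + 0)) (fun=> f zero).
  rewrite /= !(mulr0, mul0r, mul1r, addr0); apply=> //; first exact: cst_continuous.
  by move=> x _; rewrite pL /= !(mulr0, addr0) [clampI 0]clampI0// Fl.
have L10 : L (1, 0) = f zero by rewrite -(Kl one) val_oneI.
have K1 (t : unit_interval R) : L (1, val t) = f zero.
  have := uniq (fun x => L (x * 0 + 1, x * val t + 0)) (fun=> f zero).
  rewrite /= !(mulr0, mul0r, mul1r, addr0, add0r); apply=> //; first exact: cst_continuous.
  by move=> x _; rewrite pL /= !(mulr0, addr0, add0r) clampI1// F1.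
have L01 : L (0, 1) = f one by rewrite -(K0 one) val_oneI.
have Kr (s : unit_interval R) : L (val s, 1) = f one.
  have := uniq (fun x => L (x * val s + 0, x * 0 + 1)) (fun=> f one).
  rewrite /= !(mulr0, mul0r, mul1r, addr0, add0r); apply=> //; first exact: cst_continuous.
  by move=> x _; rewrite pL /= !(mulr0, addr0, add0r) [clampI 1]clampI1// Fr.
exists (fun st => L (val st.1, val st.2)); split=> [|t|t|s|s].
- apply: (contcomp _ cL); apply: contpair; apply: valI_comp => x; [exact: cvg_fst|exact: cvg_snd].
- by rewrite val_zeroI K0.
- by rewrite val_oneI K1.
- by rewrite val_zeroI Kl.
- by rewrite val_oneI Kr.
Qed.

(** * Paths between vertices are homotopic to edge walks *)

Section CellPaths.
Variables (R : realType) (X : sset).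
Local Notation I := (unit_interval R).
Local Notation vtx i := (@segment R _ i i zero).

(** The star of a vertex contains no other vertex, because in dimension 0 the attractor is [core],
    which tests equality of cells. *)
Lemma vertex_inj (u v : X 0) : vertex R u = vertex R v -> u = v.
Proof.
move=> uv; pose x0 := existT (fun n => X n) 0%N u.
have su : star (R := R) x0 (vertex R u).
  apply/starE; exists ord0; rewrite attract_core // /core asboolT //=.
  have -> : [forall k : 'I_1, 0 < coords (@segment R 0 ord0 ord0 zero) k].
    apply/forallP => k; rewrite (ord1 k).
    by have := coords_sum (@segment R _ (ord0 : 'I_1) ord0 zero); rewrite big_ord1 => ->.
  by rewrite invr_eq0 pnatr_eq0.
rewrite uv in su; have [k] := (starE _ _ _).1 su.
rewrite (_ : attract _ _ _ = core x0 v (coords (@segment R _ ord0 ord0 zero)))// /core.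
case: ifP; last by rewrite eqxx.
move=> /andP[/asboolP e _] _; apply/esym.
exact: (Eqdep_dec.inj_pair2_eq_dec _ PeanoNat.Nat.eq_dec _ _ _ _ e).
Qed.

Lemma simplex_map_continuous m n (theta : 'I_m.+1 -> 'I_n.+1) :
  continuous (@simplex_map R m n theta).
Proof.
move=> t; apply: (@cvg_simplex _ _ _ (nbhs_filter t)) => k; rewrite coords_map.
under eq_fun do rewrite coords_map.
apply: (@pushc_cvg _ _ _ (nbhs_filter t)) => l; exact: coords_continuous.
Qed.

Lemma simplex_homotopic n (w : X n) (c d : I -> simplex R n) :
  continuous c -> continuous d -> c zero = d zero -> c one = d one ->
  homotopic (point_of w \o c) (point_of w \o d).
Proof.
apply: homotopic_convex; last exact: point_of_continuous.
move=> x y r [x0 x1] [y0 y1] /andP[r0 r1]; split=> [i|].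
  by rewrite !mxE addr_ge0// mulr_ge0// subr_ge0.
under eq_bigr do rewrite !mxE.
by rewrite big_split /= -!mulr_sumr x1 y1; lra.
Qed.

Lemma cell_path_is_path n (w : X n) (c : I -> simplex R n) : continuous c ->
  is_path (point_of w (c zero)) (point_of w (c one)) (point_of w \o c).
Proof. by move=> cc; split=> //; exact: (contcomp cc (@point_of_continuous _ _ _ _)). Qed.

Definition line n (s t : simplex R n) (x : I) : simplex R n := mix s t (val x).

Lemma line_continuous n (s t : simplex R n) : continuous (line s t).
Proof.
move=> x; apply: (@mix_cvg _ _ _ _ (nbhs_filter x)); [exact: cvg_cst|exact: cvg_cst|].
exact: valI_continuous.
Qed.

Lemma line0 n (s t : simplex R n) : line s t zero = s.
Proof. by rewrite /line val_zeroI mix0. Qed.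

Lemma line1 n (s t : simplex R n) : line s t one = t.
Proof. by rewrite /line val_oneI mix1. Qed.

(** An index distinct from [i] and [j] allows passage to the opposite face; what remains is a
    vertex, or an edge in one of its two directions. *)
Lemma simplex_edge n (w : X n) (i j : 'I_n.+1) : exists v q v',
  [/\ vertex R v = point_of w (vtx i), is_walk v q v', vertex R v' = point_of w (vtx j)
    & homotopic (@walk_path R X v q) (point_of w \o @segment R _ i j)].
Proof.
elim: n w i j => [|n IH] w i j.
  exists w, [::], w; rewrite (ord1 i) (ord1 j); split=> //.
  rewrite (_ : _ \o _ = cst (vertex R w)).
    by apply: homotopic_refl; exact: cst_continuous.
  by apply/funext => t /=; rewrite (segment_vertex _ t zero).
have [k /andP[ki kj]|none] := pickP (fun k => (k != i) && (k != j)).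
  case: (unliftP k i) ki => [i' ->|->]; last by rewrite eqxx.
  case: (unliftP k j) kj => [j' ->|->]; last by rewrite eqxx.
  move=> _ _; have [v [q [v' [h1 h2 h3 h4]]]] := IH (face k w) i' j'.
  exists v, q, v'; split=> //.
  - by rewrite h1 point_of_face /coface simplex_map_segment.
  - by rewrite h3 point_of_face /coface simplex_map_segment.
  - apply: homotopic_trans h4 _.
    rewrite (_ : _ \o _ = point_of w \o @segment R _ (lift k i') (lift k j')).
      apply: homotopic_refl; apply: contcomp; last exact: point_of_continuous.
      exact: segment_continuous.
    by apply/funext => t /=; rewrite point_of_face /coface simplex_map_segment.
have n0 : n = 0%N.
  have : (#|[set: 'I_n.+2]%SET| <= #|[set i; j]%SET|)%N.
    apply: subset_leq_card; apply/fintype.subsetP => k _; rewrite !inE.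
    by have /negbT := none k; rewrite negb_and !negbK.
  rewrite cardsT card_ord cards2; case: (i != j) => /=; lia.
subst n; have ij : i != j.
  apply/negP => /eqP ij; have := none (if i == ord0 then ord_max else ord0).
  by rewrite -ij; case: (eqVneq i ord0) => [->//|h]; rewrite eq_sym h.
have cases k : k = ord0 \/ k = ord_max :> 'I_2.
  by case: k => -[|[|//]] h; [left|right]; exact: val_inj.
have v0 : vertex R (edge_source w) = point_of w (vtx (ord0 : 'I_2)).
  by rewrite -edge_path0 /edge_path segment0.
have v1 : vertex R (edge_target w) = point_of w (vtx (ord_max : 'I_2)).
  by rewrite -edge_path1 /edge_path segment1.
have [ei|ei] := cases i; have [ej|ej] := cases j; rewrite ei ej ?eqxx// in ij *.
  exists (edge_source w), [:: (w, true)], (edge_target w); split=> //.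
  exact: hidr (edge_is_path R w).
exists (edge_target w), [:: (w, false)], (edge_source w); split=> //.
apply: homotopic_trans (hidr (is_path_prev (edge_is_path R w))) _.
rewrite (_ : path_rev _ = point_of w \o (@segment R _ ord0 ord_max \o @revI R)); last by [].
apply: simplex_homotopic; last 2 first.
- by rewrite /= revI0 segment1 segment0.
- by rewrite /= revI1 segment1 segment0.
- exact: (contcomp (@revI_continuous R) (@segment_continuous _ _ _ _)).
- exact: segment_continuous.
Qed.

(* The condition that [unit_induction] propagates along the initial segments of
   a path in [path_homotopic_walk]. *)
Definition reaches (u : X 0) (f : I -> realization R X) n (w : X n) (t : simplex R n) :=
  exists v q (i : 'I_n.+1) (c : I -> simplex R n),
  [/\ is_walk u q v, vertex R v = point_of w (vtx i),
    [/\ continuous c, c zero = vtx i & c one = t]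
  & homotopic f (pcat (@walk_path R X u q) (point_of w \o c))].

(** The vertex and the path in [reaches] are arbitrary: a simplex is convex, and the segment between
    two of its vertices is homotopic to a walk. *)
Lemma reaches_any u f n (w : X n) (t : simplex R n) (j : 'I_n.+1) (d : I -> simplex R n) :
  reaches u f w t -> continuous d -> d zero = vtx j -> d one = t ->
  exists v q, [/\ is_walk u q v, vertex R v = point_of w (vtx j)
    & homotopic f (pcat (@walk_path R X u q) (point_of w \o d))].
Proof.
move=> [v [q [i [c [wq vi [cc c0 c1] fc]]]]] cd d0 d1.
have [v1 [q1 [v2 [h1 wq1 h2 hq1]]]] := simplex_edge w i j.
have ev : v1 = v by apply: vertex_inj; rewrite h1 vi.
subst v1; exists v2, (q ++ q1); split=> //; first exact: is_walk_cat wq wq1.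
apply: homotopic_trans fc _; apply: homotopic_sym.
have Pq := walk_is_path R wq; have Pq1 := walk_is_path R wq1.
have Pd := cell_path_is_path w cd; rewrite d0 -h2 in Pd.
have Pqq := walk_is_path R (is_walk_cat wq wq1).
apply: homotopic_trans (hpcat Pqq Pd (walk_path_cat R wq wq1) (hrefl Pd)) _.
apply: homotopic_trans (hassoc Pq Pq1 Pd) _.
apply: hpcat Pq (is_path_pcat Pq1 Pd) (hrefl Pq) _.
apply: homotopic_trans (hpcat Pq1 Pd hq1 (hrefl Pd)) _.
rewrite -pcat_comp; apply: simplex_homotopic => //.
- apply: pcat_continuous => //; first exact: segment_continuous.
  by rewrite segment1 d0.
- by rewrite pcat0 segment0 c0.
- by rewrite pcat1 d1.
Qed.

(** For the converse, the given path in the simplex of [w] need not come from that of [v];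
    [reaches_any] replaces it by the image of a segment. *)
Lemma reaches_map u f m n (v : X m) (w : X n) (theta : 'I_m.+1 -> 'I_n.+1) :
  (forall s : simplex R m, point_of v s = point_of w (simplex_map theta s)) ->
  forall t, reaches u f v t <-> reaches u f w (simplex_map theta t).
Proof.
move=> vw t; have E (c : I -> simplex R m) :
    point_of v \o c = point_of w \o (simplex_map theta \o c).
  by apply/funext => s /=; rewrite vw.
split=> [[v1 [q [i [c [wq vi [cc c0 c1] fc]]]]]|rw].
  exists v1, q, (theta i), (simplex_map theta \o c); split=> //.
  - by rewrite vi vw simplex_map_segment.
  - split; first exact: (contcomp cc (@simplex_map_continuous _ _ _)).
      by rewrite /= c0 simplex_map_segment.
    by rewrite /= c1.
  - by rewrite -E.
pose d := line (vtx (ord0 : 'I_m.+1)) t.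
have cd : continuous d by exact: line_continuous.
have [||| v1 [q [wq vi h]]] := @reaches_any u f n w _ (theta ord0) (simplex_map theta \o d) rw.
- exact: (contcomp cd (@simplex_map_continuous _ _ _)).
- by rewrite /= /d line0 simplex_map_segment.
- by rewrite /= /d line1.
exists v1, q, ord0, d; split=> //.
- by rewrite vi vw simplex_map_segment.
- by split; rewrite // /d ?line0 ?line1.
- by rewrite E.
Qed.

Lemma reaches_glue u f (a b : cells R X) : Defs.glue a b ->
  reaches u f (projT2 (projT1 a)) (projT2 a) <-> reaches u f (projT2 (projT1 b)) (projT2 b).
Proof.
elim=> [n i x t|n i x t|c|c d _ h|c d e _ h1 _ h2] /=.
- by apply: reaches_map => s; exact: point_of_face.
- by apply: reaches_map => s; exact: point_of_degen.
- by [].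
- exact: iff_sym.
- exact: (iff_trans h1 h2).
Qed.

Lemma reaches_point u f m n (v : X m) (s : simplex R m) (w : X n) (t : simplex R n) :
  point_of v s = point_of w t -> reaches u f v s -> reaches u f w t.
Proof. by move=> /pi_glueP g; exact: (reaches_glue u f g).1. Qed.

Lemma reaches_homotopic u f g n (w : X n) (t : simplex R n) : homotopic f g ->
  reaches u f w t -> reaches u g w t.
Proof.
move=> fg [v [q [i [c [h1 h2 h3 h4]]]]]; exists v, q, i, c; split=> //.
exact: homotopic_trans (homotopic_sym fg) h4.
Qed.

Lemma reaches_end u f n (w : X n) (t : simplex R n) : reaches u f w t ->
  f one = point_of w t.
Proof.
by move=> [v [q [i [c [_ _ [_ _ <-] /homotopic_ends[_ ->]]]]]]; rewrite pcat1.
Qed.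

Lemma reaches_step u f n (w : X n) (c : I -> simplex R n) : continuous c ->
  reaches u f w (c zero) -> reaches u (pcat f (point_of w \o c)) w (c one).
Proof.
move=> cc /[dup] /reaches_end fe [v [q [i [d [wq vi [cd d0 d1] fd]]]]].
exists v, q, i, (pcat d c); split=> //.
  by split; [exact: pcat_continuous|rewrite pcat0|rewrite pcat1].
have Pc := cell_path_is_path w cc; have Pd := cell_path_is_path w cd.
have Pq := walk_is_path R wq; rewrite d0 -vi in Pd; rewrite -d1 in Pc.
apply: homotopic_trans (homotopic_pcat fd (hrefl Pc) _) _.
  by rewrite fe.
by rewrite pcat_comp; exact: hassoc Pq Pd Pc.
Qed.

End CellPaths.

(** * Approximation of paths by edge walks *)

Section EdgeApproximation.
Variables (R : realType) (X : sset).
Local Notation I := (unit_interval R).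

Lemma drift_cvg (x0 : {n & X n}) (S : Type) (F : set_system S) {FF : Filter F}
    (a : S -> realization R X) (r : S -> R) (z : realization R X) (r0 : R) : star x0 z ->
  a s @[s --> F] --> z -> r s @[s --> F] --> r0 ->
  drift x0 (a s) (r s) @[s --> F] --> drift x0 z r0.
Proof.
move=> sz ca cr; have h := @drift_continuous R X x0 z r0 sz.
have hp : (a s, r s) @[s --> F] --> (z, r0).
  exact: (@cvg_pair _ _ _ F (nbhs z) (nbhs r0) FF (nbhs_filter z) (nbhs_filter r0) _ _ ca cr).
exact: (cvg_comp _ _ hp h).
Qed.

Definition track (x0 : {n & X n}) (z : realization R X) (r : I) : realization R X :=
  drift x0 z (val r).

Lemma track_is_path x0 (z : realization R X) : star x0 z ->
  is_path z (star_center R x0) (track x0 z).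
Proof.
move=> sz; split; last 2 first.
- by rewrite /track val_zeroI drift0.
- by rewrite /track val_oneI drift1.
move=> r; apply: (@drift_cvg x0 _ _ (nbhs_filter r)) => //; first exact: cvg_cst.
exact: valI_continuous.
Qed.

(** The two routes are images under [K] of plane paths with common ends: the bottom of a square, and
    its other three sides, of which the top is collapsed to the center. *)
Lemma track_square x0 (d : I -> realization R X) : continuous d ->
  (forall x, star x0 (d x)) ->
  homotopic d (pcat (track x0 (d zero)) (path_rev (track x0 (d one)))).
Proof.
move=> cd sd; pose V : normedModType R := (R^o * R^o)%type.
(* The plane appears as the full subset of itself to fit [homotopic_convex]. *)
pose inV (v : V) : set_type [set: V] := SigSub (in_setT v).
have cinV (u : I -> V) : continuous u -> continuous (inV \o u).
  by move=> cu; apply: continuous_to_set.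
pose K (v : set_type [set: V]) := drift x0 (d (clampI (set_val v).1)) (set_val v).2.
have cK : continuous K.
  apply: (@contcomp _ _ _ set_val (fun v : V => drift x0 (d (clampI v.1)) v.2)).
    exact: val_continuous_set.
  move=> v; apply: (@drift_cvg x0 _ _ (nbhs_filter v)); [exact: sd| |exact: cvg_snd].
  have c1 : continuous (fun v : V => clampI v.1) by apply: clampI_comp => x; exact: cvg_fst.
  exact: (contcomp c1 cd).
pose bottom (t : I) : V := (val t, 0); pose left (t : I) : V := (0, val t).
pose top (t : I) : V := (val t, 1); pose right (t : I) : V := (1, 1 - val t).
have cval := @valI_continuous R.
have cc (a : R) : continuous (fun _ : I => a : R^o) by exact: cst_continuous.
have cb : continuous bottom by apply: contpair => //; exact: cc.
have cl : continuous left by apply: contpair => //; exact: cc.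
have ct : continuous top by apply: contpair => //; exact: cc.
have cr : continuous right.
  apply: contpair; first exact: cc.
  rewrite (_ : (fun t => _) = fun t : I => (- 1) * val t + 1).
    exact: (affine_continuous cval).
  by apply/funext => t; lra.
have dK : d = K \o (inV \o bottom).
  by apply/funext => t; rewrite /K /= clampIK drift0.
have lK : K \o (inV \o left) = track x0 (d zero).
  by apply/funext => t; rewrite /K /= clampI0.
have tK : K \o (inV \o top) = cst (star_center R x0).
  by apply/funext => t; rewrite /K /= clampIK drift1.
have rK : K \o (inV \o right) = path_rev (track x0 (d one)).
  apply/funext => t; transitivity (drift x0 (d one) (val (revI t))); last by [].
  by rewrite val_revI /K /= [clampI 1]clampI1.
have Pl := track_is_path (sd zero).
have Pr := is_path_prev (track_is_path (sd one)).
apply: homotopic_trans _ (hpcat Pl (is_path_pcat (is_path_cst _ _) Pr) (hrefl Pl) (hidl Pr)).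
rewrite -lK -tK -rK -!pcat_comp {1}dK.
have ctr : continuous (pcat top right).
  by apply: pcat_continuous => //; rewrite /top /right val_oneI val_zeroI subr0.
apply: homotopic_convex => //.
- exact: cinV.
- apply: cinV; apply: pcat_continuous => //.
  by rewrite pcat0 /top /left val_oneI val_zeroI.
- by rewrite /= pcat0; congr inV; rewrite /bottom /left val_zeroI.
- by rewrite /= !pcat1; congr inV; rewrite /bottom /right val_oneI subrr.
Qed.

Lemma track_cell x0 (z : realization R X) :
  track x0 z = point_of (projT2 (projT1 (repr z))) \o
    line (projT2 (repr z)) (target x0 (projT2 (projT1 (repr z))) (projT2 (repr z))).
Proof. by []. Qed.

Theorem path_homotopic_walk (u v : X 0) (f : I -> realization R X) :
  is_path (vertex R u) (vertex R v) f ->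
  exists2 q, is_walk u q v & homotopic f (@walk_path R X u q).
Proof.
move=> [cf f0 f1].
pose initial (s : R) (x : I) := f (clampI (s * val x)).
pose between (s s' : R) (x : I) := f (clampI (s + val x * (s' - s))).
have cs (s : R) : continuous (fun x : I => clampI (s * val x)).
  by apply: clampI_comp; exact: (Defs.scale_continuous (@valI_continuous R)).
have cb (s s' : R) : continuous (fun x : I => clampI (s + val x * (s' - s))).
  apply: clampI_comp; rewrite (_ : (fun x => _) = fun x : I => (s' - s) * val x + s).
    exact: (affine_continuous (@valI_continuous R)).
  by apply/funext => x; rewrite addrC mulrC.
pose P s := reaches u (initial s) (projT2 (projT1 (repr (f (clampI s)))))
  (projT2 (repr (f (clampI s)))).
have reprP z : point_of (projT2 (projT1 (repr z))) (projT2 (repr z)) = z :> realization R X.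
  by rewrite -[RHS]reprK /point_of; congr (\pi_(realization R X) _); case: (repr z) => -[].
have P0 : P 0.
  apply: (@reaches_point _ _ _ _ _ _ u (segment ord0 ord0 zero)).
    by rewrite reprP clampI0// f0.
  exists u, [::], ord0, (cst (segment ord0 ord0 zero)); split=> //.
    by split=> //; exact: cst_continuous.
  have -> : initial 0 = cst (vertex R u).
    by apply/funext => x; rewrite /initial mul0r clampI0// f0.
  exact: homotopic_sym (hidl (is_path_cst _ _)).
have P1 : P 1.
  apply: (unit_induction _ P0) => s0 hs0.
  have [x0 _ sz] := star_cover (f (clampI s0)).
  have [e e0 He] := @near_dist R R^o _ (f \o @clampI R) s0 _
    (contcomp (@clampI_continuous R) cf) (@open_star R X x0) sz.
  exists e => // s s' hs hs' ds ds' Ps.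
  have cbf : continuous (between s s') by exact: (contcomp (cb s s') cf).
  have b0 : between s s' zero = f (clampI s) by rewrite /between val_zeroI mul0r addr0.
  have b1 : between s s' one = f (clampI s').
    by rewrite /between val_oneI mul1r addrC subrK.
  have sb x : star x0 (between s s' x).
    have hx := valI_itv x.
    have -> : between s s' x =
        (f \o @clampI R) ((1 - val x) *: (s : R^o) + val x *: (s' : R^o)).
      by rewrite /between /= /GRing.scale /=; congr (f (clampI _)); lra.
    by apply: He; exact: (@ball_segment R R^o).
  have hb := track_square cbf sb; rewrite b0 b1 in hb.
  pose z := f (clampI s); pose z' := f (clampI s').
  have sz1 : star x0 z by rewrite /z -b0; exact: sb.
  have sz2 : star x0 z' by rewrite /z' -b1; exact: sb.
  have Pi : is_path (f (clampI 0)) z (initial s).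
    split; first exact: (contcomp (cs s) cf).
      by rewrite /initial val_zeroI mulr0.
    by rewrite /initial val_oneI mulr1.
  have step1 : reaches u (pcat (initial s) (track x0 z)) (projT2 (projT1 (repr z)))
      (target x0 (projT2 (projT1 (repr z))) (projT2 (repr z))).
    rewrite track_cell; set c := line _ _.
    have := @reaches_step _ _ u (initial s) _ (projT2 (projT1 (repr z))) c
      (@line_continuous _ _ _ _).
    by rewrite /c line0 line1; apply.
  (* This changes simplex at the center of the star: both simplices have a point over it, and
     [reaches] depends only on the point of the realization. *)
  have step2 : reaches u (pcat (initial s) (track x0 z)) (projT2 (projT1 (repr z')))
      (target x0 (projT2 (projT1 (repr z'))) (projT2 (repr z'))).
    apply: reaches_point step1.
    by rewrite !point_of_target//; apply/starE; rewrite reprP.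
  have step3 : reaches u (pcat (pcat (initial s) (track x0 z)) (path_rev (track x0 z')))
      (projT2 (projT1 (repr z'))) (projT2 (repr z')).
    rewrite (track_cell x0 z'); set c := line _ _.
    have cc : continuous (path_rev c) by apply: prev_continuous; exact: line_continuous.
    have := @reaches_step _ _ u _ _ (projT2 (projT1 (repr z'))) (path_rev c) cc.
    by rewrite prev0 prev1 /c line0 line1; apply.
  apply: reaches_homotopic step3.
  have Pz := track_is_path sz1; have Pz' := is_path_prev (track_is_path sz2).
  apply: homotopic_trans (hassoc Pi Pz Pz') _.
  apply: homotopic_trans (hpcat Pi (is_path_pcat Pz Pz') (hrefl Pi) (homotopic_sym hb)) _.
  rewrite [initial s](_ : _ = f \o (fun x : I => clampI (s * val x)))//.
  rewrite [between s s'](_ : _ = f \o (fun x : I => clampI (s + val x * (s' - s))))//.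
  rewrite -pcat_comp; apply: homotopic_reparam => //.
  - by apply: pcat_continuous => //; rewrite val_oneI val_zeroI mulr1 mul0r addr0.
  - by rewrite pcat0 !val_zeroI !mulr0.
  - by rewrite pcat1 !val_oneI mul1r mulr1 addrC subrK.
have i1 : initial 1 = f by apply/funext => x; rewrite /initial mul1r clampIK.
rewrite /P i1 in P1.
have : reaches u f v (segment ord0 ord0 zero).
  by apply: reaches_point P1; rewrite reprP clampI1.
move=> [v1 [q [i [c [wq vi [cc c0 c1] h]]]]]; rewrite (ord1 i) in vi c0.
have ev : v1 = v by exact: vertex_inj vi.
subst v1; exists q => //; apply: homotopic_trans h _.
have -> : point_of v \o c = cst (vertex R v).
  apply/funext => x /=; congr point_of; apply: coords_inj; apply/funext => k.
  have := coords_sum (c x); have := coords_sum (@segment R 0 ord0 ord0 zero).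
  by rewrite !big_ord1 (ord1 k) => -> ->.
exact: hidr (walk_is_path R wq).
Qed.

End EdgeApproximation.

(** * The twisted set *)

Section PathConnected.
Variables (R : realType) (X : sset).
Local Notation I := (unit_interval R).

Lemma vertex_path (z : realization R X) :
  exists v (f : I -> realization R X), is_path (vertex R v) z f.
Proof.
have [n [w [t ->]]] := point_ofP z.
have [v [_ [_ [ev _ _ _]]]] := @simplex_edge R X n w ord0 ord0.
exists v, (point_of w \o line (@segment R _ ord0 ord0 zero) t).
have := cell_path_is_path w (@line_continuous R n (@segment R _ ord0 ord0 zero) t).
by rewrite line0 line1 -ev.
Qed.

Lemma realization_path_connected (v : X 0) : sset_connected X ->
  path_connected R (realization R X).
Proof.
move=> cX; split; first by exists (vertex R v).
move=> x y; have [u [f Pf]] := vertex_path x; have [w [g Pg]] := vertex_path y.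
have [p wp] := cX u w.
have [c c0 c1] := is_path_pcat (is_path_prev Pf) (is_path_pcat (walk_is_path R wp) Pg).
have q : {path unit_interval R from x to y in realization R X} := mk_path c c0 c1.
exact: inhabits q.
Qed.

End PathConnected.

(** * Loop classes and conjugation *)

Section LoopClasses.
Variables (R : realType) (T : topologicalType).
Local Notation I := (unit_interval R).

Definition class_of_loop (x : T) (f : I -> T) (P : is_path x x f) : fundamental_group R x :=
  let: And3 c l r := P in loop_class c l r.

Lemma class_of_loopP x f g (P : is_path x x f) (Q : is_path x x g) :
  class_of_loop P = class_of_loop Q <-> homotopic f g.
Proof. by case: P => c l r; case: Q => c' l' r'; exact: loop_classP. Qed.

Lemma class_of_loop1 x f (P : is_path x x f) :
  class_of_loop P = 1%g <-> homotopic f (cst x).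
Proof. by case: P => c l r; exact: loop_classP. Qed.

Lemma class_of_loopM x f g h (P : is_path x x f) (Q : is_path x x g) (S : is_path x x h) :
  homotopic (pcat f g) h -> (class_of_loop P * class_of_loop Q)%g = class_of_loop S.
Proof. by case: P => c l r; case: Q => c' l' r'; case: S => ? ? ?; exact: fg_mulE. Qed.

Lemma class_of_loop_repr x (a : fundamental_group R x) :
  exists f (P : is_path x x f), a = class_of_loop P.
Proof.
exists (repr a : I -> T), (And3 (@cts_fun _ _ (repr a)) (path_zero (s := repr a))
  (path_one (s := repr a))); exact: loop_class_repr.
Qed.

Lemma conj_cancel (x y z w v u : T) (f g h k l : I -> T) :
  is_path x y f -> is_path y z g -> is_path w z h -> is_path z v k -> is_path v u l ->
  homotopic (pcat (pcat f (pcat g (path_rev h))) (pcat h (pcat k l)))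
    (pcat f (pcat (pcat g k) l)).
Proof.
move=> Pf Pg Ph Pk Pl; have Ph' := is_path_prev Ph; have Pkl := is_path_pcat Pk Pl.
apply: homotopic_trans (hassoc Pf (is_path_pcat Pg Ph') (is_path_pcat Ph Pkl)) _.
apply: hpcat Pf (is_path_pcat (is_path_pcat Pg Ph') (is_path_pcat Ph Pkl)) (hrefl Pf) _.
apply: homotopic_trans (hassoc Pg Ph' (is_path_pcat Ph Pkl)) _.
have Ph'hkl := is_path_pcat Ph' (is_path_pcat Ph Pkl).
apply: homotopic_trans (hpcat Pg Ph'hkl (hrefl Pg) (hcancel Ph Pkl)) _.
exact: homotopic_sym (hassoc Pg Pk Pl).
Qed.

Lemma conj_null (x y : T) (f g : I -> T) : is_path x y g -> is_path y y f ->
  homotopic (pcat g (pcat f (path_rev g))) (cst x) -> homotopic f (cst y).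
Proof.
move=> Pg Pf h; have Pg' := is_path_prev Pg; have Pfg := is_path_pcat Pf Pg'.
have h1 : homotopic (pcat f (path_rev g)) (path_rev g).
  apply: homotopic_trans (homotopic_sym (hcancel Pg Pfg)) _.
  apply: homotopic_trans (hidr Pg').
  exact: hpcat Pg' (is_path_pcat Pg Pfg) (hrefl Pg') h.
apply: homotopic_trans (homotopic_sym (hidr Pf)) _.
apply: homotopic_trans (hpcat Pf (is_path_cst R y) (hrefl Pf) (homotopic_sym (hinvl Pg))) _.
apply: homotopic_trans (homotopic_sym (hassoc Pf Pg' Pg)) _.
apply: homotopic_trans (hpcat Pfg Pg h1 (hrefl Pg)) _.
exact: hinvl Pg.
Qed.

End LoopClasses.

(** * Walks in the twisted set and their weights *)

Section TwistedWalks.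
Variables (X : sset) (H : groupType) (t : forall n, X n -> H).
Hypothesis twt : twisting t.
Local Notation tX := (twisted_sset twt).
Local Open Scope group_scope.

Definition arc_weight (a : oriented_edge X) : H := if a.2 then t a.1 else (t a.1)^-1.

Definition walk_weight (p : seq (oriented_edge X)) : H :=
  foldr (fun a h => arc_weight a * h) 1 p.

(** The twist sits on the last face, which for an edge is its source: the lift [(h, e)] runs from
    level [h * (t e)^-1] to level [h]. This fixes the label of each lifted arc. *)
Lemma twisted_walk u p v k : is_walk u p v ->
  exists q, @is_walk tX (k, u) q (k * walk_weight p, v).
Proof.
elim: p u k => [|[e b] p IH] u k /=; first by move=> ->; exists [::]; rewrite mulg1.
rewrite /arc_source /arc_target /= => -[<- wp].
rewrite /arc_weight mulgA; case: b wp => /= wp.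
  have [q wq] := IH _ (k * t e) wp; exists (((k * t e, e) : tX 1%N, true) :: q).
  by split; [exact: (congr2 pair (mulgK (t e) k) erefl)|exact: wq].
have [q wq] := IH _ (k * (t e)^-1) wp; exists (((k, e) : tX 1%N, false) :: q).
by split; last exact: wq.
Qed.

Lemma twisted_walk_proj (R : realType) (x : tX 0%N) q y : is_walk x q y ->
  exists p, [/\ is_walk x.2 p y.2, y.1 = x.1 * walk_weight p
    & realization_map (R := R) (twisted_proj twt) \o @walk_path R tX x q =
      @walk_path R X x.2 p].
Proof.
elim: q x => [|[[h e] b] q IH] x /=.
  move=> ->; exists [::]; split=> //=; first by rewrite mulg1.
  by apply/funext => s /=; rewrite /vertex realization_mapE.
move=> -[sx /IH[p [wp yp pp]]]; exists ((e, b) :: p); split=> /=.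
- rewrite -sx; split; last by move: wp; rewrite /arc_target /=; case: b {sx pp yp}.
  by rewrite /arc_source /=; case: b {sx wp pp yp}.
- rewrite yp -sx /arc_source /arc_target /arc_weight /=; case: b {sx wp pp yp} => /=.
    by rewrite mulgA mulgVK.
  by rewrite mulgA.
- rewrite pcat_comp; congr pcat.
    rewrite /arc_path /=; case: b {sx wp pp yp}; apply/funext => s.
      by rewrite /= /edge_path realization_mapE.
    by rewrite /path_rev /= /edge_path realization_mapE.
  rewrite pp; congr walk_path.
  by rewrite /arc_target /=; case: b {sx wp pp yp}.
Qed.

End TwistedWalks.

Section TwistedRealization.
Variables (R : realType) (X : sset) (H : groupType) (t : forall n, X n -> H).
Hypothesis twt : twisting t.
Local Notation tX := (twisted_sset twt).
Local Notation p := (realization_map (R := R) (twisted_proj twt)).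

Lemma twisted_even (z : realization R X) : exists U : set (realization R X),
  [/\ open U, U z & forall y, U (p y) -> exists S g, S y /\ even_sheet p U S g].
Proof.
have [x0 _ sz] := star_cover z; exists (star x0); split=> //; first exact: open_star.
move=> y /sheet_cover[h sy]; exists (@sheet R X H t twt x0 h), (section_at twt x0 h).
by split=> //; exact: even_sheetP.
Qed.

Lemma twisted_covering : path_connected R (realization R tX) ->
  path_connected R (realization R X) -> covering_map R p.
Proof.
move=> ctX cX; split=> //; first exact: realization_map_continuous.
move=> z; have [x0 _ sz] := star_cover z; exists (star x0).
  by apply: open_nbhs_nbhs; split=> //; exact: open_star.
exists H, (@sheet R X H t twt x0); have even h := even_sheetP R twt x0 h; split.
- apply/seteqP; split=> y /=; first by move=> /sheet_cover[h sy]; exists h.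
  by move=> [h _ sy]; exact: sheet_star sy.
- by move=> h h' _ _ [y [sy sy']]; exact: sheet_disjoint sy sy'.
- move=> h; exists (@sheet R X H t twt x0 h); first exact: open_sheet.
  by apply/esym/setIidr; have [] := even h.
- move=> h; have [oU oS SU _ [cg gP gK]] := even h; split.
  + split=> [y sy|y y'|u Uu]; first exact: SU.
      by rewrite !inE => sy sy'; exact: sheet_inj sy sy'.
    by have [sg pg] := gP u Uu; exists (section_at twt x0 h u).
  + by apply: continuous_subspaceT; exact: realization_map_continuous.
  + exists (section_at twt x0 h); split; last by move=> y; rewrite inE => /gK.
    by apply: continuous_in_subspaceT => u; rewrite inE => /cg.
Qed.

End TwistedRealization.

(** * Weights as values of [chi] *)

Section TauWalks.
Variables (R : realType) (X : sset) (T : set (X 1%N)) (vs : X 0%N).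
Hypotheses (cX : sset_connected X) (mT : maximal_tree T).
Variables (H : groupType) (chi : {multiplicative fundamental_group R (vertex R vs) -> H}).
Local Notation weight := (walk_weight (tau cX mT chi)).
Local Notation branch v := (@walk_path R X vs (tree_path vs cX mT v)).

(** Closing up by tree branches, as in [edge_loop], makes the weight formula provable by induction
    on walks that are not closed. *)
Definition conj_walk (u : X 0%N) p (v : X 0%N) :=
  pcat (branch u) (pcat (@walk_path R X u p) (path_rev (branch v))).

Lemma conj_walk_is_path u p v : is_walk u p v ->
  is_path (vertex R vs) (vertex R vs) (conj_walk u p v).
Proof.
move=> wp; apply: is_path_pcat (tree_path_is_path R vs cX mT u) _.
apply: is_path_pcat (walk_is_path R wp) _.
exact: is_path_prev (tree_path_is_path R vs cX mT v).
Qed.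

Lemma tau'_class (e : X 1%N) :
  tau' R vs cX mT e = class_of_loop (edge_loop_is_path R vs cX mT e).
Proof. by []. Qed.

(** For a reversed edge, the loop is the reverse of [edge_loop] up to association, so its class is
    inverse to [tau' e]. *)
Lemma chi_arc a (P : is_path (vertex R vs) (vertex R vs)
    (pcat (branch (arc_source a)) (pcat (@arc_path R X a) (path_rev (branch (arc_target a)))))) :
  chi (class_of_loop P) = arc_weight (tau cX mT chi) a.
Proof.
case: a P => e [] P.
  rewrite -[RHS]/(tau cX mT chi e) tau1E tau'_class; congr (chi _).
  by apply/class_of_loopP; case: P => cP _ _; exact: homotopic_refl.
have PT := tree_path_is_path R vs cX mT (edge_source e).
have PT' := tree_path_is_path R vs cX mT (edge_target e).
have Pe := edge_is_path R e; have PL := edge_loop_is_path R vs cX mT e.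
rewrite -[RHS]/((tau cX mT chi e)^-1)%g.
suff h : (class_of_loop P * tau' R vs cX mT e)%g = 1%g.
  apply: (@mulIg H (tau cX mT chi e)); rewrite mulVg tau1E -gmulfM h.
  exact: chi1.
rewrite tau'_class (class_of_loopM _ _ (is_path_cst R _)).
  exact/class_of_loop1/homotopic_refl/cst_continuous.
apply: homotopic_trans (hinvl PL); apply: homotopic_pcat; last 1 first.
- by case: P PL => _ _ -> [_ -> _].
- rewrite /edge_loop (prev_pcat PT (is_path_pcat Pe (is_path_prev PT'))).
  rewrite (prev_pcat Pe (is_path_prev PT')) prevK.
  exact: homotopic_sym (hassoc PT' (is_path_prev Pe) (is_path_prev PT)).
- exact: hrefl PL.
Qed.

Lemma chi_conj_walk u p v (P : is_path (vertex R vs) (vertex R vs) (conj_walk u p v)) :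
  is_walk u p v -> chi (class_of_loop P) = weight p.
Proof.
elim: p u P => [|a p IH] u P wp.
  have [c _ _] := P; move: P; rewrite -wp => P.
  have Pu := tree_path_is_path R vs cX mT u; have Pr := is_path_prev Pu.
  rewrite -[RHS](chi1 chi); congr (chi _); apply/class_of_loop1.
  apply: homotopic_trans (hinvr Pu).
  exact: hpcat Pu (is_path_pcat (is_path_cst _ _) Pr) (hrefl Pu) (hidl Pr).
case: wp => au wp; subst u.
have Ps := tree_path_is_path R vs cX mT (arc_source a).
have Pt := tree_path_is_path R vs cX mT (arc_target a).
have Pv := is_path_prev (tree_path_is_path R vs cX mT v).
have Pa := arc_is_path R a; have Pp := walk_is_path R wp.
have P1 := is_path_pcat Ps (is_path_pcat Pa (is_path_prev Pt)).
have P2 := conj_walk_is_path wp.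
rewrite [RHS]/= -(chi_arc P1) -(IH _ P2 wp) -gmulfM; congr (chi _).
apply/esym/class_of_loopM; exact: conj_cancel Ps Pa Pt Pp Pv.
Qed.

(** The branch at the base vertex is a chosen closed walk in the tree, perhaps not empty, but
    null-homotopic by [tree_walk_null]. *)
Lemma chi_walk p (P : is_path (vertex R vs) (vertex R vs) (@walk_path R X vs p)) :
  is_walk vs p vs -> chi (class_of_loop P) = weight p.
Proof.
move=> wp; rewrite -(chi_conj_walk (conj_walk_is_path wp) wp); congr (chi _).
apply/class_of_loopP; have [V tV _] := mT.
have null := tree_walk_null R tV (tree_pathP vs cX mT vs).
have Pb := tree_path_is_path R vs cX mT vs; have Pb' := is_path_prev Pb.
have null' := homotopic_prev null; apply: homotopic_sym.
apply: homotopic_trans (hpcat Pb (is_path_pcat P Pb') null (hpcat P Pb' (hrefl P) null')) _.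
rewrite (_ : path_rev (cst _) = cst (vertex R vs)); last by apply/funext.
have Pc := is_path_cst R (vertex R vs).
exact: homotopic_trans (hidl (is_path_pcat P Pc)) (hidr P).
Qed.

End TauWalks.

Theorem proposition3p8 (R : realType) (X : sset) (vs : X 0%N)
    (cX : sset_connected X) (T : set (X 1%N)) (mT : maximal_tree T)
    (H : groupType)
    (chi : {multiplicative fundamental_group R (vertex R vs) -> H})
    (chi_surjective : forall h : H, exists a, chi a = h)
    (chi_isomorphism : bijective chi) :
  universal_covering_map R (realization_map (R := R) (twisted_cover_proj cX mT chi)).
Proof.
pose tX := twisted_cover cX mT chi; pose twt := tau_twisting cX mT chi.
pose x1 : tX 0%N := (1%g, vs).
have reach (x : tX 0%N) : exists q, is_walk x1 q x.
  case: x => k u; have [q wq] := cX vs u.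
  (* The lift of [q] multiplies the level by its weight, so it must start at level [h] to end at
     [k]; a closed walk of weight [h] leads there from level 1. *)
  pose h := (k * (walk_weight (tau cX mT chi) q)^-1)%g.
  have [a ah] := chi_surjective h.
  have [f [Pf af]] := class_of_loop_repr a.
  have [p wp fp] := path_homotopic_walk Pf.
  have Pp := walk_is_path R wp.
  have hp : walk_weight (tau cX mT chi) p = h.
    rewrite -(chi_walk cX mT chi Pp wp) -ah af; congr (chi _).
    exact/class_of_loopP/homotopic_sym.
  have [p' wp'] := twisted_walk twt 1%g wp.
  have [q' wq'] := twisted_walk twt h wq.
  exists (p' ++ q'); rewrite mul1g hp in wp'.
  by have := is_walk_cat wp' wq'; rewrite /h mulgVK.
have ctX : sset_connected tX.
  move=> x y; have [p wp] := reach x; have [q wq] := reach y.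
  by exists (walk_inv p ++ q); exact: is_walk_cat (is_walk_inv wp) wq.
have ptX := realization_path_connected R x1 ctX.
split; first exact: twisted_covering ptX (realization_path_connected R vs cX).
split=> // x a; have [f [Pf ->]] := class_of_loop_repr a; apply/class_of_loop1.
have [g] := ptX.2 (vertex R x1) x.
have Pg : is_path (vertex R x1) x g.
  by split; [exact: cts_fun|exact: path_zero|exact: path_one].
(* Edge approximation concerns paths between vertices, so a loop at an arbitrary point is first
   moved to [x1]. *)
apply: (conj_null Pg Pf).
have PL := is_path_pcat Pg (is_path_pcat Pf (is_path_prev Pg)).
have [q wq hq] := path_homotopic_walk PL; apply: homotopic_trans hq _.
(* A closed walk upstairs returns to level 1, so its projection has weight 1. *)
have [p [wp /= e pq]] := twisted_walk_proj R wq.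
have Pp := walk_is_path R wp.
have null : homotopic (@walk_path R X vs p) (cst (vertex R vs)).
  apply/(class_of_loop1 Pp); apply: (bij_inj chi_isomorphism).
  rewrite (chi_walk cX mT chi Pp wp) chi1.
  by apply: (@mulgI H 1%g); rewrite -e mulg1.
have [cq q0 _] := walk_is_path R wq.
have := @lift_null R _ _ _ (@realization_map_continuous R _ _ (twisted_proj twt))
  (@twisted_even R X H _ twt) _ cq.
rewrite q0 pq /vertex realization_mapE; exact.
Qed.
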